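(* Let $N\in\mathbb{N}$, $0<\alpha<1$ and $h>0$. Then there is a constant $C_p$, independent of $n$ and $h$, such that $$\|\nabla\mathcal{G}^{\alpha}_{n,h}\|_p\le C_p\frac{1}{(nh)^{\frac{\alpha N}{2}(1-1/p)+\frac{\alpha}{2}}},\qquad n\in\mathbb{N},$$ for $p\in[1,\infty)$ if $N=1$, and for $p\in[1,\frac{N}{N-1})$ if $N>1$.
   Context: Here $\mathbb{N}=\{1,2,\dots\}$, $\mathbb{N}_0=\{0,1,2,\dots\}$, $\nabla$ is the gradient in $x\in\mathbb{R}^N$, and $\|\cdot\|_p$ is the norm of $L^p(\mathbb{R}^N)$ (for vector fields, of their Euclidean length). Discrete scaled Wright function: for $0<\alpha<1$, $\beta\ge0$, $h>0$, $n,j\in\mathbb{N}_0$, $$\varphi^h_{\alpha,\beta}(n,j)=\frac{1}{2\pi i}\int_{\Upsilon}\frac{1}{z^{n+1}}\frac{\left(1-h(\frac{1-z}{h})^{\alpha}\right)^{j}}{(\frac{1-z}{h})^{\beta}}\,dz,$$ where $\Upsilon$ is the positively oriented circle centred at $0$ of radius $r\in(0,1)$ (principal powers). Gaussian kernel: $G_t(x)=(4\pi t)^{-N/2}e^{-|x|^2/(4t)}$, $t>0$, $x\in\mathbb{R}^N$. Discrete Gaussian kernel: $\mathcal{G}_{n,h}(x)=\frac{1}{h^n\Gamma(n)}\int_0^\infty e^{-t/h}t^{n-1}G_t(x)\,dt$, $n\in\mathbb{N}$. Fundamental solution: $$\mathcal{G}^{\alpha}_{n,h}(x)=\sum_{j=1}^{\infty}\varphi^h_{\alpha,1-\alpha}(n-1,j-1)\,\mathcal{G}_{j,h}(x),\quad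 n\in\mathbb{N}.$$ *)

(* Defs.v *)
From HB Require Import structures.
From mathcomp Require Import all_boot all_order all_algebra.
From mathcomp Require Import complex.
From mathcomp Require Import all_classical all_reals all_analysis.

Set Implicit Arguments.
Unset Strict Implicit.
Unset Printing Implicit Defensive.

Import Order.TTheory GRing.Theory Num.Theory.
Import numFieldNormedType.Exports.

Local Open Scope classical_set_scope.
Local Open Scope ring_scope.

(** Lebesgue measure on R^n, carried by [n.-tuple R] with the product
    sigma-algebra of the library, obtained by iterating the product measure;
    [lebesgueN_box] gives its values on boxes. *)

Section LebesgueN.
Context {R : realType}.
Local Notation RT := (measurableTypeR R).

Definition tcons n (u : RT * n.-tuple RT) : n.+1.-tuple RT :=
  [tuple of u.1 :: u.2].

Lemma measurable_tcons n : measurable_fun [set: RT * n.-tuple RT] (@tcons n).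
Proof. exact: measurable_cons. Qed.

Section step.
Context n (m : {sigma_finite_measure set (n.-tuple RT) -> \bar R}).

Let prodm : {measure set (RT * n.-tuple RT)%type -> \bar R} :=
  (@lebesgue_measure R \x m)%E.

Definition lebesgue_tcons : set (n.+1.-tuple RT) -> \bar R :=
  pushforward (@lebesgue_measure R \x m)%E (@tcons n).

Let pm : {measure set (n.+1.-tuple RT) -> \bar R} :=
  measure_function_pushforward__canonical__measure_function_Measure prodm
    (@measurable_tcons n).

Let lebesgue_tcons0 : lebesgue_tcons set0 = 0%E.
Proof. exact: (measure0 pm). Qed.

Let lebesgue_tcons_ge0 A : (0 <= lebesgue_tcons A)%E.
Proof. exact: (measure_ge0 pm). Qed.

Let lebesgue_tcons_sigma_additive : semi_sigma_additive lebesgue_tcons.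
Proof. exact: (@measure_semi_sigma_additive _ _ _ pm). Qed.

HB.instance Definition _ := isMeasure.Build _ _ _ lebesgue_tcons
  lebesgue_tcons0 lebesgue_tcons_ge0 lebesgue_tcons_sigma_additive.

Let thead_behead_meas : measurable_fun [set: n.+1.-tuple RT]
  (fun t : n.+1.-tuple RT => (thead t, [tuple of behead t]) : RT * n.-tuple RT).
Proof.
apply/measurable_fun_pair => /=.
  exact: (@measurable_tnth _ RT n.+1 ord0).
exact: (@measurable_behead _ RT n).
Qed.

Let prodm_sigma_finite : sigma_finite setT prodm.
Proof.
have /sigma_finiteP[F [TF ndF Foo]] := sigma_finiteT (@lebesgue_measure R).
have /sigma_finiteP[G [TG ndG Goo]] := sigma_finiteT m.
exists (fun k => F k `*` G k).
  rewrite -setXTT TF TG predeqE => -[x y]; split.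
    move=> [/= [i _ Fx] [j _ Gy]]; exists (maxn i j) => //; split.
    - by move: x Fx; exact/subsetPset/ndF/leq_maxl.
    - by move: y Gy; exact/subsetPset/ndG/leq_maxr.
  by move=> [k _ []/= ? ?]; split; exists k.
move=> k; have [? ?] := Foo k; have [? ?] := Goo k.
split; first exact: measurableX.
by rewrite [prodm _]product_measure1E// lte_mul_pinfty// ge0_fin_numE.
Qed.

Let lebesgue_tcons_sigma_finite : sigma_finite setT lebesgue_tcons.
Proof.
have [F TF mF] := prodm_sigma_finite.
pose u (t : n.+1.-tuple RT) : RT * n.-tuple RT := (thead t, [tuple of behead t]).
have uK : cancel (@tcons n) u.
  by move=> [a b]; rewrite /u /tcons /=; congr pair; apply/val_inj.
exists (fun i => u @^-1` F i).
  by rewrite -preimage_bigcup -TF preimage_setT.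
move=> i; have [mFi Foo] := mF i; split.
  by rewrite -[X in measurable X]setTI; exact: thead_behead_meas.
rewrite /lebesgue_tcons /pushforward -comp_preimage.
by rewrite (_ : u \o _ = id) ?preimage_id//; apply/funext => x /=; exact: uK.
Qed.

HB.instance Definition _ := Measure_isSigmaFinite.Build _ _ _ lebesgue_tcons
  lebesgue_tcons_sigma_finite.

End step.

Fixpoint lebesgueN n : {sigma_finite_measure set (n.-tuple RT) -> \bar R} :=
  if n is n'.+1 then lebesgue_tcons (lebesgueN n')
  else \d_([tuple] : 0.-tuple RT).

Lemma lebesgueN_box n (A : n.-tuple (set RT)) :
  (forall i, measurable (tnth A i)) ->
  lebesgueN n [set t | forall i, tnth A i (tnth t i)] =
  (\prod_(i < n) lebesgue_measure (tnth A i))%E.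
Proof.
elim: n A => [|n IH] A mA /=.
  rewrite big_ord0 diracE mem_set//; by case.
rewrite /lebesgue_tcons /pushforward.
rewrite [X in (_ \x _)%E X](_ : _ = tnth A ord0 `*`
    [set t | forall i, tnth [tuple of behead A] i (tnth t i)]); last first.
  apply/seteqP; split=> [[x t] /= At|[x t] /= [Ax At] i].
    split; first by have := At ord0; rewrite tnth0.
    by move=> i; have := At (lift ord0 i); rewrite tnthS tnth_behead
      (_ : inord _ = lift ord0 i)//; apply/val_inj; rewrite /= inordK ?ltnS.
  case: (unliftP ord0 i) => [j ->|->]; last by rewrite tnth0.
  rewrite tnthS; have := At j; rewrite tnth_behead.
  by rewrite (_ : inord _ = lift ord0 j)//; apply/val_inj; rewrite /= inordK ?ltnS.
have mB i : measurable (tnth [tuple of behead A] i) by rewrite tnth_behead.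
rewrite product_measure1E//; last first.
  rewrite (_ : [set _ | _] = \bigcap_(i in [set: 'I_n])
      ((fun t : n.-tuple RT => tnth t i) @^-1` tnth [tuple of behead A] i)); last first.
    by apply/seteqP; split=> t /= h i; [move=> _|]; exact: h.
  apply: fin_bigcap_measurable => // i _.
  by rewrite -[X in measurable X]setTI; exact: measurable_tnth.
rewrite IH// big_ord_recl; congr (_ * _)%E.
apply: eq_bigr => i _; rewrite tnth_behead; congr (lebesgue_measure (tnth A _)).
by apply/val_inj; rewrite /= inordK ?ltnS.
Qed.

End LebesgueN.

Section ComplexAnalysis.
Context {R : realType}.
Local Open Scope complex_scope.

Definition cexp (w : R[i]) : R[i] :=
  (expR (complex.Re w))%:C * (cos (complex.Im w) +i* sin (complex.Im w)).

Definition cabs (z : R[i]) : R :=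
  Num.sqrt (complex.Re z ^+ 2 + complex.Im z ^+ 2).

(** Principal argument of [z != 0], with values in ]-pi, pi]. *)
Definition carg (z : R[i]) : R :=
  let a := acos (complex.Re z / cabs z) in
  if 0 <= complex.Im z then a else - a.

(** Principal logarithm and principal power of [z != 0]. *)
Definition cLog (z : R[i]) : R[i] := ln (cabs z) +i* carg z.

Definition cpow (z : R[i]) (a : R) : R[i] := cexp (a%:C * cLog z).

(** Integral of [f] along the positively oriented circle of radius [r] centred
    at 0, parametrised by [z = r e^(i t)], [dz = i z dt], [0 <= t <= 2 pi]. *)
Definition circle_integral (r : R) (f : R[i] -> R[i]) : R[i] :=
  let z t := r%:C * cexp (t *i) in
  let g t := f (z t) * ('i * z t) in
  (\int[lebesgue_measure]_(t in `[0, 2 * pi]) complex.Re (g t))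
  +i* (\int[lebesgue_measure]_(t in `[0, 2 * pi]) complex.Im (g t)).

(** [wright h alpha beta r n j] is phi^h_(alpha,beta)(n,j), computed on the
    circle of radius [r]; by Cauchy's theorem it does not depend on [r] in
    ]0, 1[. *)
Definition wright (h alpha beta r : R) (n j : nat) : R[i] :=
  ((2 * pi) *i)^-1 * circle_integral r (fun z =>
    (z ^+ n.+1)^-1 *
    ((1 - h%:C * cpow ((1 - z) / h%:C) alpha) ^+ j
      / cpow ((1 - z) / h%:C) beta)).

End ComplexAnalysis.

Section Kernels.
Context {R : realType} {N : nat}.
Local Notation RT := (measurableTypeR R).
Local Notation mu := (@lebesgue_measure R).

Definition Gamma (s : R) : R :=
  \int[mu]_(t in `]0, +oo[) (t `^ (s - 1) * expR (- t)).

Definition enorm (x : 'rV[R]_N) : R := Num.sqrt (\sum_(i < N) x 0 i ^+ 2).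

Definition gauss (t : R) (x : 'rV[R]_N) : R :=
  (4 * pi * t) `^ (- (N%:R / 2)) * expR (- (enorm x ^+ 2 / (4 * t))).

Definition dgauss (n : nat) (h : R) (x : 'rV[R]_N) : R :=
  (h ^+ n * Gamma n%:R)^-1 *
  \int[mu]_(t in `]0, +oo[) (expR (- (t / h)) * t ^+ n.-1 * gauss t x).

(** The Wright function is real, because its integrand takes conjugate values
    at conjugate points of the circle; hence the projection [Re].
    The series diverges when [h `^ (1 - alpha) > 2]; [limn] is then the
    default element of [R]. *)
Definition fundsol (alpha h r : R) (n : nat) (x : 'rV[R]_N) : R :=
  limn (fun m => \sum_(1 <= j < m)
    complex.Re (wright h alpha (1 - alpha) r n.-1 j.-1) * dgauss j h x).

Definition unitv (i : 'I_N) : 'rV[R]_N := delta_mx 0 i.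

Definition grad (f : 'rV[R]_N -> R) (x : 'rV[R]_N) : 'rV[R]_N :=
  \row_i 'D_(unitv i) f x.

(** The vector of R^N with the coordinates of a tuple. *)
Definition vec (t : N.-tuple RT) : 'rV[R]_N := \row_i tnth t i.

(** L^p(R^N) norm of (the Euclidean length of) a vector field. *)
Definition LpnormV (p : R) (F : 'rV[R]_N -> 'rV[R]_N) : \bar R :=
  Lnorm (lebesgueN N) p%:E (fun t => (enorm (F (vec t)))%:E).

End Kernels.

(* Main.v *)
Require Import Defs.
From mathcomp Require Import all_boot all_order all_algebra.
From mathcomp Require Import complex.
From mathcomp Require Import all_classical all_reals all_analysis.
From mathcomp Require Import measurable_realfun ring lra.

Set Implicit Arguments.
Unset Strict Implicit.
Unset Printing Implicit Defensive.

Import Order.TTheory GRing.Theory Num.Theory.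
Import numFieldNormedType.Exports.

Local Open Scope classical_set_scope.
Local Open Scope ring_scope.

(** Write [m = n - 1], [a = h^(1 - alpha)] and [b = 1 - a].

Since [1 - h ((1 - z) / h)^alpha = b + a (1 - (1 - z)^alpha)], the binomial
theorem gives
  [phi(m, J) = a sum_k c_k C(J, k) a^k b^(J - k)]
where [c_k] is the coefficient of [z^m] in
[(1 - z)^(alpha - 1) (1 - (1 - z)^alpha)^k]. This number, [sibuya alpha m k],
is nonnegative: it is the probability that a renewal process with Sibuya
waiting times has had exactly [k] renewals by time [m]. The identity is
[wright_mixcoef]. It rests on the value [circE] of the integrals of
[(1 - z)^be / z^(n + 1)] over a circle, which real analysis in the angle and
the radius provides: integrating a derivative over a period gives the recursion
that the coefficients of [(1 - z)^be] satisfy, and the same relation shows that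
the mean of [(1 - z)^be] over a circle does not depend on the radius.

The kernel [dgauss J.+1 h] averages the Gaussian kernel against the Gamma
density [gdens h J], and [sum_J C(J, k) b^(J - k) gdens h J t] equals
[gdens h k t * expR (b t / h)], a multiple of the Gamma density of scale
[h / a = h^alpha]. Hence, where the series converges, the fundamental solution
is a finite mixture with nonnegative weights,
  [K(x) = int w(t) G_t(x) dt],  [w = sum_(k <= m) c_k gdens (h^alpha) k].
Off the origin the series converges exactly when [|b| < 1], or [b = -1] and
[2 m < N] (the heat kernel then decays fast enough in time). In the other cases
its general term does not tend to [0], whatever [x <> 0], so that the limit
operator returns one and the same element off the origin and the gradient
vanishes there. This dichotomy is [fundsol_cases].

It remains to estimate the mixture. Its gradient is at most
[C int w(t) t^(-(N + 1) / 2) exp (- |x|^2 / (8 t)) dt], and the L^p norm in [x]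
of the integrand is a multiple of [w(t) t^(- ga)] with
[ga = N / 2 (1 - 1 / p) + 1 / 2]; the condition on [p] says that [ga < 1].
Minkowski's inequality, in the form [weighted_jensen], leaves the moment
[int w(t) t^(- ga) dt]. The moment of order [- ga] of [gdens H k] is at most a
multiple of [H^(- ga)] times the coefficient of [z^k] in [(1 - z)^(ga - 1)]
([frac_moment]). Substituting [1 - (1 - z)^alpha] for [z] in that power series
and multiplying by [(1 - z)^(alpha - 1)] turns it into
[(1 - z)^(alpha ga - 1)], whose coefficient of [z^m] is at most
[n^(- alpha ga)]. With [H = h^alpha] the moment is thus at most a multiple of
[(n h)^(- alpha ga)] ([subdens_moment]), which is the bound sought. *)

(** * Negative binomial coefficients and Sibuya renewal probabilities *)

Section Coefficients.
Context {R : realType}.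
Implicit Types (al th ga : R) (m k n : nat).

(** Coefficient of [z^k] in [(1 - z)^(- th)]. *)
Definition negbin th k : R := \prod_(i < k) ((th + i%:R) / i.+1%:R).

(** Coefficient of [z^m] in [F k = (1 - z)^(al - 1) (1 - (1 - z)^al)^k]. The
recursion is the differential equation
[(1 - z) (F k)' = (1 - al - k al) F k + k al F (k - 1)]; for [k = 0] the factor
[k%:R] cancels the index [k.-1]. *)
Fixpoint sibuya al m k : R :=
  if m is m'.+1 then
    ((m'.+1%:R - al - k%:R * al) * sibuya al m' k +
      k%:R * al * sibuya al m' k.-1) / m'.+1%:R
  else (k == 0)%:R.

Lemma negbin0 th : negbin th 0 = 1.
Proof. by rewrite /negbin big_ord0. Qed.

Lemma negbinS th k : k.+1%:R * negbin th k.+1 = (th + k%:R) * negbin th k.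
Proof.
rewrite /negbin big_ord_recr/= mulrCA mulrC; congr (_ * _).
by rewrite mulrCA mulfV ?mulr1// pnatr_eq0.
Qed.

(** The derivative of [(1 - z)^(- th)] is [th (1 - z)^(- (th + 1))]. *)
Lemma negbinSl th k :
  k.+1%:R * negbin th k.+1 = th * negbin (th + 1) k.
Proof.
elim: k => [|k IH]; first by rewrite negbinS !negbin0 addr0.
have k0 : k.+1%:R != 0 :> R by rewrite pnatr_eq0.
apply: (mulfI k0); rewrite negbinS mulrCA IH.
have := negbinS (th + 1) k => E.
rewrite [RHS]mulrCA E -natr1; ring.
Qed.

Lemma sibuyaS al m k : m.+1%:R * sibuya al m.+1 k =
  (m.+1%:R - al - k%:R * al) * sibuya al m k + k%:R * al * sibuya al m k.-1.
Proof. by rewrite /= mulrCA mulfV ?mulr1// pnatr_eq0. Qed.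

Lemma sibuya_small al m k : (m < k)%N -> sibuya al m k = 0.
Proof.
elim: m k => [|m IH] [|k]//= mk.
by rewrite !IH ?mulr0 ?addr0 ?mul0r// ltnW.
Qed.

Lemma sibuya_ge0 al m k : 0 <= al <= 1 -> 0 <= sibuya al m k.
Proof.
move=> /andP[al0 al1].
elim: m k => [|m IH] k; first by rewrite ler0n.
have [mk|km] := ltnP m.+1 k; first by rewrite sibuya_small.
rewrite /= divr_ge0// addr_ge0//; last by rewrite !mulr_ge0.
have [mk|{}km] := ltnP m k; first by rewrite sibuya_small ?mulr0.
rewrite mulr_ge0// -addrA -opprD -{1}[al]mul1r -mulrDl subr_ge0.
by rewrite -[leRHS]mulr1 ler_pM ?addr_ge0// -natr1 addrC lerD2r ler_nat.
Qed.

Lemma sibuya_diag_gt0 al m : 0 < al -> 0 < sibuya al m m.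
Proof.
move=> al0; elim: m => [|m IH]; first by rewrite ltr01.
by rewrite /= sibuya_small// mulr0 add0r divr_gt0// !mulr_gt0.
Qed.

(** Substitute [w = 1 - (1 - z)^al] in the expansion of [(1 - w)^(- th)], which
becomes [(1 - z)^(- al th)], and multiply by [(1 - z)^(al - 1)]. Taking [th] to
be a nonpositive integer identifies the Wright function; [th = 1 - ga] sums the
moments of order [- ga]. *)
Lemma sibuya_negbin al th m :
  \sum_(k < m.+1) sibuya al m k * negbin th k = negbin (1 - al + al * th) m.
Proof.
elim: m => [|m IH]; first by rewrite big_ord1 !negbin0 mulr1.
have m0 : m.+1%:R != 0 :> R by rewrite pnatr_eq0.
apply: (mulfI m0); rewrite negbinS -{}IH !mulr_sumr.
under eq_bigr do rewrite mulrA sibuyaS mulrDl.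
rewrite big_split/= big_ord_recr/= sibuya_small// mulr0 mul0r addr0.
rewrite [X in _ + X]big_ord_recl/= mul0r mul0r mul0r add0r -big_split/=.
apply: eq_bigr => k _; rewrite /bump/= add1n.
have -> : k.+1%:R * al * sibuya al m k * negbin th k.+1 =
   al * sibuya al m k * (k.+1%:R * negbin th k.+1) by ring.
rewrite negbinS -[m.+1%:R]natr1; ring.
Qed.

Lemma negbin_opp_nat k i : negbin (- i%:R) k = (-1) ^+ k * 'C(i, k)%:R.
Proof.
elim: k => [|k IH]; first by rewrite negbin0 bin0 mulr1.
have k0 : k.+1%:R != 0 :> R by rewrite pnatr_eq0.
apply: (mulfI k0); rewrite negbinS IH.
have [ik|ki] := ltnP i k.
  by rewrite !bin_small ?ltnS ?(ltnW ik)// !mulr0.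
have -> : - i%:R + k%:R = - (i - k)%:R :> R by rewrite natrB// opprB addrC.
rewrite mulrCA [RHS]mulrCA.
have -> : k.+1%:R * 'C(i, k.+1)%:R = (i - k)%:R * 'C(i, k)%:R :> R.
  by rewrite -!natrM mul_bin_left.
rewrite exprS; ring.
Qed.

(** The [k]-th derivative of the binomial theorem, divided by [k!]. *)
Lemma sum_bin_bin (x : R) J k :
  \sum_(i < J.+1) 'C(J, i)%:R * 'C(i, k)%:R * x ^+ i =
  'C(J, k)%:R * x ^+ k * (1 + x) ^+ (J - k).
Proof.
have [Jk|kJ] := ltnP J k.
  rewrite bin_small// !mul0r big1// => i _.
  by rewrite [X in _ * X%:R]bin_small ?mulr0 ?mul0r// (leq_trans _ Jk)// ltn_ord.
transitivity (\sum_(k <= i < J.+1) 'C(J, k)%:R * 'C(J - k, i - k)%:R * x ^+ i).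
  rewrite -(big_mkord xpredT (fun i => 'C(J, i)%:R * 'C(i, k)%:R * x ^+ i)).
  rewrite (@big_cat_nat _ _ _ k)//=; last exact: ltnW.
  rewrite big_nat big1 ?add0r; last first.
    by move=> i /andP[_ ik]; rewrite [X in _ * X%:R]bin_small ?mulr0 ?mul0r.
  rewrite !big_nat; apply: eq_bigr => i /andP[ki iJ]; congr (_ * _).
  rewrite -!natrM; congr (_%:R).
  have f0 : (0 < k`! * (i - k)`! * (J - i)`!)%N by rewrite !muln_gt0 !fact_gt0.
  apply/eqP; rewrite -(eqn_pmul2r f0); apply/eqP.
  have E1 := bin_fact ki.
  have E2 : ('C(J, i) * (i`! * (J - i)`!) = J`!)%N by rewrite bin_fact.
  have E3 := bin_fact kJ.
  have E4 : ('C(J - k, i - k) * ((i - k)`! * (J - i)`!) = (J - k)`!)%N.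
    by rewrite -(bin_fact (n := J - k) (m := i - k)) ?leq_sub2r// subnBA ?subnK// ltnW.
  transitivity J`!.
    by rewrite -E2 -E1; ring.
  by rewrite -E3 -E4; ring.
rewrite -{1}[k]add0n big_addn subSn// big_mkord exprDn mulr_sumr.
apply: eq_bigr => i _; rewrite addnK expr1n mul1r exprD -mulr_natr; ring.
Qed.

(** Both sides are the coefficient of [z^m] in
[(1 - z)^(al - 1) (1 - a (1 - z)^al)^J]: on the left the power is expanded in
[(1 - z)^al], on the right in [1 - (1 - z)^al], after writing
[1 - a (1 - z)^al = (1 - a) + a (1 - (1 - z)^al)]. *)
Lemma wright_coef al a m J :
  \sum_(i < J.+1) 'C(J, i)%:R * (- a) ^+ i * negbin (1 - al - al * i%:R) m =
  \sum_(k < m.+1) sibuya al m k * ('C(J, k)%:R * a ^+ k * (1 - a) ^+ (J - k)).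
Proof.
under eq_bigr => i _.
  rewrite -[- (al * _)]mulrN -sibuya_negbin mulr_sumr.
  under eq_bigr do rewrite negbin_opp_nat.
  over.
rewrite exchange_big/=; apply: eq_bigr => k _.
have -> : 'C(J, k)%:R * a ^+ k * (1 - a) ^+ (J - k) =
   (-1) ^+ k * ('C(J, k)%:R * (- a) ^+ k * (1 + (- a)) ^+ (J - k)).
  rewrite (exprNn a k) -signr_odd.
  case: (odd k); rewrite ?expr1 ?expr0; ring.
rewrite -sum_bin_bin !mulr_sumr; apply: eq_bigr => i _; ring.
Qed.

End Coefficients.

(** * Inequalities for real powers *)
Section PowerInequalities.
Context {R : realType}.
Implicit Types (u c t d p ga : R) (m k n : nat).

Lemma powRV u ga : 0 <= u -> (u^-1) `^ ga = (u `^ ga)^-1.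
Proof. by move=> u0; rewrite -powR_inv1// -powRrM mulN1r powRN. Qed.

Lemma ln_le_subr1 u : 0 < u -> ln u <= u - 1.
Proof.
move=> u0; have -> : u = 1 + (u - 1) by ring.
by rewrite [leRHS]addrAC subrr add0r le_ln1Dx//; lra.
Qed.

Lemma bernoulli_powR u ga : 0 <= u -> 0 <= ga <= 1 ->
  u `^ ga <= 1 + ga * (u - 1).
Proof.
move=> u0 /andP[ga0 ga1].
have [->|gane0] := eqVneq ga 0; first by rewrite powRr0 mul0r addr0.
move: u0; rewrite le_eqVlt => /predU1P[<-|u0].
  by rewrite powR0//; lra.
have [M ME] : exists M, M = 1 + ga * (u - 1) by exists (1 + ga * (u - 1)).
rewrite -ME.
have M0 : 0 < M.
  have -> : M = (1 - ga) + ga * u by rewrite ME; ring.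
  by rewrite ltr_wpDl ?subr_ge0// mulr_gt0// lt_neqAle eq_sym gane0.
(* concavity of [ln] between [u] and [1], from the tangent line at [M] *)
have h1 : ln (u / M) <= u / M - 1 by apply: ln_le_subr1; rewrite divr_gt0.
have h2 : ln (1 / M) <= 1 / M - 1 by apply: ln_le_subr1; rewrite divr_gt0.
rewrite ln_div ?posrE// in h1; rewrite ln_div ?posrE// ln1 in h2.
have E : ga * (u / M - 1) + (1 - ga) * (1 / M - 1) = 0.
  transitivity ((1 + ga * (u - 1)) / M - 1); first by ring.
  by rewrite -ME divff ?gt_eqF// subrr.
have : ga * (ln u - ln M) + (1 - ga) * (0 - ln M) <= 0.
  by rewrite -[leRHS]E; apply: lerD; apply: ler_wpM2l; lra.
move=> h; rewrite -ler_ln ?posrE ?powR_gt0// ln_powR; lra.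
Qed.

Lemma bernoulli_powR_ge1 u p : 0 <= u -> 1 <= p ->
  1 + p * (u - 1) <= u `^ p.
Proof.
move=> u0 p1; have p0 : 0 < p by lra.
have := @bernoulli_powR (u `^ p) p^-1 (powR_ge0 _ _).
rewrite -powRrM mulfV ?lt0r_neq0// powRr1// invr_ge0 invf_le1//= p1 (ltW p0).
by move=> /(_ isT); rewrite -lerBlDl mulrC ler_pdivlMr//; lra.
Qed.

Lemma powRN_expR_bounded c d : 0 <= c -> 0 < d ->
  exists2 C, 0 <= C & forall t, 0 < t -> t `^ (- c) * expR (- (d / t)) <= C.
Proof.
move=> c0 d0.
(* the value at the maximum, which is reached at [t = d / c] *)
exists (expR (- c + c * ln (c / d))); first exact: expR_ge0.
move=> t t0; rewrite /powR gt_eqF// -expRD ler_expR.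
move: c0; rewrite le_eqVlt => /predU1P[<-|c0].
  by rewrite oppr0 !mul0r addr0 sub0r oppr_le0 divr_ge0// ltW.
have h : ln (d / t / c) <= d / t / c - 1 by apply: ln_le_subr1; rewrite !divr_gt0.
rewrite !ln_div ?posrE ?divr_gt0// in h *.
have : c * (ln d - ln t - ln c) <= c * (d / t / c - 1) by rewrite ler_pM2l.
have -> : c * (d / t / c - 1) = d / t - c by field; rewrite !gt_eqF.
lra.
Qed.

(** The ratio of consecutive coefficients is [1 - ga / (k + 2)], and it is at
least [((k + 1) / (k + 2))^ga] by Bernoulli's inequality. *)
Lemma negbin_ge ga k : 0 <= ga -> ga <= 1 -> (0 < k)%N ->
  (1 - ga) * k%:R `^ (- ga) <= negbin (1 - ga) k.
Proof.
move=> ga0 ga1; elim: k => // -[_ _|k /(_ isT) IH _].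
  by rewrite powR1 mulr1 /negbin big_ord1/= addr0 divr1.
have k0 : 0 < k.+1%:R :> R by rewrite ltr0n.
have k1 : 0 < k.+2%:R :> R by rewrite ltr0n.
have -> : negbin (1 - ga) k.+2 = (1 - ga / k.+2%:R) * negbin (1 - ga) k.+1.
  have /mulfI : k.+2%:R != 0 :> R by rewrite gt_eqF.
  apply; rewrite negbinS -[k.+2]addn1 natrD; field.
  by rewrite -natr1 in k1; rewrite gt_eqF.
apply: (@le_trans _ _ ((1 - ga / k.+2%:R) * ((1 - ga) * k.+1%:R `^ (- ga)))); last first.
  rewrite ler_wpM2l// subr_ge0 ler_pdivrMr// mul1r (le_trans ga1)//.
  by rewrite (ler_nat _ 1).
rewrite mulrCA ler_wpM2l ?subr_ge0//.
have := @bernoulli_powR (k.+1%:R / k.+2%:R) ga.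
rewrite divr_ge0 ?ga0// => /(_ isT ga1).
rewrite powRM ?invr_ge0// powRV//.
have -> : 1 + ga * (k.+1%:R / k.+2%:R - 1) = 1 - ga / k.+2%:R :> R.
  by rewrite -[k.+2]addn1 natrD; rewrite -natr1 in k1; field; rewrite gt_eqF.
by rewrite !powRN ler_pdivlMr ?powR_gt0// mulrC.
Qed.

(** With [x = ga / (m + 1)], the ratio [1 - x] of consecutive coefficients is at
most [1 / (1 + x)], and [1 + x] is at least [((m + 2) / (m + 1))^ga]. *)
Lemma negbin_le ga m : 0 <= ga -> ga <= 1 ->
  negbin (1 - ga) m <= m.+1%:R `^ (- ga).
Proof.
move=> ga0 ga1; elim: m => [|m IH]; first by rewrite negbin0 powR1.
have m0 : 0 < m.+1%:R :> R by rewrite ltr0n.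
have m1 : 0 < m.+2%:R :> R by rewrite ltr0n.
have -> : negbin (1 - ga) m.+1 = (1 - ga / m.+1%:R) * negbin (1 - ga) m.
  have /mulfI : m.+1%:R != 0 :> R by rewrite gt_eqF.
  apply; rewrite negbinS -natr1; field.
  by rewrite natr1 gt_eqF.
have h0 : 0 <= 1 - ga / m.+1%:R.
  by rewrite subr_ge0 ler_pdivrMr// mul1r (le_trans ga1)// (ler_nat _ 1).
apply: (le_trans (ler_wpM2l h0 IH)).
have := @bernoulli_powR (m.+2%:R / m.+1%:R) ga.
rewrite divr_ge0 ?ga0// => /(_ isT ga1).
rewrite powRM ?invr_ge0// powRV//.
have -> : 1 + ga * (m.+2%:R / m.+1%:R - 1) = 1 + ga / m.+1%:R :> R.
  rewrite -[m.+2]addn1 natrD; field; exact: lt0r_neq0.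
move=> h; rewrite [leRHS]powRN -[leRHS]mul1r ler_pdivlMr ?powR_gt0//.
have {}h := ler_wpM2l h0 h.
rewrite powRN -mulrA [X in _ * X]mulrC (le_trans h)//.
by rewrite -subr_sqr expr1n gerBl sqr_ge0.
Qed.

End PowerInequalities.

(** * Measurability and limits of elementary expressions *)
Section Measurability.
Context {R : realType} d (T : measurableType d).
Implicit Types (D : set T) (f : T -> R).

Lemma measurable_fun_expR D f :
  measurable_fun D f -> measurable_fun D (fun x => expR (f x)).
Proof. by move=> mf; apply: (measurableT_comp (@measurable_expR R)). Qed.

Lemma measurable_fun_powR D f c :
  measurable_fun D f -> measurable_fun D (fun x => f x `^ c).
Proof. by move=> mf; apply: (measurableT_comp (@measurable_powR R c)). Qed.

Lemma measurable_fun_inv D f :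
  measurable_fun D f -> measurable_fun D (fun x => (f x)^-1).
Proof.
(* a real power of the nonnegative [f x ^+ 2] is measurable, and both sides
   vanish where [f] does *)
move=> mf; rewrite (_ : (fun x => _) = fun x => f x * (f x ^+ 2) `^ (- 1)).
  by apply: measurable_funM => //; exact/measurable_fun_powR/measurable_funX.
apply/funext => x; rewrite powR_inv1 ?sqr_ge0//.
have [->|fx] := eqVneq (f x) 0; first by rewrite invr0 mul0r.
by rewrite expr2 invfM mulrA mulfV// mul1r.
Qed.

End Measurability.

Ltac mfun := repeat (cbv beta; first
  [ exact: measurable_cst | exact: measurable_id | exact: measurable_fst
  | exact: measurable_snd | assumption
  | apply: measurable_fun_expR | apply: measurable_fun_powR
  | apply: measurable_funX | apply: measurable_fun_inv | apply: measurable_funN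
  | apply: measurable_funM | apply: measurable_funD
  | apply: measurable_sum => ? ]).

Lemma cvg_sumr {R : realType} {T I : Type} {F : set_system T} {FF : Filter F}
    (s : seq I) (f : I -> T -> R) (l : I -> R) :
  (forall i, f i x @[x --> F] --> l i) ->
  \sum_(i <- s) f i x @[x --> F] --> \sum_(i <- s) l i.
Proof.
move=> fl; elim: s => [|i s IH].
  by under eq_cvg do rewrite big_nil; rewrite big_nil; exact: cvg_cst.
by under eq_cvg do rewrite big_cons; rewrite big_cons; exact: cvgD.
Qed.

(** * Gamma densities *)
Section GammaDensity.
Context {R : realType}.
Local Notation mu := (@lebesgue_measure R).
Implicit Types (h t c : R) (k n : nat).

(** Density of the Gamma distribution of shape [k + 1] and scale [h]. *)
Definition gdens h k t : R :=
  expR (- (t / h)) * t ^+ k / (h ^+ k.+1 * k`!%:R).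

Lemma measurable_gdens D h k : measurable_fun D (gdens h k).
Proof. rewrite /gdens; mfun. Qed.

Lemma gdens_ge0 h k t : 0 < h -> 0 <= t -> 0 <= gdens h k t.
Proof.
by move=> h0 t0; rewrite divr_ge0// mulr_ge0 ?expR_ge0 ?exprn_ge0// ltW.
Qed.

Lemma gdensS h k t : 0 < h -> t * gdens h k t = (k.+1%:R * h) * gdens h k.+1 t.
Proof.
move=> h0; rewrite /gdens factS natrM.
have k0 : k`!%:R != 0 :> R by rewrite pnatr_eq0 -lt0n fact_gt0.
have k1 : k.+1%:R != 0 :> R by rewrite pnatr_eq0.
by rewrite !exprS; field; rewrite k0 addrC natr1 k1 expf_neq0 gt_eqF.
Qed.

(** The probability that a Gamma variable of shape [k + 1] exceeds [t], written
as the probability of at most [k] points in a Poisson process; its derivative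
telescopes to [- gdens h k t]. *)
Let prim h k t : R := \sum_(i < k.+1) h * gdens h i t.

Let prim_derive h k t : 0 < h -> is_derive t 1 (prim h k) (- gdens h k t).
Proof.
move=> h0; have hn0 : h != 0 by rewrite gt_eqF.
have dexp : is_derive t 1 (fun x => expR (- (x / h))) (- (h^-1) * expR (- (t / h))).
  apply: is_derive_eq.
  by rewrite /GRing.scale/=; ring.
elim: k => [|k IH].
  rewrite (_ : prim h 0 = fun t => expR (- (t / h))); last first.
    apply/funext => x; rewrite /prim big_ord1 /gdens expr0 mulr1 fact0 mulr1 expr1.
    by rewrite mulrCA mulfV// mulr1.
  apply: is_derive_eq; rewrite /gdens expr0 fact0 !mulr1 expr1; ring.
rewrite (_ : prim h k.+1 = prim h k +
    (fun t => (h ^+ k.+1 * k.+1`!%:R)^-1 *: (expR (- (t / h)) * t ^+ k.+1))); last first.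
  apply/funext => x; rewrite /prim big_ord_recr/=; congr (_ + _).
  rewrite /gdens /GRing.scale/= !exprS; field.
  by rewrite hn0 expf_neq0// pnatr_eq0 -lt0n fact_gt0.
have dX : is_derive t 1 (fun x => expR (- (x / h)) * x ^+ k.+1)
   (expR (- (t / h)) * (k.+1%:R * t ^+ k) + t ^+ k.+1 * (- (h^-1) * expR (- (t / h)))).
  have dXn : is_derive t 1 (fun x : R => x ^+ k.+1) (k.+1%:R * t ^+ k).
    have := @is_deriveX R R id k.+1 t 1 1 (is_derive_id _ _).
    by rewrite exprfctE /GRing.scale/= mulr1.
  exact: (is_deriveM dexp dXn).
apply: is_derive_eq; rewrite /gdens /GRing.scale/= factS natrM.
have k0 : k`!%:R != 0 :> R by rewrite pnatr_eq0 -lt0n fact_gt0.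
have k1 : k.+1%:R != 0 :> R by rewrite pnatr_eq0.
by rewrite !exprS; field; rewrite k0 addrC natr1 k1 expf_neq0 gt_eqF.
Qed.

Let gdens_cvg0 h k : 0 < h -> gdens h k t @[t --> +oo] --> 0.
Proof.
move=> h0.
have hk t : 0 < t -> 0 <= gdens h k t <= k.+1%:R * h / t ^+ 1 * (h^-1).
  move=> t0; rewrite gdens_ge0 ?(ltW t0)//=.
  have e1 := @expR_ge1Dxn R (t / h) k (ltW (divr_gt0 t0 h0)).
  have e2 : (t / h) ^+ k.+1 / k.+1`!%:R <= expR (t / h) by lra.
  rewrite /gdens expRN -mulrA ler_pdivrMl ?expR_gt0//.
  have k0 : 0 < k`!%:R :> R by rewrite ltr0n fact_gt0.
  have k1 : 0 < k.+1%:R :> R by rewrite ltr0n.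
  apply: le_trans (_ : (t / h) ^+ k.+1 / k.+1`!%:R * (k.+1%:R * h / t ^+ 1 / h) <= _).
    rewrite factS natrM exprMn exprVn !exprS expr0 le_eqVlt; apply/orP; left; apply/eqP.
    by field; rewrite gt_eqF// addrC natr1 !gt_eqF// exprn_gt0.
  by rewrite ler_wpM2r// !mulr_ge0// ?invr_ge0// ltW// exprn_gt0.
apply: (@squeeze_cvgr _ _ _ _ (cst 0) (fun t => (k.+1%:R * h / h) * t^-1)).
- near=> t.
  have t0 : 0 < t by near: t; exact: nbhs_pinfty_gt.
  have /andP[g0 gC] := hk t t0; rewrite /= g0/=.
  by rewrite (le_trans gC)// expr1 mulrAC.
- exact: cvg_cst.
- rewrite -[X in _ --> X](mulr0 (k.+1%:R * h / h)); apply: cvgMr.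
  apply/(@gtr0_cvgV0 _ _ _ _ (fun x : R => x)); last exact: cvg_id.
  exact: nbhs_pinfty_gt.
Unshelve. all: end_near. Qed.

Lemma integral_gdens h k : 0 < h -> 
  (\int[mu]_(t in `]0%R, +oo[) (gdens h k t)%:E = 1)%E.
Proof.
move=> h0.
rewrite integral_itv_obnd_cbnd; last by apply/measurable_EFinP; exact: measurable_gdens.
have dF t := @prim_derive h k t h0.
have cF : continuous (prim h k).
  by move=> t; apply: differentiable_continuous; apply/derivable1_diffP; case: (dF t).
have cg : continuous (gdens h k).
  move=> t; rewrite /gdens; apply: cvgMl.
  apply: cvgM; last exact: exprn_continuous.
  apply: continuous_comp; last exact: continuous_expR.
  apply: cvgN; apply: cvgMl; exact: cvg_id.
rewrite (@ge0_continuous_FTC2y _ _ (- prim h k) _ 0).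
- rewrite -EFinB; congr EFin; rewrite sub0r opprK /prim big_ord_recl/=.
  rewrite big1 ?addr0; last by move=> i _; rewrite /gdens expr0n/= !mulr0 mul0r mulr0.
  by rewrite /gdens mul0r oppr0 expR0 expr0 fact0 !mulr1 expr1 mul1r mulfV// gt_eqF.
- by move=> t t0; exact: gdens_ge0.
- exact: continuous_subspaceT.
- have p0 : prim h k x @[x --> +oo] --> \sum_(i < k.+1) (h * 0).
    by apply: cvg_sumr => i; apply: cvgMr; exact: gdens_cvg0.
  rewrite big1 in p0; last by move=> i _; rewrite mulr0.
  by rewrite -oppr0; exact: cvgN.
- by move=> t t0; apply: derivableN; case: (dF t).
- apply: cvgN; apply: cvg_at_right_filter; exact: cF.
- move=> t _; rewrite derive1E deriveN; last by case: (dF t).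
  by rewrite derive_val opprK.
Qed.

End GammaDensity.

(** * Remainders of the exponential series *)
Section ExpRemainder.
Context {R : realType}.
Implicit Types (x y s b be : R) (M i : nat).

Lemma partial_exp_le M x : 0 <= x ->
  \sum_(i < M) x ^+ i / i`!%:R <= expR x.
Proof.
move=> x0; rewrite -(big_mkord xpredT (fun i => x ^+ i / i`!%:R)).
apply: nondecreasing_cvgn_le; last exact: is_cvg_series_exp_coeff.
apply/nondecreasing_seqP => n; rewrite /series/= big_nat_recr//= lerDl.
by rewrite divr_ge0// exprn_ge0.
Qed.

(** Each term of the tail is [(|b| / be)^i] times a term of the series of
[expR (be * s)], and [(|b| / be)^i <= (|b| / be)^M] as soon as [i >= M]. *)
Lemma exp_remainder_geometric M b be s : `|b| < be -> 0 <= s ->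
  `|expR (b * s) - \sum_(i < M) (b * s) ^+ i / i`!%:R| <=
    (`|b| / be) ^+ M * expR (be * s).
Proof.
move=> bbe s0; have be0 : 0 < be by exact: le_lt_trans bbe.
set S := fun M => \sum_(i < M) (b * s) ^+ i / i`!%:R.
have cS : S n @[n --> \oo] --> expR (b * s).
  have := is_cvg_series_exp_coeff (b * s).
  have -> : S = series (exp_coeff (b * s)) by apply/funext => n; rewrite /series/= big_mkord.
  by [].
have cD : `|S n - S M| @[n --> \oo] --> `|expR (b * s) - S M|.
  apply: cvg_norm; apply: cvgB => //; exact: cvg_cst.
apply: (cvgr_to_le cD); near=> n.
have Mn : (M <= n)%N by near: n; exact: nbhs_infty_ge.
rewrite /S -!(big_mkord xpredT (fun i => (b * s) ^+ i / i`!%:R)).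
rewrite (@big_cat_nat _ _ _ M 0%N n)//= addrAC subrr add0r.
apply: le_trans (ler_norm_sum _ _ _) _.
have hb : 0 <= `|b| / be <= 1.
  by rewrite divr_ge0 ?(ltW be0)//= ler_pdivrMr// mul1r ltW.
apply: (@le_trans _ _ (\sum_(M <= i < n) (`|b| / be) ^+ M * ((be * s) ^+ i / i`!%:R))).
  rewrite big_nat [leRHS]big_nat; apply: ler_sum => i /andP[Mi _].
  rewrite normrM normfV normr_nat mulrA ler_wpM2r ?invr_ge0//.
  rewrite normrX normrM (ger0_norm s0).
  have -> : `|b| * s = (`|b| / be) * (be * s) by field; rewrite gt_eqF.
  rewrite exprMn ler_wpM2r ?exprn_ge0 ?mulr_ge0 ?(ltW be0)//.
  by case/andP: hb => h0 h1; rewrite -(subnK Mi) exprD ler_piMl ?exprn_ge0// exprn_ile1.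
rewrite -mulr_sumr ler_wpM2l ?exprn_ge0//; first by case/andP: hb.
apply: le_trans (partial_exp_le n (mulr_ge0 (ltW be0) s0)).
rewrite -(big_mkord xpredT (fun i => (be * s) ^+ i / i`!%:R)).
rewrite (@big_cat_nat _ _ _ M 0%N n)//= lerDr sumr_ge0// => i _.
by rewrite divr_ge0// exprn_ge0// mulr_ge0// ltW.
Unshelve. all: end_near. Qed.

(** [(-1)^M] times the remainder of order [M] of the series of [expR (- s)]: see
[alt_remainderE]. *)
Fixpoint alt_remainder M s : R :=
  if M is M'.+1 then s ^+ M' / M'`!%:R - alt_remainder M' s else expR (- s).

Lemma alt_remainderE M s : alt_remainder M s =
  (-1) ^+ M * (expR (- s) - \sum_(i < M) (- s) ^+ i / i`!%:R).
Proof.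
elim: M => [|M IH] /=; first by rewrite big_ord0 expr0 subr0 mul1r.
rewrite IH big_ord_recr/= exprS (exprNn s M).
by rewrite -signr_odd; case: (odd M); rewrite ?expr1 ?expr0; ring.
Qed.

Lemma is_derive_alt_remainder M s :
  is_derive s 1 (alt_remainder M.+1) (alt_remainder M s).
Proof.
have dX n : is_derive s 1 (fun x : R => x ^+ n.+1 / n.+1`!%:R) (s ^+ n / n`!%:R).
  have dXn : is_derive s 1 (fun x : R => x ^+ n.+1) (n.+1%:R * s ^+ n).
    have := @is_deriveX R R id n.+1 s 1 1 (is_derive_id _ _).
    by rewrite exprfctE /GRing.scale/= mulr1.
  rewrite (_ : (fun x => _) = (n.+1`!%:R^-1 : R) \*: (fun x : R => x ^+ n.+1)); last first.
    by apply/funext => x; rewrite /= mulrC.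
  apply: is_derive_eq; rewrite /GRing.scale/= factS natrM.
  have k0 : n`!%:R != 0 :> R by rewrite pnatr_eq0 -lt0n fact_gt0.
  have k1 : n.+1%:R != 0 :> R by rewrite pnatr_eq0.
  by field; rewrite k0 addrC natr1 k1.
elim: M => [|M IH].
  rewrite (_ : alt_remainder 1 = fun t : R => 1 - expR (- t)); last first.
    by apply/funext => x; rewrite /= expr0 fact0 divr1.
  by apply: is_derive_eq; rewrite /GRing.scale/=; ring.
rewrite (_ : alt_remainder M.+2 = (fun t : R => t ^+ M.+1 / M.+1`!%:R) - alt_remainder M.+1)//.
by have := dX M => ?; exact: is_deriveB.
Qed.

(** Each remainder vanishes at [0] and has the preceding one as derivative. *)
Lemma alt_remainder_ge0 M s : 0 <= s -> 0 <= alt_remainder M s.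
Proof.
elim: M s => [|M IH] s s0; first exact: expR_ge0.
have d t := is_derive_alt_remainder M t.
have z : alt_remainder M.+1 0 = 0.
  case: {IH d} M => [|M]; first by rewrite /= oppr0 expR0 expr0 fact0 divr1 subrr.
  rewrite alt_remainderE oppr0 expR0 big_ord_recl/= expr0 fact0 divr1 big1.
    by rewrite addr0 subrr mulr0.
  by move=> i _; rewrite expr0n mul0r.
rewrite -z; apply: (@ger0_derive1_le_cc _ _ 0 s) => //.
- move=> x; rewrite in_itv/= => /andP[x0 _].
  by rewrite derive1E; have := d x => ?; rewrite derive_val IH// ltW.
- apply: continuous_subspaceT => x; apply: differentiable_continuous.
  by apply/derivable1_diffP; case: (d x).
- by rewrite in_itv/= lexx.
- by rewrite in_itv/= lexx s0.
Qed.

(** Two consecutive remainders are nonnegative and add up to the term between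
them. *)
Lemma exp_remainder_alternating M s : 0 <= s ->
  `|expR (- s) - \sum_(i < M) (- s) ^+ i / i`!%:R| <= s ^+ M / M`!%:R.
Proof.
move=> s0.
have -> : `|expR (- s) - \sum_(i < M) (- s) ^+ i / i`!%:R| = alt_remainder M s.
  rewrite -[RHS]ger0_norm ?alt_remainder_ge0// alt_remainderE.
  by rewrite normrM normrX normrN1 expr1n mul1r.
by have := alt_remainder_ge0 M.+1 s0; rewrite /= subr_ge0.
Qed.

End ExpRemainder.

(** * The heat kernel averaged against Gamma densities *)
Section RintegralFacts.
Context {R : realType} d (T : measurableType d) (mu : {measure set T -> \bar R}).
Implicit Types (D : set T) (f g : T -> R).

Lemma integrableM_real D (f g : T -> R) (C : R) : measurable D ->
  mu.-integrable D (EFin \o f) -> measurable_fun D g ->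
  (forall x, D x -> `|g x| <= C) ->
  mu.-integrable D (EFin \o (fun x => f x * g x)).
Proof.
move=> mD If mg gC.
apply: (@le_integrable _ _ _ _ _ mD _ (fun x => C%:E * (f x)%:E)%E).
- apply/measurable_EFinP; apply: measurable_funM => //.
  by apply/measurable_EFinP; exact: measurable_int If.
- move=> x Dx; rewrite -EFinM /= lee_fin !normrM mulrC ler_wpM2r//.
  by rewrite (le_trans (gC _ Dx))// ler_norm.
- exact: integrableZl.
Qed.

Lemma Rintegral_sum D I (s : seq I) (f : I -> T -> R) : measurable D ->
  (forall i, mu.-integrable D (EFin \o f i)) ->
  \int[mu]_(x in D) (\sum_(i <- s) f i x) = \sum_(i <- s) \int[mu]_(x in D) f i x.
Proof.
move=> mD If; elim: s => [|i s IH].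
  rewrite big_nil; under eq_Rintegral do rewrite big_nil.
  by rewrite Rintegral_cst// mul0r.
rewrite big_cons -IH; under eq_Rintegral do rewrite big_cons.
rewrite RintegralD//.
rewrite (_ : _ \o _ = (fun x => \sum_(i <- s) (f i x)%:E)%E).
  by apply: (@integrable_sum _ _ _ _ _ mD _ s xpredT (fun i => EFin \o f i)) => j _; exact: If.
by apply/funext => x /=; rewrite sumEFin.
Qed.

Lemma Rintegral_dist_le D f g E : measurable D ->
  mu.-integrable D (EFin \o f) -> mu.-integrable D (EFin \o g) ->
  mu.-integrable D (EFin \o E) ->
  (forall x, D x -> `|f x - g x| <= E x) ->
  `|\int[mu]_(x in D) f x - \int[mu]_(x in D) g x| <= \int[mu]_(x in D) E x.
Proof.
move=> mD If Ig IE fgE; rewrite -RintegralB//.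
have IB : mu.-integrable D (EFin \o (fun x => f x - g x)).
  rewrite (_ : _ \o _ = (EFin \o f) \- (EFin \o g))%E; first exact: integrableB.
  by apply/funext => x /=; rewrite EFinB.
apply: le_trans (le_normr_Rintegral mD IB) _.
apply: le_Rintegral => //.
rewrite (_ : _ \o _ = (abse \o (EFin \o (fun x => f x - g x)))).
  exact: integrable_abse.
by apply/funext => x.
Qed.

End RintegralFacts.

Section HeatKernel.
Context {R : realType}.
Local Notation mu := (@lebesgue_measure R).
Local Notation D := `]0%R, +oo[%classic.
Implicit Types (q h t c e rho b : R) (k n M : nat).

(** The Gaussian kernel at time [t] and squared distance [rho], in a real
dimension [2 q]: differentiating in [rho] raises [q] by one. *)
Definition heat q rho t : R :=
  (4 * pi * t) `^ (- q) * expR (- (rho / (4 * t))).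

Lemma measurable_heat q rho A : measurable_fun A (heat q rho).
Proof. rewrite /heat; mfun. Qed.

Lemma heat_ge0 q rho t : 0 <= heat q rho t.
Proof. by rewrite mulr_ge0 ?powR_ge0 ?expR_ge0. Qed.

(** Away from the origin the exponential factor beats every negative power of
[t] at [0]. *)
Lemma heat_bound q e rho : 0 <= q + e -> 0 < rho ->
  exists2 C, 0 <= C & forall t, 0 < t -> t `^ (- e) * heat q rho t <= C.
Proof.
move=> qe rho0.
have [C C0 hC] := @powRN_expR_bounded R (q + e) (rho / 4) qe (divr_gt0 rho0 (ltr0n _ 4)).
exists ((4 * pi) `^ (- q) * C); first by rewrite mulr_ge0 ?powR_ge0.
move=> t t0; rewrite /heat powRM ?mulr_ge0 ?pi_ge0 ?(ltW t0)//.
have -> : t `^ (- e) * ((4 * pi) `^ (- q) * t `^ (- q) * expR (- (rho / (4 * t)))) =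
  (4 * pi) `^ (- q) * (t `^ (- e) * t `^ (- q) * expR (- (rho / 4 / t))).
  by have -> : rho / (4 * t) = rho / 4 / t; [rewrite invfM mulrA | ring].
rewrite -powRD; last by rewrite (gt_eqF t0) implybT.
by rewrite -opprD [e + q]addrC ler_wpM2l ?powR_ge0// hC.
Qed.

Lemma integrable_gdens h k : 0 < h -> mu.-integrable D (EFin \o gdens h k).
Proof.
move=> h0; apply/integrableP; split.
  by apply/measurable_EFinP; exact: measurable_gdens.
under eq_integral => t.
  rewrite inE/= in_itv/= andbT => t0.
  rewrite ger0_norm ?gdens_ge0 ?(ltW t0)//; over.
by rewrite integral_gdens// ltry.
Qed.

Lemma Rintegral_gdens h k : 0 < h -> \int[mu]_(t in D) gdens h k t = 1.
Proof. by move=> h0; rewrite /Rintegral integral_gdens. Qed.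

Lemma integrable_gdens_heat q rho h k : 0 <= q -> 0 < rho -> 0 < h ->
  mu.-integrable D (EFin \o (fun t => gdens h k t * heat q rho t)).
Proof.
move=> q0 rho0 h0.
have [|C C0 hC] := @heat_bound q 0 rho _ rho0; first by rewrite addr0.
apply: (@integrableM_real _ _ _ _ _ _ _ C) => //.
- exact: integrable_gdens.
- exact: measurable_heat.
- move=> t /=; rewrite in_itv/= andbT => t0.
  by have := hC t t0; rewrite oppr0 powRr0 mul1r ger0_norm ?heat_ge0.
Qed.

(** The discrete heat kernel [dgauss k.+1 h] at squared distance [rho], for
[q = N / 2]. *)
Definition dheat q h k rho : R := \int[mu]_(t in D) (gdens h k t * heat q rho t).

(** Exponential tilting changes the scale of a Gamma density. Together with
[gdens_shift] it sums the series over the shapes: the sum over [i] of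
[C(k + i, k) b^i gdens h (k + i)] is [gdens h k t * expR (b * (t / h))]. *)
Lemma gdens_tilt h k b t : 0 < h -> b < 1 ->
  gdens h k t * expR (b * (t / h)) = (1 - b) ^- k.+1 * gdens (h / (1 - b)) k t.
Proof.
move=> h0 b1; have b0 : 0 < 1 - b by rewrite subr_gt0.
rewrite /gdens.
have -> : expR (- (t / (h / (1 - b)))) = expR (- (t / h)) * expR (b * (t / h)).
  by rewrite -expRD; congr expR; field; rewrite !gt_eqF.
have k0 : k`!%:R != 0 :> R by rewrite pnatr_eq0 -lt0n fact_gt0.
by rewrite exprMn exprVn !exprS; field; rewrite k0 ?expf_neq0 ?gt_eqF.
Qed.

Lemma gdens_shift h k i b t : 0 < h ->
  'C(k + i, k)%:R * b ^+ i * gdens h (k + i) t =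
  gdens h k t * ((b * (t / h)) ^+ i / i`!%:R).
Proof.
move=> h0; rewrite /gdens.
have F : ('C(k + i, k) * (k`! * i`!))%:R = (k + i)`!%:R :> R.
  by rewrite -(bin_fact (leq_addr i k)) addKn.
rewrite -F !natrM.
have k0 : k`!%:R != 0 :> R by rewrite pnatr_eq0 -lt0n fact_gt0.
have i0 : i`!%:R != 0 :> R by rewrite pnatr_eq0 -lt0n fact_gt0.
have C0 : 'C(k + i, k)%:R != 0 :> R by rewrite pnatr_eq0 -lt0n bin_gt0 leq_addr.
rewrite !exprMn exprVn !exprS !exprD; field.
by rewrite k0 i0 C0 ?expf_neq0 ?gt_eqF.
Qed.

End HeatKernel.

(** * Summing the series of discrete heat kernels *)
Section HeatSeries.
Context {R : realType}.
Local Notation mu := (@lebesgue_measure R).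
Local Notation D := `]0%R, +oo[%classic.
Implicit Types (q h t c e rho b : R) (k n M : nat).

Lemma sum_gdens_shift h k b t M : 0 < h ->
  \sum_(J < M + k) 'C(J, k)%:R * b ^+ (J - k) * gdens h J t =
  gdens h k t * \sum_(i < M) (b * (t / h)) ^+ i / i`!%:R.
Proof.
move=> h0.
rewrite -(big_mkord xpredT (fun J => 'C(J, k)%:R * b ^+ (J - k) * gdens h J t)).
rewrite (@big_cat_nat _ _ _ k 0%N (M + k)%N) ?leq_addl//=.
rewrite big_nat big1 ?add0r; last first.
  by move=> J /andP[_ Jk]; rewrite bin_small// !mul0r.
rewrite -{1}[k]add0n big_addn addnK big_mkord mulr_sumr.
by apply: eq_bigr => i _; rewrite addnK addnC gdens_shift.
Qed.

Lemma partial_sum_dheat q h k b rho M : 0 <= q -> 0 < rho -> 0 < h ->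
  \sum_(J < M + k) 'C(J, k)%:R * b ^+ (J - k) * dheat q h J rho =
  \int[mu]_(t in D) (gdens h k t * (\sum_(i < M) (b * (t / h)) ^+ i / i`!%:R)
     * heat q rho t).
Proof.
move=> q0 rho0 h0.
under [RHS]eq_Rintegral do rewrite -sum_gdens_shift// mulr_suml.
rewrite Rintegral_sum//.
  apply: eq_bigr => J _; rewrite /dheat -RintegralZl//.
    by apply: eq_Rintegral => t _; rewrite !mulrA.
  exact: integrable_gdens_heat.
move=> J; rewrite (_ : _ \o _ = (fun t =>
   ('C(J, k)%:R * b ^+ (J - k))%:E * (gdens h J t * heat q rho t)%:E)%E).
  by apply: integrableZl => //; exact: integrable_gdens_heat.
by apply/funext => t; rewrite -EFinM mulrA.
Qed.

Lemma integrable_partial q h k b rho M : 0 <= q -> 0 < rho -> 0 < h ->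
  mu.-integrable D (EFin \o (fun t =>
    gdens h k t * (\sum_(i < M) (b * (t / h)) ^+ i / i`!%:R) * heat q rho t)).
Proof.
move=> q0 rho0 h0.
rewrite (_ : _ \o _ = (fun t => \sum_(J < M + k)
  ('C(J, k)%:R * b ^+ (J - k))%:E * (gdens h J t * heat q rho t)%:E)%E).
  apply: integrable_sum => // J _.
  by apply: integrableZl => //; exact: integrable_gdens_heat.
apply/funext => t; rewrite /= -sum_gdens_shift// mulr_suml -sumEFin.
by apply: eq_bigr => J _; rewrite -EFinM [in RHS]mulrA.
Qed.

(** By [partial_sum_dheat] the partial sums are integrals of partial sums of the
exponential series, so it is enough to dominate the remainders of the latter by
functions whose integrals tend to [0]. *)
Lemma dheat_series_cvg_of q h k b rho (e : nat -> R) (E : nat -> R -> R) :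
  0 <= q -> 0 < rho -> 0 < h -> b < 1 ->
  e M @[M --> \oo] --> 0 ->
  (forall M, mu.-integrable D (EFin \o E M) /\ \int[mu]_(t in D) E M t = e M) ->
  (forall M t, 0 < t ->
    `|\sum_(i < M.+1) (b * (t / h)) ^+ i / i`!%:R - expR (b * (t / h))| *
      gdens h k t * heat q rho t <= E M t) ->
  \sum_(J < M) 'C(J, k)%:R * b ^+ (J - k) * dheat q h J rho @[M --> \oo] -->
    (1 - b) ^- k.+1 * dheat q (h / (1 - b)) k rho.
Proof.
move=> q0 rho0 h0 b1 e0 HE bE.
have hb : 0 < h / (1 - b) by rewrite divr_gt0// subr_gt0.
rewrite -(cvg_shiftn (1 + k)).
under eq_cvg => M do rewrite /= addnA addn1 partial_sum_dheat//.
have I1 : mu.-integrable D (EFin \o (fun t =>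
    gdens h k t * expR (b * (t / h)) * heat q rho t)).
  rewrite (_ : _ \o _ = (fun t => ((1 - b) ^- k.+1)%:E *
      (gdens (h / (1 - b)) k t * heat q rho t)%:E)%E).
    by apply: integrableZl => //; exact: integrable_gdens_heat.
  by apply/funext => t; rewrite -EFinM mulrA -gdens_tilt//.
have -> : (1 - b) ^- k.+1 * dheat q (h / (1 - b)) k rho =
    \int[mu]_(t in D) (gdens h k t * expR (b * (t / h)) * heat q rho t).
  rewrite -RintegralZl//; last exact: integrable_gdens_heat.
  by apply: eq_Rintegral => t _; rewrite gdens_tilt// mulrA.
apply/cvgrPdist_le => /= eps eps0.
have /cvgrPdist_le/(_ _ eps0) := e0.
apply: filterS => M; rewrite sub0r normrN => eM.
rewrite distrC; apply: le_trans (le_trans (ler_norm _) eM).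
have [IE <-] := HE M.
apply: Rintegral_dist_le => //; first exact: integrable_partial.
move=> t /=; rewrite in_itv/= andbT => t0.
set S := \sum_(i < M.+1) _; set X := expR _.
have -> : gdens h k t * S * heat q rho t - gdens h k t * X * heat q rho t =
  (S - X) * gdens h k t * heat q rho t by ring.
rewrite (normrM _ (heat q rho t)) (normrM _ (gdens h k t)).
rewrite (ger0_norm (heat_ge0 _ _ _)) (ger0_norm (gdens_ge0 k h0 (ltW t0))).
exact: bE.
Qed.

(** Choose [be] between [|b|] and [1]. The remainder of order [M] is at most
[(|b| / be)^M * expR (be * (t / h))], and the exponential is integrable against
[gdens h k] because [be < 1]. *)
Lemma dheat_series_cvg_geometric q h k b rho :
  0 <= q -> 0 < rho -> 0 < h -> `|b| < 1 ->
  \sum_(J < M) 'C(J, k)%:R * b ^+ (J - k) * dheat q h J rho @[M --> \oo] -->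
    (1 - b) ^- k.+1 * dheat q (h / (1 - b)) k rho.
Proof.
move=> q0 rho0 h0 b1.
have [be [bbe be1]] : exists be, `|b| < be /\ be < 1.
  by exists ((`|b| + 1) / 2); split; lra.
have be0 : 0 < be by exact: le_lt_trans bbe.
have q00 : 0 <= q + 0 by rewrite addr0.
have [C C0 hC] := heat_bound q00 rho0.
have hb : 0 < h / (1 - be) by rewrite divr_gt0// subr_gt0.
apply: (@dheat_series_cvg_of _ _ _ _ _
  (fun M => (`|b| / be) ^+ M.+1 * ((1 - be) ^- k.+1 * C))
  (fun M t => (`|b| / be) ^+ M.+1 * ((1 - be) ^- k.+1 * C) * gdens (h / (1 - be)) k t)) => //.
- by rewrite (le_lt_trans (ler_norm b)).
- rewrite -[X in _ --> X](mul0r ((1 - be) ^- k.+1 * C)); apply: cvgMl.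
  rewrite (cvg_shiftS (fun M => (`|b| / be) ^+ M)).
  by apply: cvg_expr; rewrite ger0_norm ?divr_ge0 ?(ltW be0)// ltr_pdivrMr ?mul1r.
- move=> M; split; last by rewrite RintegralZl ?Rintegral_gdens ?mulr1//; exact: integrable_gdens.
  rewrite (_ : _ \o _ = (fun t => ((`|b| / be) ^+ M.+1 * ((1 - be) ^- k.+1 * C))%:E *
     (gdens (h / (1 - be)) k t)%:E)%E).
    by apply: integrableZl => //; exact: integrable_gdens.
  by apply/funext => t; rewrite -EFinM.
- move=> M t t0.
  have s0 : 0 <= t / h by rewrite divr_ge0// ltW.
  have r := exp_remainder_geometric M.+1 bbe s0.
  have hCt := hC t t0; rewrite oppr0 powRr0 mul1r in hCt.
  have g0 := gdens_ge0 k h0 (ltW t0).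
  apply: le_trans (_ : _ <= ((`|b| / be) ^+ M.+1 * expR (be * (t / h))) * gdens h k t * C) _.
    apply: ler_pM; [exact: mulr_ge0|exact: heat_ge0| |exact: hCt].
    by rewrite ler_wpM2r// distrC.
  have -> : (`|b| / be) ^+ M.+1 * expR (be * (t / h)) * gdens h k t * C =
    (`|b| / be) ^+ M.+1 * C * (gdens h k t * expR (be * (t / h))) by ring.
  by rewrite gdens_tilt// le_eqVlt; apply/orP; left; apply/eqP; ring.
Qed.

(** The bound [s^(M + 1) / (M + 1)!] on the remainder at [s = t / h] is too weak
by itself, since its integral against [gdens h k] grows like [M^k]. The heat
kernel is at most [C t^(- k - 1 / 2)]; the factor [t^(- k)] turns the product
into a multiple of [gdens h M.+1], and the last factor [t^(- 1 / 2)], which has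
size [M^(- 1 / 2)] where this density lives, makes the integral tend to [0]. *)
Lemma dheat_series_cvg_alternating q h k rho :
  k%:R + 2^-1 <= q -> 0 < rho -> 0 < h ->
  \sum_(J < M) 'C(J, k)%:R * (- 1) ^+ (J - k) * dheat q h J rho @[M --> \oo] -->
    (1 - (-1)) ^- k.+1 * dheat q (h / (1 - (-1))) k rho.
Proof.
move=> kq rho0 h0.
have q0 : 0 <= q by apply: le_trans kq; rewrite addr_ge0.
have qk : 0 <= q - (k%:R + 2^-1) by rewrite subr_ge0.
have [C C0 hC] := heat_bound qk rho0.
pose K := C / (h ^+ k * k`!%:R) / 2.
have K0 : 0 <= K.
  by rewrite !divr_ge0// mulr_ge0// exprn_ge0// ltW.
pose ep M := M.+1%:R `^ (- 2^-1) : R.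
have ep0 M : 0 < ep M by rewrite powR_gt0// ltr0n.
have ep2 M : ep M ^+ 2 = M.+1%:R^-1.
  rewrite /ep expr2 -powRD; last by rewrite pnatr_eq0 implybT.
  by rewrite -opprD (_ : 2^-1 + 2^-1 = 1) ?powR_inv1//; lra.
have epV M : 1 / (M.+1%:R * ep M) = ep M.
  have := ep2 M; move=> /(congr1 (fun x => x^-1)); rewrite invrK => <-.
  by field; rewrite gt_eqF// ep0.
have h1 : 1 - (-1) = 2 :> R by lra.
apply: (@dheat_series_cvg_of _ _ _ _ _
  (fun M => K * (1 + 1 / h) * ep M)
  (fun M t => K * ep M * gdens h M.+1 t + K / (M.+1%:R * h * ep M) * gdens h M t)) => //.
- rewrite -[X in _ --> X](mulr0 (K * (1 + 1 / h))); apply: cvgMr.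
  apply/cvgrPdist_le => /= eps eps0.
  have /cvgrPdist_le/(_ _ (exprn_gt0 2 eps0)) := @cvg_harmonic R.
  apply: filterS => M; rewrite !sub0r !normrN [harmonic M]/= -ep2.
  rewrite (ger0_norm (sqr_ge0 _)) (ger0_norm (ltW (ep0 M))).
  by rewrite ler_sqr// nnegrE ltW.
- move=> M.
  have I1 := integrable_gdens M h0; have I2 := integrable_gdens M.+1 h0.
  have J1 : mu.-integrable D (fun t => (K * ep M)%:E * (gdens h M.+1 t)%:E)%E.
    exact: integrableZl.
  have J2 : mu.-integrable D (fun t => (K / (M.+1%:R * h * ep M))%:E * (gdens h M t)%:E)%E.
    exact: integrableZl.
  split.
    rewrite (_ : _ \o _ = (fun t => (K * ep M)%:E * (gdens h M.+1 t)%:E) \+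
      (fun t => (K / (M.+1%:R * h * ep M))%:E * (gdens h M t)%:E))%E.
      exact: integrableD.
    by apply/funext => t; rewrite /= -!EFinM.
  rewrite RintegralD//; [|by under eq_fun do rewrite EFinM..].
  rewrite !RintegralZl// !Rintegral_gdens// !mulr1.
  have -> : K / (M.+1%:R * h * ep M) = K / h * (1 / (M.+1%:R * ep M)).
    have m0 : M.+1%:R != 0 :> R by rewrite pnatr_eq0.
    by field; rewrite addrC natr1 m0 !gt_eqF.
  by rewrite epV; field; rewrite gt_eqF.
- move=> M t t0.
  have s0 : 0 <= t / h by rewrite divr_ge0// ltW.
  have r := exp_remainder_alternating M.+1 s0.
  have hCt := hC t t0; rewrite opprK in hCt.
  rewrite mulN1r distrC.
  apply: le_trans (_ : (t / h) ^+ M.+1 / M.+1`!%:R * gdens h k t *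
    (C * t `^ (- (k%:R + 2^-1))) <= _).
    apply: ler_pM; [apply: mulr_ge0 => //; exact: gdens_ge0 (ltW t0) |exact: heat_ge0| |].
      by rewrite ler_wpM2r// gdens_ge0// ltW.
    by rewrite powRN ler_pdivlMr ?powR_gt0// mulrC.
  have -> : (t / h) ^+ M.+1 / M.+1`!%:R * gdens h k t * (C * t `^ (- (k%:R + 2^-1))) =
    K * (2 * t `^ (- 2^-1)) * gdens h M.+1 t.
    rewrite opprD powRD; last by rewrite (gt_eqF t0) implybT.
    rewrite powRN powR_mulrn ?(ltW t0)// /K /gdens exprMn exprVn.
    have F1 : k`!%:R != 0 :> R by rewrite pnatr_eq0 -lt0n fact_gt0.
    have F2 : M.+1`!%:R != 0 :> R by rewrite pnatr_eq0 -lt0n fact_gt0.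
    rewrite (exprS h k) (exprS h M.+1); field.
    by rewrite F1 F2 !expf_neq0// !gt_eqF.
  set y := t `^ (- 2^-1).
  have y2 : y ^+ 2 = t^-1.
    rewrite /y expr2 -powRD; last by rewrite (gt_eqF t0) implybT.
    by rewrite -opprD (_ : 2^-1 + 2^-1 = 1) ?powR_inv1 ?(ltW t0)//; lra.
  (* by the inequality of means [t^(-1/2)] is split between a constant and [1/t],
   and [1/t] turns [gdens h M.+1] into a multiple of [gdens h M] *)
have am : 2 * y <= ep M + y ^+ 2 / ep M.
    rewrite -subr_ge0 (_ : _ - _ = (ep M - y) ^+ 2 / ep M).
      by rewrite divr_ge0 ?sqr_ge0// ltW.
    by field; rewrite gt_eqF.
  have -> : K / (M.+1%:R * h * ep M) * gdens h M t = K / ep M * (t^-1 * gdens h M.+1 t).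
    have := gdensS M t h0 => /(congr1 (fun x => x / t)).
    rewrite mulrAC mulfV ?gt_eqF// mul1r => ->.
    have m0 : M.+1%:R != 0 :> R by rewrite pnatr_eq0.
    by field; rewrite addrC natr1 m0 !gt_eqF.
  have -> : K * ep M * gdens h M.+1 t + K / ep M * (t^-1 * gdens h M.+1 t) =
     K * (ep M + y ^+ 2 / ep M) * gdens h M.+1 t by rewrite y2; ring.
  by rewrite ler_wpM2r ?gdens_ge0 ?(ltW t0)// ler_wpM2l.
Qed.

End HeatSeries.

(** * Divergence of the series *)
Section Divergence.
Context {R : realType}.
Local Notation mu := (@lebesgue_measure R).
Local Notation D := `]0%R, +oo[%classic.
Implicit Types (q h t c e rho b : R) (k n m M J : nat).

(** Jensen's inequality for the probability density [gdens h J.+1]: the heat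
kernel is [expR (y t)] with [y] a combination of [- ln t] and [- 1 / t], and the
mean of [t] is [(J + 2) h], that of [1 / t] is [1 / ((J + 1) h)]. *)
Lemma dheat_ge q h rho : 0 <= q -> 0 < rho -> 0 < h ->
  exists2 c, 0 < c & forall J, c * J.+2%:R `^ (- q) <= dheat q h J.+1 rho.
Proof.
move=> q0 rho0 h0.
exists ((4 * pi * h) `^ (- q) * expR (- (rho / (4 * h)))).
  by rewrite mulr_gt0 ?expR_gt0 ?powR_gt0// !mulr_gt0// pi_gt0.
move=> J.
have J1 : 0 < J.+1%:R :> R by rewrite ltr0n.
have J2 : 0 < J.+2%:R :> R by rewrite ltr0n.
pose ka := rho / (4 * h * J.+1%:R).
pose y0 := - q * ln (4 * pi * h * J.+2%:R) - ka.
apply: (@le_trans _ _ (expR y0)).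
  rewrite mulrAC -powRM; last 2 first.
  - by rewrite !mulr_ge0 ?pi_ge0// ltW.
  - by rewrite ltW.
  rewrite {1}/powR gt_eqF; last by rewrite !mulr_gt0// pi_gt0.
  rewrite -expRD ler_expR /y0 lerD2l lerN2 /ka.
  rewrite ler_wpM2l ?(ltW rho0)// lef_pV2 ?posrE ?mulr_gt0//.
  by rewrite ler_peMr ?(ler_nat _ 1)// mulr_ge0// ltW.
have I k := integrable_gdens k h0.
(* minorant of the integrand: the tangent line of [expR] at [y0], where [ln] is
   itself replaced by its tangent line; its integral is [expR y0] *)
pose L t := expR y0 * ((1 + q + ka) * gdens h J.+1 t - q * gdens h J.+2 t - ka * gdens h J t).
have IZ (x : R) k : mu.-integrable D (EFin \o (fun t => x * gdens h k t)).
  rewrite (_ : _ \o _ = fun t => (x%:E * (gdens h k t)%:E)%E).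
    by apply: integrableZl => //; exact: I.
  by apply/funext => t; rewrite -EFinM.
have IB (f g : R -> R) : mu.-integrable D (EFin \o f) -> mu.-integrable D (EFin \o g) ->
    mu.-integrable D (EFin \o (fun t => f t - g t)).
  move=> If Ig; rewrite (_ : _ \o _ = (EFin \o f) \- (EFin \o g))%E; first exact: integrableB.
  by apply/funext => t; rewrite /= EFinB.
have IL : mu.-integrable D (EFin \o L).
  rewrite (_ : _ \o _ = fun t => ((expR y0)%:E *
      ((1 + q + ka) * gdens h J.+1 t - q * gdens h J.+2 t - ka * gdens h J t)%:E)%E).
    by apply: integrableZl => //; apply: (IB _ _ (IB _ _ (IZ _ _) (IZ _ _)) (IZ _ _)).
  by apply/funext => t; rewrite -EFinM.
have -> : expR y0 = \int[mu]_(t in D) L t.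
  rewrite /L RintegralZl//; last exact: (IB _ _ (IB _ _ (IZ _ _) (IZ _ _)) (IZ _ _)).
  rewrite RintegralB//; last exact: (IB _ _ (IZ _ _) (IZ _ _)).
  by rewrite RintegralB// !RintegralZl// !Rintegral_gdens//; ring.
apply: le_Rintegral => //; first exact: integrable_gdens_heat.
move=> t /=; rewrite in_itv/= andbT => t0.
rewrite /L.
have -> : gdens h J.+2 t = t / (J.+2%:R * h) * gdens h J.+1 t.
  by rewrite mulrAC gdensS// mulrAC mulfV ?mul1r// gt_eqF// mulr_gt0.
have -> : gdens h J t = J.+1%:R * h / t * gdens h J.+1 t.
  by rewrite mulrAC -gdensS// mulrAC mulfV ?mul1r// gt_eqF.
rewrite mulrC.
have -> : (1 + q + ka) * gdens h J.+1 t - q * (t / (J.+2%:R * h) * gdens h J.+1 t) -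
  ka * (J.+1%:R * h / t * gdens h J.+1 t) =
  gdens h J.+1 t * (1 + q + ka - q * (t / (J.+2%:R * h)) - ka * (J.+1%:R * h / t)) by ring.
rewrite -[leLHS]mulrA ler_wpM2l ?gdens_ge0 ?(ltW t0)//.
rewrite /heat {1}/powR gt_eqF ?mulr_gt0 ?pi_gt0// -expRD.
set y := - q * _ - _.
apply: (@le_trans _ _ ((1 + (y - y0)) * expR y0)); last first.
  have -> : expR y = expR (y - y0) * expR y0 by rewrite -expRD subrK.
  rewrite ler_wpM2r ?expR_ge0//.
  exact: expR_ge1Dx.
rewrite ler_wpM2r ?expR_ge0//.
have lnb : ln (4 * pi * t) - ln (4 * pi * h * J.+2%:R) <= t / (J.+2%:R * h) - 1.
  rewrite -ln_div ?posrE ?mulr_gt0 ?pi_gt0//.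
  have -> : t / (J.+2%:R * h) = 4 * pi * t / (4 * pi * h * J.+2%:R).
    move: (@pi R) (pi_gt0 R) => P p0; field.
    by rewrite -[2 + J%:R]natrD add2n !gt_eqF.
  by apply: ln_le_subr1; rewrite divr_gt0// !mulr_gt0// pi_gt0.
have := ler_wpM2l q0 lnb.
have kaE : ka * (J.+1%:R * h / t) = rho / (4 * t).
  by rewrite /ka; field; rewrite addrC natr1 !gt_eqF.
rewrite kaE /y /y0.
move: (ln (4 * pi * t)) (ln _) (t / _) (rho / _) (ka) => *; lra.
Qed.

Lemma leq_expn2 (i j k : nat) : (i <= j)%N -> (i ^ k <= j ^ k)%N.
Proof. by case: k => // k ij; rewrite leq_exp2r. Qed.

Lemma expn_le_ffact J m : ((J - m) ^ m <= J ^_ m)%N.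
Proof.
elim: m => [|m IH]; first by rewrite expn0 ffactn0.
rewrite ffactnSr expnSr leq_mul//; last by rewrite leq_sub2l.
by apply: leq_trans IH; apply: leq_expn2; rewrite leq_sub2l.
Qed.

Lemma bin_le_expn J k : ('C(J, k) <= J ^ k)%N.
Proof.
apply: (@leq_trans (J ^_ k)); first by rewrite -bin_ffact leq_pmulr// fact_gt0.
elim: k => [|k IH]; first by rewrite ffactn0 expn0.
by rewrite ffactnSr expnSr leq_mul// leq_subr.
Qed.

(** The sum is a polynomial in [J] of degree exactly [m]. *)
Lemma bin_poly_ge (d : nat -> R) m : d m != 0 ->
  exists2 c, 0 < c & exists J0, forall J, (J0 <= J)%N ->
    c * J%:R ^+ m <= `|\sum_(k < m.+1) d k * 'C(J, k)%:R|.
Proof.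
move=> dm0.
have dm : 0 < `|d m| by rewrite normr_gt0.
pose A := `|d m| / (2 * (m.+1%:R ^+ m * m`!%:R)).
pose B := \sum_(k < m) `|d k|.
have m10 : 0 < m.+1%:R ^+ m * m`!%:R :> R by rewrite mulr_gt0 ?exprn_gt0 ?ltr0n ?fact_gt0.
have A0 : 0 < A by rewrite divr_gt0// mulr_gt0.
have B0 : 0 <= B by rewrite sumr_ge0.
exists A => //.
exists (maxn m.+1 (Num.trunc (B / A)).+1) => J.
rewrite geq_max => /andP[mJ BJ].
have J0 : 0 < J%:R :> R by rewrite ltr0n (leq_trans _ mJ).
have BAJ : B <= A * J%:R.
  rewrite mulrC -ler_pdivrMr// ltW// (lt_le_trans (truncnS_gt _))//.
  by rewrite ler_nat.
have lead : J%:R ^+ m <= m.+1%:R ^+ m * m`!%:R * 'C(J, m)%:R :> R.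
  rewrite -!natrX -!natrM ler_nat -mulnA [(m`! * _)%N]mulnC bin_ffact.
  apply: leq_trans (leq_mul (leqnn _) (expn_le_ffact J m)).
  rewrite -expnMn; apply: leq_expn2; rewrite mulnBr leq_subRL; last by rewrite leq_mul// ltnW.
  by rewrite [X in (_ <= X)%N]mulSn addnC leq_add2l mulnC leq_mul.
have low : `|\sum_(k < m) d k * 'C(J, k)%:R| <= A * J%:R ^+ m.
  have [m0|m0] := posnP m.
    rewrite big1 ?normr0; last by move=> k _; have := ltn_ord k; rewrite [X in (_ < X)%N]m0.
    by rewrite mulr_ge0// ltW.
  apply: (@le_trans _ _ (B * J%:R ^+ m.-1)); last first.
    by rewrite -{2}(prednK m0) exprS mulrA ler_wpM2r// exprn_ge0.
  apply: le_trans (ler_norm_sum _ _ _) _; rewrite /B mulr_suml.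
  apply: ler_sum => k _; rewrite normrM normr_nat ler_wpM2l//.
  rewrite -natrX ler_nat (leq_trans (bin_le_expn J k))//.
  rewrite leq_pexp2l//; first by rewrite -(ltr_nat R).
  by rewrite -ltnS prednK.
rewrite big_ord_recr/=.
have := ler_normB (\sum_(k < m) d k * 'C(J, k)%:R + d m * 'C(J, m)%:R)
  (\sum_(k < m) d k * 'C(J, k)%:R).
rewrite addrAC subrr add0r normrM normr_nat => h.
have : 2 * A * J%:R ^+ m <= `|d m| * 'C(J, m)%:R.
  have -> : 2 * A = `|d m| / (m.+1%:R ^+ m * m`!%:R).
    by rewrite /A; move: (_ ^+ m * _) m10 => X X0; field; rewrite gt_eqF.
  by rewrite -mulrA ler_wpM2l// ler_pdivrMl.
lra.
Qed.

End Divergence.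

(** * Convergence or divergence of mixtures *)
Section SeriesDichotomy.
Context {R : realType}.
Implicit Types (a q h t e rho b : R) (c : nat -> R) (k n m M J : nat).

Lemma growth_lower b q m : 0 <= q -> 1 <= b -> 1 < b \/ q <= m%:R ->
  exists2 de, 0 < de & forall J,
    de <= b ^+ J.+1 * J.+1%:R ^+ m * J.+2%:R `^ (- q).
Proof.
move=> q0 b1 H.
have J12 J : J.+2%:R <= 2 * J.+1%:R :> R.
  by rewrite -natrM ler_nat mul2n -addnn addnS ltnS leq_addr.
have bJ J : 1 <= b ^+ J by rewrite exprn_ege1.
have powq J n : q <= n%:R -> (J.+2%:R ^+ n)^-1 <= J.+2%:R `^ (- q).
  move=> qn; rewrite powRN lef_pV2 ?posrE ?exprn_gt0 ?powR_gt0//.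
  by rewrite -powR_mulrn// ler_powR// (ler_nat _ 1).
case: H => [b1'|qm].
- pose n := (Num.trunc q).+1.
  have qn : q <= n%:R by rewrite ltW// truncnS_gt.
  have L0 : 0 < ln b by rewrite ln_gt0.
  exists ((ln b / 2) ^+ n / n`!%:R); first by
    rewrite divr_gt0 ?exprn_gt0 ?ltr0n ?fact_gt0// divr_gt0.
  move=> J.
  have e1 : (J.+1%:R * ln b) ^+ n / n`!%:R <= b ^+ J.+1.
    have b0 : 0 < b by lra.
    have <- : expR (J.+1%:R * ln b) = b ^+ J.+1.
      by rewrite mulrC expRM_natr lnK.
    have := @expR_ge1Dxn R (J.+1%:R * ln b) (Num.trunc q) (mulr_ge0 (ler0n _ _) (ltW L0)).
    by rewrite -/n; lra.
  apply: (@le_trans _ _ ((J.+1%:R * ln b) ^+ n / n`!%:R * 1 * (J.+2%:R ^+ n)^-1)).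
    rewrite mulr1 mulrAC ler_wpM2r ?invr_ge0// -expr_div_n.
    rewrite lerXn2r ?nnegrE ?divr_ge0 ?mulr_ge0 ?(ltW L0)//.
    rewrite ler_pdivlMr ?ltr0n// mulrAC ler_pdivrMr//.
    have -> : J.+1%:R * ln b * 2 = ln b * (2 * J.+1%:R) by ring.
    by rewrite ler_wpM2l// ltW.
  apply: ler_pM; [|by rewrite invr_ge0 exprn_ge0| |exact: powq].
    by rewrite mulr1 divr_ge0// exprn_ge0// mulr_ge0// ltW.
  apply: ler_pM => //; first by rewrite divr_ge0// exprn_ge0// mulr_ge0// ltW.
  by rewrite exprn_ege1// (ler_nat _ 1).
- exists ((2 ^+ m)^-1); first by rewrite invr_gt0 exprn_gt0.
  move=> J.
  apply: (@le_trans _ _ (1 * J.+1%:R ^+ m * (J.+2%:R ^+ m)^-1)).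
    rewrite mul1r -[leLHS]mulr1 mulrC ler_pdivrMr ?exprn_gt0// mulrAC ler_pdivlMr ?exprn_gt0//.
    by rewrite mul1r -exprMn lerXn2r ?nnegrE ?mulr_ge0// mulrC.
  apply: ler_pM; [by rewrite mul1r exprn_ge0|by rewrite invr_ge0 exprn_ge0| |exact: powq].
  by rewrite ler_wpM2r ?exprn_ge0.
Qed.

(** For [c = sibuya al m] this is the coefficient of [z^m] in
[(1 - z)^(al - 1) (1 - a (1 - z)^al)^J], by [wright_coef]. *)
Definition mixcoef c a m J : R :=
  \sum_(k < m.+1) c k * ('C(J, k)%:R * a ^+ k * (1 - a) ^+ (J - k)).

(** The term [k = m] of [mixcoef] dominates and has the size of
[|1 - a|^J J^m], while [dheat] is at least a multiple of [J^(- q)]. *)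
Lemma mix_dheat_lower c a q h rho m : 0 <= q -> 0 < rho -> 0 < h ->
  0 < a -> c m != 0 -> 1 - a <= -1 -> 1 - a < -1 \/ q <= m%:R ->
  exists2 de, 0 < de & exists J0, forall J, (J0 <= J)%N ->
    de <= `|mixcoef c a m J * dheat q h J rho|.
Proof.
move=> q0 rho0 h0 a0 cm b1 H.
have b0 : 1 - a != 0 by apply/eqP; lra.
have nb1 : 1 <= `|1 - a| by rewrite ler0_norm; lra.
have nbH : 1 < `|1 - a| \/ q <= m%:R.
  by case: H => ?; [left; rewrite ler0_norm; lra|right].
have [de1 de10 hde1] := growth_lower q0 nb1 nbH.
have [c2 c20 hc2] := dheat_ge q0 rho0 h0.
pose d k := c k * a ^+ k / (1 - a) ^+ k.
have dm : d m != 0 by rewrite /d !mulf_neq0 ?invr_eq0 ?expf_neq0// gt_eqF.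
have [c1 c10 [J0 hJ0]] := bin_poly_ge dm.
exists (de1 * c1 * c2); first by rewrite !mulr_gt0.
exists (maxn J0 m).+1 => -[//|J]; rewrite ltnS geq_max => /andP[J0J mJ].
have -> : mixcoef c a m J.+1 = (1 - a) ^+ J.+1 * \sum_(k < m.+1) d k * 'C(J.+1, k)%:R.
  rewrite /mixcoef mulr_sumr; apply: eq_bigr => k _.
  have kJ : (k <= J.+1)%N by rewrite (leq_trans (ltnSE (ltn_ord k)))// ltnW.
  by rewrite /d expfB_cond ?(negbTE b0)//; ring.
rewrite 2!normrM normrX.
have h1 := hJ0 J.+1 (leqW J0J).
have h2 : c2 * J.+2%:R `^ (- q) <= `|dheat q h J.+1 rho|.
  by rewrite (le_trans (hc2 J))// ler_norm.
apply: (@le_trans _ _ (`|1 - a| ^+ J.+1 * (c1 * J.+1%:R ^+ m) * (c2 * J.+2%:R `^ (- q)))).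
  have -> : `|1 - a| ^+ J.+1 * (c1 * J.+1%:R ^+ m) * (c2 * J.+2%:R `^ (- q)) =
    `|1 - a| ^+ J.+1 * J.+1%:R ^+ m * J.+2%:R `^ (- q) * c1 * c2 by ring.
  by rewrite !ler_wpM2r// ltW.
apply: ler_pM => //.
- by rewrite mulr_ge0 ?exprn_ge0// mulr_ge0 ?exprn_ge0// ltW.
- by rewrite mulr_ge0 ?powR_ge0// ltW.
- by rewrite ler_wpM2l// exprn_ge0.
Qed.

Lemma mix_dheat_dvg c a q h rho m : 0 <= q -> 0 < rho -> 0 < h ->
  0 < a -> c m != 0 -> 1 - a <= -1 -> 1 - a < -1 \/ q <= m%:R ->
  ~ cvgn (fun M => \sum_(J < M) mixcoef c a m J * dheat q h J rho).
Proof.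
move=> q0 rho0 h0 a0 cm b1 H cv.
have [de de0 [J0 hJ]] := mix_dheat_lower q0 rho0 h0 a0 cm b1 H.
pose u J := mixcoef c a m J * dheat q h J rho.
have cs : cvgn (series u).
  rewrite (_ : series u = fun M => \sum_(J < M) mixcoef c a m J * dheat q h J rho)//.
  by apply/funext => M; rewrite /series/= big_mkord.
have /cvgrPdist_lt/(_ _ de0)[n _ hn] := cvg_series_cvg_0 cs.
have := hn (maxn n J0) (leq_maxl _ _).
by rewrite /= sub0r normrN ltNge hJ// leq_maxr.
Qed.

Lemma mix_dheat_cvg c a q h rho m : 0 <= q -> 0 < rho -> 0 < h -> 0 < a ->
  `|1 - a| < 1 \/ 1 - a = -1 /\ m%:R + 2^-1 <= q ->
  \sum_(J < M) mixcoef c a m J * dheat q h J rho @[M --> \oo] -->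
    a^-1 * \sum_(k < m.+1) c k * dheat q (h / a) k rho.
Proof.
move=> q0 rho0 h0 a0 H.
have E : (fun M => \sum_(J < M) mixcoef c a m J * dheat q h J rho) =
  (fun M => \sum_(k < m.+1) c k * a ^+ k *
     \sum_(J < M) 'C(J, k)%:R * (1 - a) ^+ (J - k) * dheat q h J rho).
  apply/funext => M; under eq_bigr do rewrite /mixcoef mulr_suml.
  rewrite exchange_big; apply: eq_bigr => k _; rewrite mulr_sumr.
  by apply: eq_bigr => J _; ring.
have -> : a^-1 * \sum_(k < m.+1) c k * dheat q (h / a) k rho =
  \sum_(k < m.+1) c k * a ^+ k * ((1 - (1 - a)) ^- k.+1 * dheat q (h / (1 - (1 - a))) k rho).
  rewrite mulr_sumr; apply: eq_bigr => k _.
  have -> : 1 - (1 - a) = a by ring.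
  by rewrite exprS; field; rewrite expf_neq0 gt_eqF.
rewrite E; apply: cvg_sumr => k; apply: cvgMr.
case: H => [b1|[b1 mq]]; first exact: dheat_series_cvg_geometric.
rewrite b1; apply: dheat_series_cvg_alternating => //.
by apply: le_trans mq; rewrite lerD2r ler_nat -ltnS.
Qed.

End SeriesDichotomy.

(** * Integrals of powers of 1 - z over circles *)
Section CircleIntegrals.
Context {R : realType}.
Local Notation mu := (@lebesgue_measure R).
Implicit Types (be nu s t : R) (n : nat).

(** Squared modulus, logarithm of the modulus, and argument of
[1 - s e^(i t)]. This number has a positive real part for [|s| < 1], so that its
principal argument is an arctangent. *)
Definition sqmod s t : R := (1 - s * cos t) ^+ 2 + (s * sin t) ^+ 2.
Definition lnmod s t : R := ln (sqmod s t) / 2.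
Definition argm s t : R := atan (- (s * sin t) / (1 - s * cos t)).

(** Real and imaginary parts of [e^(- i nu t) (1 - s e^(i t))^be]. *)
Definition oscc be nu s t : R :=
  expR (be * lnmod s t) * cos (be * argm s t - nu * t).
Definition oscs be nu s t : R :=
  expR (be * lnmod s t) * sin (be * argm s t - nu * t).

Lemma re_gt0 s t : `|s| < 1 -> 0 < 1 - s * cos t.
Proof.
move=> s1; rewrite subr_gt0 (le_lt_trans (ler_norm _))// normrM.
by rewrite (le_lt_trans _ s1)// ler_piMr// cos_max.
Qed.

Lemma sqmod_gt0 s t : `|s| < 1 -> 0 < sqmod s t.
Proof. by move=> s1; rewrite ltr_wpDr ?sqr_ge0// exprn_gt0// re_gt0. Qed.

Lemma expR_lnmod2 s t : `|s| < 1 -> expR (lnmod s t) ^+ 2 = sqmod s t.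
Proof.
move=> s1; rewrite -expRM_natr /lnmod divfK ?pnatr_eq0// lnK// posrE.
exact: sqmod_gt0.
Qed.

Lemma cos_argm s t : `|s| < 1 -> expR (lnmod s t) * cos (argm s t) = 1 - s * cos t.
Proof.
move=> s1; have u0 := re_gt0 t s1.
apply: (pexpIrn (n := 2)) => //.
- by rewrite nnegrE mulr_ge0 ?expR_ge0// cos_atan invr_ge0 sqrtr_ge0.
- by rewrite nnegrE ltW.
rewrite exprMn expR_lnmod2// cos_atan exprVn sqr_sqrtr; last first.
  by rewrite addr_ge0// sqr_ge0.
have d0 := sqmod_gt0 t s1; rewrite /sqmod in d0 *.
move: (1 - s * cos t) (s * sin t) u0 d0 => u v u0 d0.
rewrite expr_div_n sqrrN.
have -> : 1 + v ^+ 2 / u ^+ 2 = (u ^+ 2 + v ^+ 2) / u ^+ 2 by field; rewrite gt_eqF.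
by rewrite invf_div mulrC divfK// gt_eqF.
Qed.

Lemma sin_argm s t : `|s| < 1 -> expR (lnmod s t) * sin (argm s t) = - (s * sin t).
Proof.
move=> s1; have u0 := re_gt0 t s1.
have c0 : cos (argm s t) != 0.
  by rewrite cos_atan invr_eq0 sqrtr_eq0 -ltNge ltr_pwDl// sqr_ge0.
have -> : sin (argm s t) = cos (argm s t) * tan (argm s t).
  by rewrite /tan mulrCA mulfV// mulr1.
by rewrite mulrA cos_argm// atanK mulrC divfK// gt_eqF.
Qed.

(** Real part of [e^(- i t) (1 - s e^(i t)) = e^(- i t) - s]. This factor appears
in the derivatives of the argument and of the logarithm of the modulus. *)
Lemma cos_argmB s t : `|s| < 1 ->
  expR (lnmod s t) * cos (argm s t - t) = cos t - s.
Proof.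
move=> s1; rewrite cosB mulrDr !mulrA cos_argm// sin_argm//.
have := cos2Dsin2 t; move: (cos t) (sin t) => c d cd.
have -> : (1 - s * c) * c + - (s * d) * d = c - s * (c ^+ 2 + d ^+ 2) by ring.
by rewrite cd mulr1.
Qed.

Lemma sin_argmB s t : `|s| < 1 ->
  expR (lnmod s t) * sin (argm s t - t) = - sin t.
Proof.
by move=> s1; rewrite sinB mulrBr !mulrA cos_argm// sin_argm//; ring.
Qed.

Section DeriveLogModulusArgument.
Variables (u v : R -> R) (x du dv : R).
Hypotheses (hu : is_derive x 1 u du) (hv : is_derive x 1 v dv).

Lemma is_derive_half_ln (d0 : 0 < u x ^+ 2 + v x ^+ 2) :
  is_derive x 1 (fun y => ln (u y ^+ 2 + v y ^+ 2) / 2)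
    ((u x * du + v x * dv) / (u x ^+ 2 + v x ^+ 2)).
Proof.
have h := is_derive1_ln d0.
have hd : is_derive x 1 (fun y => u y ^+ 2 + v y ^+ 2) (2 * (u x * du + v x * dv)).
  by apply: is_derive_eq; rewrite /GRing.scale/=; ring.
have hc := @is_derive1_comp _ (@ln R) (fun y => u y ^+ 2 + v y ^+ 2) _ _ _ h hd.
rewrite (_ : (fun y => _) = 2^-1 \*: (@ln R \o (fun y => u y ^+ 2 + v y ^+ 2))).
  by apply: is_derive_eq; rewrite /GRing.scale/=; field; rewrite gt_eqF.
by apply/funext => y; rewrite /GRing.scale/= mulrC.
Qed.

Lemma is_derive_atan_quot (u0 : u x != 0) :
  is_derive x 1 (fun y => atan (v y / u y))
    ((dv * u x - v x * du) / (u x ^+ 2 + v x ^+ 2)).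
Proof.
have h := is_derive1_atan (v x / u x).
have hV := is_deriveV u0 hu.
have hq : is_derive x 1 (fun y => v y / u y) ((dv * u x - v x * du) / u x ^+ 2).
  by apply: is_derive_eq; rewrite /GRing.scale/=; field.
apply: (is_derive_eq (@is_derive1_comp _ (@atan R) (fun y => v y / u y) _ _ _ h hq)).
field; rewrite u0/=.
by rewrite gt_eqF// ltr_wpDr ?sqr_ge0// exprn_even_gt0//.
Qed.

End DeriveLogModulusArgument.

Section DerivePolar.
Variables (X Y : R -> R) (x dX dY : R).
Hypotheses (hX : is_derive x 1 X dX) (hY : is_derive x 1 Y dY).

Lemma is_derive_exp_cos be (z : R -> R) dz : is_derive x 1 z dz ->
  is_derive x 1 (fun y => expR (be * X y) * cos (be * Y y - z y))
   (expR (be * X x) * (be * dX * cos (be * Y x - z x)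
      - (be * dY - dz) * sin (be * Y x - z x))).
Proof.
by move=> hz; apply: is_derive_eq; rewrite /GRing.scale/=; ring.
Qed.

Lemma is_derive_exp_sin be (z : R -> R) dz : is_derive x 1 z dz ->
  is_derive x 1 (fun y => expR (be * X y) * sin (be * Y y - z y))
   (expR (be * X x) * (be * dX * sin (be * Y x - z x)
      + (be * dY - dz) * cos (be * Y x - z x))).
Proof.
by move=> hz; apply: is_derive_eq; rewrite /GRing.scale/=; ring.
Qed.

End DerivePolar.

Lemma is_derive_lnmod_t s t : `|s| < 1 ->
  is_derive t 1 (lnmod s) (s * sin t / sqmod s t).
Proof.
move=> s1; rewrite /lnmod /sqmod.
have hu : is_derive t 1 (fun t => 1 - s * cos t) (s * sin t).
  by apply: is_derive_eq; rewrite /GRing.scale/=; ring.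
have hv : is_derive t 1 (fun t => s * sin t) (s * cos t).
  by apply: is_derive_eq; rewrite /GRing.scale/=; ring.
apply: (is_derive_eq (is_derive_half_ln hu hv (sqmod_gt0 t s1))).
by congr (_ / _); ring.
Qed.

Lemma is_derive_argm_t s t : `|s| < 1 ->
  is_derive t 1 (argm s) ((s ^+ 2 - s * cos t) / sqmod s t).
Proof.
move=> s1; rewrite /argm /sqmod.
have hu : is_derive t 1 (fun t => 1 - s * cos t) (s * sin t).
  by apply: is_derive_eq; rewrite /GRing.scale/=; ring.
have hv : is_derive t 1 (fun t => - (s * sin t)) (- (s * cos t)).
  by apply: is_derive_eq; rewrite /GRing.scale/=; ring.
apply: (is_derive_eq (is_derive_atan_quot hu hv (lt0r_neq0 (re_gt0 t s1)))).
rewrite sqrrN; congr (_ / _).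
have := cos2Dsin2 t; move: (cos t) (sin t) => a b ab.
have -> : - (s * a) * (1 - s * a) - - (s * b) * (s * b) =
  s ^+ 2 * (a ^+ 2 + b ^+ 2) - s * a by ring.
by rewrite ab mulr1.
Qed.

Lemma is_derive_lnmod_s s t : `|s| < 1 ->
  is_derive s 1 (lnmod ^~ t) ((s - cos t) / sqmod s t).
Proof.
move=> s1; rewrite /lnmod /sqmod.
have hu : is_derive s 1 (fun s => 1 - s * cos t) (- cos t).
  by apply: is_derive_eq; rewrite /GRing.scale/=; ring.
have hv : is_derive s 1 (fun s => s * sin t) (sin t).
  by apply: is_derive_eq; rewrite /GRing.scale/=; ring.
apply: (is_derive_eq (is_derive_half_ln hu hv (sqmod_gt0 t s1))).
congr (_ / _).
have := cos2Dsin2 t; move: (cos t) (sin t) => a b ab.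
have -> : (1 - s * a) * - a + s * b * b = s * (a ^+ 2 + b ^+ 2) - a by ring.
by rewrite ab mulr1.
Qed.

Lemma is_derive_argm_s s t : `|s| < 1 ->
  is_derive s 1 (argm ^~ t) (- sin t / sqmod s t).
Proof.
move=> s1; rewrite /argm /sqmod.
have hu : is_derive s 1 (fun s => 1 - s * cos t) (- cos t).
  by apply: is_derive_eq; rewrite /GRing.scale/=; ring.
have hv : is_derive s 1 (fun s => - (s * sin t)) (- sin t).
  by apply: is_derive_eq; rewrite /GRing.scale/=; ring.
apply: (is_derive_eq (is_derive_atan_quot hu hv (lt0r_neq0 (re_gt0 t s1)))).
by rewrite sqrrN; congr (_ / _); ring.
Qed.

(** Imaginary part of the derivative in [t] of
[e^(- i nu t) (1 - s e^(i t))^be], namely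
[- i nu e^(- i nu t) (1 - s e^(i t))^be
 - i be s e^(- i (nu - 1) t) (1 - s e^(i t))^(be - 1)]. *)
Lemma is_derive_oscs_t be nu s t : `|s| < 1 ->
  is_derive t 1 (oscs be nu s)
    (- (nu * oscc be nu s t) - be * s * oscc (be - 1) (nu - 1) s t).
Proof.
move=> s1.
have hz : is_derive t 1 (fun t => nu * t) nu.
  by apply: is_derive_eq; rewrite /GRing.scale/=; ring.
apply: (is_derive_eq (is_derive_exp_sin (is_derive_lnmod_t t s1)
  (is_derive_argm_t t s1) be hz)).
rewrite -(expR_lnmod2 t s1) /oscc.
have e0 : expR (lnmod s t) != 0 by rewrite gt_eqF// expR_gt0.
have hc := cos_argmB t s1; have hs := sin_argmB t s1.
have -> : (be - 1) * argm s t - (nu - 1) * t =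
  be * argm s t - nu * t - (argm s t - t) by ring.
have -> : be * lnmod s t = (be - 1) * lnmod s t + lnmod s t by ring.
rewrite expRD.
move: (be * argm s t - nu * t) (argm s t - t) hc hs => ph ps hc hs.
rewrite (cosB ph ps).
have -> : s ^+ 2 - s * cos t = - s * (expR (lnmod s t) * cos ps) by rewrite hc; ring.
have -> : s * sin t = - s * (expR (lnmod s t) * sin ps) by rewrite hs; ring.
by field.
Qed.

Lemma is_derive_oscc_s be s t : `|s| < 1 ->
  is_derive s 1 (fun s => oscc be 0 s t) (- be * oscc (be - 1) (- 1) s t).
Proof.
move=> s1.
have hz : is_derive s 1 (fun s : R => 0 * t) 0.
  exact: is_derive_cst.
apply: (is_derive_eq (is_derive_exp_cos (is_derive_lnmod_s t s1)
  (is_derive_argm_s t s1) be hz)).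
rewrite -(expR_lnmod2 t s1) /oscc mul0r subr0 mulN1r opprK.
have e0 : expR (lnmod s t) != 0 by rewrite gt_eqF// expR_gt0.
have hc := cos_argmB t s1; have hs := sin_argmB t s1.
have -> : (be - 1) * argm s t + t = be * argm s t - (argm s t - t) by ring.
have -> : be * lnmod s t = (be - 1) * lnmod s t + lnmod s t by ring.
rewrite expRD.
move: (be * argm s t) (argm s t - t) hc hs => ph ps hc hs.
rewrite (cosB ph ps).
have -> : s - cos t = - (expR (lnmod s t) * cos ps) by rewrite hc; ring.
rewrite -hs.
by field.
Qed.

Lemma continuous_oscc be nu s : `|s| < 1 -> continuous (oscc be nu s).
Proof.
move=> s1 t; apply: differentiable_continuous; apply/derivable1_diffP.
have hz : is_derive t 1 (fun t => nu * t) nu.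
  by apply: is_derive_eq; rewrite /GRing.scale/=; ring.
by case: (is_derive_exp_cos (is_derive_lnmod_t t s1) (is_derive_argm_t t s1) be hz).
Qed.

Lemma continuous_oscs be nu s : `|s| < 1 -> continuous (oscs be nu s).
Proof.
move=> s1 t; apply: differentiable_continuous; apply/derivable1_diffP.
by case: (is_derive_oscs_t be nu t s1).
Qed.

(** For integral [nu], up to the factor [2 pi s^nu], the coefficient of index
[nu] in the expansion of [(1 - z)^be]. *)
Definition circ be nu s : R := \int[mu]_(t in `[0, 2 * pi]) oscc be nu s t.

Lemma integrable_oscc be nu s : `|s| < 1 ->
  mu.-integrable `[0, 2 * pi] (EFin \o oscc be nu s).
Proof.
move=> s1; apply: continuous_compact_integrable; first exact: segment_compact.
by apply: continuous_subspaceT; exact: continuous_oscc.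
Qed.

Lemma argm_0 s : argm s 0 = 0 /\ argm s (2 * pi) = 0.
Proof.
rewrite /argm sin0 mulr0 oppr0 mul0r atan0; split => //.
by rewrite mulr_natl sin2pi mulr0 oppr0 mul0r atan0.
Qed.

(** The integral over a period of the derivative of the periodic function
[oscs be n%:R s] vanishes. *)
Lemma circ_rec be n s : `|s| < 1 ->
  n%:R * circ be n%:R s = - (be * s * circ (be - 1) (n%:R - 1) s).
Proof.
move=> s1.
have pi2 : 0 < 2 * pi :> R by rewrite mulr_gt0// pi_gt0.
have dG t := is_derive_oscs_t be n%:R t s1.
pose f t := - (n%:R * oscc be n%:R s t) - be * s * oscc (be - 1) (n%:R - 1) s t.
have cf : continuous f.
  move=> t; apply: cvgB; [apply: cvgN|]; apply: cvgMr; exact: continuous_oscc.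
have := @continuous_FTC2 R f (oscs be n%:R s) 0 (2 * pi) pi2.
have [a0 a2] := argm_0 s.
have -> : oscs be n%:R s (2 * pi) = 0.
  rewrite /oscs a2 mulr0 sub0r.
  rewrite sinN -[n%:R * _]add0r [2 * pi]mulr_natl mulr_natl.
  by rewrite (periodicn (@sinD2pi R)) sin0 oppr0 mulr0.
have -> : oscs be n%:R s 0 = 0 by rewrite /oscs a0 !mulr0 subrr sin0 mulr0.
rewrite subee// => H.
have {H} : \int[mu]_(t in `[0, 2 * pi]) f t = 0.
  rewrite /Rintegral H//.
  - exact: continuous_subspaceT.
  - split.
    + by move=> t _; case: (dG t).
    + apply: cvg_at_right_filter; exact: continuous_oscs.
    + apply: cvg_at_left_filter; exact: continuous_oscs.
  - by move=> t _; rewrite derive1E; have := dG t => ?; rewrite derive_val.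
have I1 := integrable_oscc be n%:R s1.
have I2 := integrable_oscc (be - 1) (n%:R - 1) s1.
rewrite /f => /eqP; rewrite RintegralB//; last 2 first.
- rewrite (_ : _ \o _ = fun t => ((- n%:R)%:E * (oscc be n%:R s t)%:E)%E).
    exact: integrableZl.
  by apply/funext => t; rewrite -EFinM mulNr.
- rewrite (_ : _ \o _ = fun t => ((be * s)%:E * (oscc (be - 1) (n%:R - 1) s t)%:E)%E).
    exact: integrableZl.
  by apply/funext => t; rewrite -EFinM.
under eq_Rintegral do rewrite -mulNr.
by rewrite !RintegralZl// subr_eq0 mulNr eqr_oppLR => /eqP.
Qed.

Lemma oscc_bounded be nu (r : R) : 0 <= r -> r < 1 ->
  exists2 C, 0 <= C & forall s t, `|s| < r -> `|oscc be nu s t| <= C.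
Proof.
move=> r0 r1; have r1' : 0 < 1 - r by lra.
pose K := ln 5 - ln (1 - r) : R.
exists (expR (`|be| * K)); first exact: expR_ge0.
move=> s t sr; have s1 : `|s| < 1 by exact: lt_trans r1.
have d0 := sqmod_gt0 t s1.
have sc : `|s * cos t| <= r.
  by rewrite normrM (le_trans _ (ltW sr))// ler_piMr// cos_max.
have ss : `|s * sin t| <= 1.
  by rewrite normrM (le_trans _ (ltW s1))// ler_piMr// sin_max.
have lo : (1 - r) ^+ 2 <= sqmod s t.
  rewrite (@le_trans _ _ ((1 - s * cos t) ^+ 2))// ?lerDl ?sqr_ge0//.
  rewrite ler_sqr ?nnegrE ?(ltW r1')//; last by rewrite ltW// re_gt0.
  by rewrite lerD2l lerN2 (le_trans (ler_norm _)).
have up : sqmod s t <= 5.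
  rewrite /sqmod -(real_normK (num_real (s * sin t))) -(real_normK (num_real (1 - _))).
  have : `|1 - s * cos t| <= 2.
    by rewrite (le_trans (ler_normB _ _))// normr1; lra.
  have := normr_ge0 (1 - s * cos t); have := normr_ge0 (s * sin t).
  move: (`|1 - _|) (`|s * sin t|) ss => x y; nra.
have : ln ((1 - r) ^+ 2) <= ln (sqmod s t) by rewrite ler_ln ?posrE// exprn_gt0.
rewrite lnXn// => l1.
have l2 : ln (sqmod s t) <= ln 5 by rewrite ler_ln ?posrE.
have l3 : 0 <= ln 5 :> R by rewrite ln_ge0// (ler_nat _ 1).
have l4 : ln (1 - r) <= 0 by rewrite ln_le0//; lra.
have LK : `|lnmod s t| <= K.
  rewrite ler_norml /lnmod /K; apply/andP; split.
    rewrite ler_pdivlMr//. move: l1 l3 l4; rewrite mulr2n; lra.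
  rewrite ler_pdivrMr//; lra.
rewrite /oscc normrM gtr0_norm ?expR_gt0// -[leRHS]mulr1.
apply: ler_pM => //; rewrite ?expR_ge0 ?cos_max//.
rewrite ler_expR (le_trans (ler_norm _))// normrM.
by rewrite ler_wpM2l.
Qed.

Lemma circ0 be : circ be 0 0 = 2 * pi.
Proof.
rewrite /circ; under eq_Rintegral => t _.
  rewrite /oscc /lnmod /argm /sqmod !mul0r !subr0 oppr0 mul0r atan0 mulr0 cos0 mulr1.
  rewrite expr1n expr0n addr0 ln1 mul0r mulr0 expR0.
  over.
rewrite Rintegral_cst//= mul1r lebesgue_measure_itv/=.
by rewrite lte_fin mulr_gt0 ?pi_gt0//= subr0.
Qed.

(** Differentiation under the integral sign; the result is a multiple of the
coefficient of index [-1] of [(1 - z)^(be - 1)]. *)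
Lemma derivable_circ be s : `|s| < 1 ->
  derivable (circ be 0) s 1 /\ 'D_1 (circ be 0) s = - be * circ (be - 1) (- 1) s.
Proof.
move=> s1.
have [r [sr r1]] : exists r, `|s| < r /\ r < 1 by exists ((`|s| + 1) / 2); split; lra.
have r0 : 0 <= r by rewrite ltW// (le_lt_trans _ sr).
have [C C0 hC] := oscc_bounded (be - 1) (- 1) r0 r1.
have Is : `]- r, r[%classic s by rewrite /= in_itv/= -ltr_norml.
have Ix x : `]- r, r[%classic x -> `|x| < r by rewrite /= in_itv/= -ltr_norml.
have Ix1 x : `]- r, r[%classic x -> `|x| < 1 by move=> /Ix xr; exact: lt_trans r1.
have intf x : `]- r, r[%classic x ->
    mu.-integrable `[0, 2 * pi] (EFin \o (fun t => oscc be 0 x t)).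
  by move=> /Ix1 x1; exact: integrable_oscc.
have derf x t : `]- r, r[%classic x -> `[0, 2 * pi]%classic t ->
    derivable ((fun x t => oscc be 0 x t) ^~ t) x 1.
  by move=> /Ix1 x1 _; case: (is_derive_oscc_s be t x1).
have dfE x t : `|x| < 1 ->
    partial1of2 (fun x t => oscc be 0 x t) x t = - be * oscc (be - 1) (- 1) x t.
  by move=> x1; rewrite partial1of2E; have := is_derive_oscc_s be t x1 => ?; rewrite derive_val.
have G0 (t : R) : 0 <= cst (`|be| * C) t by rewrite mulr_ge0.
have intG : mu.-integrable `[0, 2 * pi] (EFin \o cst (`|be| * C)).
  apply: continuous_compact_integrable; first exact: segment_compact.
  by apply: continuous_subspaceT => ?; exact: cst_continuous.
have Gub x t : `]- r, r[%classic x -> `[0, 2 * pi]%classic t ->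
    `|partial1of2 (fun x t => oscc be 0 x t) x t| <= cst (`|be| * C) t.
  move=> xr _; rewrite dfE; last exact: Ix1.
  by rewrite normrM normrN ler_wpM2l// hC// Ix.
rewrite -[circ be 0]/(fun s => \int[mu]_(t in `[0, 2 * pi]) oscc be 0 s t).
split.
  exact (@derivable_under_integral R _ _ mu (fun x t => oscc be 0 x t)
    `[0, 2 * pi]%classic (measurable_itv _) s (- r) r Is intf derf _ G0 intG Gub).
rewrite -derive1E.
rewrite (@differentiation_under_integral R _ _ mu (fun x t => oscc be 0 x t)
  `[0, 2 * pi]%classic (measurable_itv _) s (- r) r Is intf derf _ G0 intG Gub)//.
under eq_Rintegral do rewrite dfE//.
by rewrite RintegralZl//; exact: integrable_oscc.
Qed.

(** The mean over a circle does not depend on the radius: by [derivable_circ] its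
derivative is a multiple of a coefficient of index [-1], which is zero by
[circ_rec] at [n = 0]. At radius [0] its value is clear. *)
Lemma circ_mean be s : 0 < s -> s < 1 -> circ be 0 s = 2 * pi.
Proof.
move=> s0 s1.
have n1 x : 0 <= x <= s -> `|x| < 1.
  by move=> /andP[x0 xs]; rewrite ger0_norm// (le_lt_trans xs).
have dz x : x \in `]0, s[ -> is_derive x 1 (circ be 0) 0.
  rewrite in_itv/= => /andP[x0 xs].
  have x1 : `|x| < 1 by apply: n1; rewrite !ltW.
  have [d dE] := derivable_circ be x1.
  apply: DeriveDef => //; rewrite dE.
  have := circ_rec be 0 x1; rewrite mul0r sub0r => /esym/eqP.
  by rewrite oppr_eq0 mulrAC mulf_eq0 (gt_eqF x0) orbF mulNr => /eqP ->; rewrite oppr0.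
have cc : {within `[0, s], continuous (circ be 0)}.
  apply: derivable_within_continuous => x; rewrite in_itv/= => xs.
  by case: (derivable_circ be (n1 x xs)).
have [c _] := @MVT R (circ be 0) (fun=> 0) 0 s s0 dz cc.
by rewrite mul0r circ0 => /eqP; rewrite subr_eq0 => /eqP.
Qed.

Lemma circE be n s : 0 < s -> s < 1 ->
  circ be n%:R s = 2 * pi * s ^+ n * negbin (- be) n.
Proof.
move=> s0 s1; elim: n be => [|n IH] be.
  by rewrite circ_mean// negbin0 expr0 !mulr1.
have sn1 : `|s| < 1 by rewrite gtr0_norm.
have n0 : n.+1%:R != 0 :> R by rewrite pnatr_eq0.
apply: (mulfI n0); rewrite circ_rec//.
have -> : n.+1%:R - 1 = n%:R :> R by rewrite -natr1 addrK.
rewrite IH [RHS]mulrCA negbinSl exprS opprB addrC; ring.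
Qed.

End CircleIntegrals.

(** * The values of the Wright function *)
Section ComplexPowers.
Context {R : realType}.
Local Open Scope complex_scope.
Implicit Types (x y h t r al : R) (u v : R[i]) (n i J : nat).

Lemma cexpE x y : cexp (x +i* y) = (expR x * cos y) +i* (expR x * sin y).
Proof. by rewrite /cexp; simpc. Qed.

Lemma cexpD u v : cexp (u + v) = cexp u * cexp v.
Proof.
case: u v => [a b] [c d]; simpc; rewrite !cexpE; simpc; apply/eqP.
by rewrite eq_complex/= expRD cosD sinD; apply/andP; split; apply/eqP; ring.
Qed.

Lemma cexp0 : cexp 0 = 1 :> R[i].
Proof. by rewrite (_ : 0 = 0 +i* 0) // cexpE expR0 cos0 sin0 mulr1 mulr0. Qed.

Lemma cexp_neq0 u : cexp u != 0.
Proof.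
by apply/eqP => u0; have := cexpD u (- u); rewrite subrr cexp0 u0 mul0r => /eqP; rewrite oner_eq0.
Qed.

Lemma cexpV u : (cexp u)^-1 = cexp (- u).
Proof.
by apply: (mulfI (cexp_neq0 u)); rewrite mulfV ?cexp_neq0// -cexpD subrr cexp0.
Qed.

Lemma cexpX u n : cexp u ^+ n = cexp (u *+ n).
Proof. by elim: n => [|n IH]; rewrite ?expr0 ?mulr0n ?cexp0// exprS IH -cexpD mulrS. Qed.

Lemma ln_cabs x y : 0 < x -> ln (cabs (x +i* y)) = ln (x ^+ 2 + y ^+ 2) / 2.
Proof.
move=> x0; rewrite /cabs/= -powR12_sqrt; last by rewrite addr_ge0// sqr_ge0.
by rewrite ln_powR mulrC.
Qed.

Lemma tan_gt0 x : 0 < x < pi / 2 -> 0 < tan x.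
Proof.
move=> /andP[x0 x1]; rewrite /tan divr_gt0 ?sin_gt0_pihalf ?x0//.
by rewrite cos_gt0_pihalf// x1 (lt_trans _ x0)// oppr_lt0 divr_gt0// pi_gt0.
Qed.

Lemma atan_ge0 x : 0 <= x -> 0 <= atan x.
Proof.
move=> x0; rewrite leNgt; apply/negP => a0.
have := @tan_gt0 (- atan x); rewrite oppr_gt0 a0 ltrNl atan_gtNpi2 => /(_ isT).
by rewrite tanN atanK oppr_gt0 ltNge x0.
Qed.

Lemma atan_le0 x : x <= 0 -> atan x <= 0.
Proof.
move=> x0; rewrite leNgt; apply/negP => a0.
have := @tan_gt0 (atan x); rewrite a0 atan_ltpi2 => /(_ isT).
by rewrite atanK ltNge x0.
Qed.

Lemma carg_atan x y : 0 < x -> carg (x +i* y) = atan (y / x).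
Proof.
move=> x0; rewrite /carg/=.
have -> : x / cabs (x +i* y) = cos (atan (y / x)).
  rewrite cos_atan /cabs/=; have -> : 1 + (y / x) ^+ 2 = (x ^+ 2 + y ^+ 2) / x ^+ 2.
    by field; rewrite gt_eqF.
  rewrite sqrtrM ?addr_ge0 ?sqr_ge0// sqrtrV ?sqr_ge0// sqrtr_sqr gtr0_norm//.
  by rewrite invf_div.
case: ifPn => y0.
  rewrite cosK// in_itv/= atan_ge0 ?divr_ge0 ?(ltW x0)//=.
  by rewrite (le_trans (ltW (atan_ltpi2 _)))// ler_pdivrMr// ler_peMr ?pi_ge0// (ler_nat _ 1).
rewrite cosKN ?opprK//; rewrite -ltNge in y0.
rewrite atan_le0 ?andbT; last by rewrite ler_pdivrMr// mul0r ltW.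
rewrite (le_trans _ (ltW (atan_gtNpi2 _)))// lerN2.
by rewrite ler_pdivrMr// ler_peMr ?pi_ge0// (ler_nat _ 1).
Qed.

(** On the circle [1 - z] has a positive real part, so the principal logarithm
is additive in the quotient by [h] and is given by [lnmod] and [argm]. *)
Lemma cpow_quotient h r t al : 0 < h -> `|r| < 1 ->
  cpow ((1 - r%:C * cexp (t *i)) / h%:C) al =
  cexp ((al * (lnmod r t - ln h)) +i* (al * argm r t)).
Proof.
move=> h0 r1; rewrite /cpow /cLog; congr cexp.
have -> : (1 - r%:C * cexp (t *i)) / h%:C =
   ((1 - r * cos t) / h) +i* (- (r * sin t) / h).
  rewrite cexpE expR0 !mul1r.
  have -> : (h%:C)^-1 = (h^-1)%:C by rewrite fmorphV.
  by apply/eqP; rewrite eq_complex; simpc.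
have x0 : 0 < (1 - r * cos t) / h by rewrite divr_gt0// re_gt0.
rewrite ln_cabs// carg_atan//; simpc.
have d0 := sqmod_gt0 t r1.
congr (_ +i* _); congr (_ * _).
   rewrite sqrrN !expr_div_n -mulrDl -/(sqmod r t).
  rewrite ln_div ?posrE ?exprn_gt0// lnXn// /lnmod mulr2n; by field.
by rewrite /argm; congr (atan _); field; rewrite !gt_eqF// re_gt0.
Qed.

Lemma complexMn x y n : (x +i* y) *+ n = (n%:R * x) +i* (n%:R * y).
Proof.
elim: n => [|n IH]; first by rewrite mulr0n !mul0r.
by rewrite mulrS IH; simpc; rewrite -[n.+1]add1n natrD !mulrDl !mul1r.
Qed.

Lemma Re_sum (I : Type) (s : seq I) (F : I -> R[i]) :
  complex.Re (\sum_(k <- s) F k) = \sum_(k <- s) complex.Re (F k).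
Proof.
elim: s => [|k s IH]; first by rewrite !big_nil.
by rewrite !big_cons -IH; case: (F k) (\sum_(_ <- _) _) => [a b] [c d].
Qed.

(** Expand the power by the binomial theorem; each term is a complex exponential,
a power of [1 - z] times a power of [z]. The imaginary part is what remains of
the real part after the division by [2 pi i]. *)
Lemma wright_integrand h r t al n J : 0 < h -> 0 < r -> r < 1 ->
  let z := r%:C * cexp (t *i) in
  complex.Im ((z ^+ n.+1)^-1 * ((1 - h%:C * cpow ((1 - z) / h%:C) al) ^+ J
      / cpow ((1 - z) / h%:C) (1 - al)) * ('i * z)) =
  \sum_(i < J.+1) 'C(J, i)%:R * (-1) ^+ i * (h `^ (1 - al)) ^+ i.+1 *
    (r ^- n * oscc (al * i%:R + al - 1) n%:R r t).
Proof.
move=> h0 r0 r1 z.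
have r1' : `|r| < 1 by rewrite gtr0_norm.
rewrite !cpow_quotient//.
have zE : z = cexp (ln r +i* t).
  by rewrite /z !cexpE expR0 !mul1r; simpc; rewrite lnK ?posrE.
have hE : h%:C = cexp (ln h +i* 0) by rewrite cexpE cos0 sin0 mulr1 mulr0 lnK ?posrE.
have z0 : z != 0 by rewrite zE cexp_neq0.
have -> (Q : R[i]) : (z ^+ n.+1)^-1 * Q * ('i * z) = (Q * z ^- n) * 'i.
  by rewrite exprS; field; rewrite z0 expf_neq0.
rewrite ImiRe {1}hE -cexpD exprDn !mulr_suml Re_sum.
apply: eq_bigr => i _.
rewrite expr1n mul1r (exprNn (cexp _)) zE !cexpX !cexpV -[_ *+ 'C(_, _)]mulr_natl.
set V := (_ + _) *+ i; set W := - (_ +i* ((1 - al) * _)); set Z := - (_ *+ n).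
have -> : 'C(J, i)%:R * ((-1) ^+ i * cexp V) * cexp W * cexp Z =
  ('C(J, i)%:R * (-1) ^+ i)%:C * cexp (V + W + Z).
  by rewrite !cexpD !rmorphM rmorphXn rmorphN1 rmorph_nat; ring.
have -> : V + W + Z =
  ((i.+1%:R * (1 - al)) * ln h - n%:R * ln r +
     (al * i%:R + al - 1) * lnmod r t) +i*
   ((al * i%:R + al - 1) * argm r t - n%:R * t).
  have -> : V = (i%:R * (ln h + al * (lnmod r t - ln h))) +i* (i%:R * (al * argm r t)).
    by rewrite /V -complexMn; congr (_ *+ i); simpc.
  rewrite /W /Z complexMn; simpc.
  by apply/eqP; rewrite eq_complex/= -natr1; apply/andP; split; apply/eqP; ring.
have e1 : expR (i.+1%:R * (1 - al) * ln h) = (h `^ (1 - al)) ^+ i.+1.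
  by rewrite -powR_mulrn ?powR_ge0// -powRrM /powR gt_eqF// mulrC [in RHS]mulrC; congr expR; ring.
have e2 : expR (- (n%:R * ln r)) = r ^- n.
  by rewrite expRN mulrC expRM_natr lnK.
rewrite cexpE; simpc => /=.
by rewrite /oscc 2!expRD e1 e2; ring.
Qed.

Lemma wright_mixcoef h r al n J : 0 < h -> 0 < r -> r < 1 ->
  complex.Re (wright h al (1 - al) r n J) =
  h `^ (1 - al) * mixcoef (sibuya al n) (h `^ (1 - al)) n J.
Proof.
move=> h0 r0 r1; have r1' : `|r| < 1 by rewrite gtr0_norm.
rewrite /wright /circle_integral.
set A := \int[_]_(t in _) complex.Re _; set B := \int[_]_(t in _) complex.Im _.
have p0 : pi != 0 :> R by rewrite gt_eqF// pi_gt0.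
have -> : complex.Re (((2 * pi) *i)^-1 * (A +i* B)) = B / (2 * pi).
  have -> : ((2 * (pi : R)) *i)^-1 = 0 +i* (- (2 * (pi : R))^-1).
    have q0 : (2 * pi) *i != 0 :> R[i].
      by rewrite eq_complex/= negb_and mulf_neq0 ?orbT// pnatr_eq0.
    have E : (2 * pi) *i * (0 +i* (- (2 * pi)^-1)) = 1 :> R[i].
      by simpc; rewrite mulfV ?mulf_neq0 ?pnatr_eq0.
    by rewrite -[RHS](mulKf q0) E mulr1.
  by simpc => /=; rewrite mulrC.
pose a := h `^ (1 - al).
have -> : B = \sum_(i < J.+1) 'C(J, i)%:R * (-1) ^+ i * a ^+ i.+1 *
    (r ^- n * circ (al * i%:R + al - 1) n%:R r).
  rewrite /B; under eq_Rintegral do rewrite wright_integrand//.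
  have I1 i := integrable_oscc (al * i%:R + al - 1) n%:R r1'.
  rewrite Rintegral_sum//.
    apply: eq_bigr => i _.
    under eq_Rintegral do rewrite mulrA.
    by rewrite RintegralZl// mulrA.
  move=> i; rewrite (_ : _ \o _ =
     fun t => (('C(J, i)%:R * (-1) ^+ i * a ^+ i.+1 * r ^- n)%:E *
     (oscc (al * i%:R + al - 1) n%:R r t)%:E)%E).
    by apply: integrableZl => //; exact: I1.
  by apply/funext => t; rewrite /a -EFinM; congr EFin; rewrite [LHS]mulrA.
rewrite -/a /mixcoef -(wright_coef al a n J) mulr_suml mulr_sumr.
apply: eq_bigr => i _; rewrite circE//.
have -> : - (al * i%:R + al - 1) = 1 - al - al * i%:R by ring.
rewrite exprS (exprNn a).
have rn : r ^+ n != 0 by rewrite expf_neq0// gt_eqF.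
by move: (@pi R) p0 => P p0; field; rewrite rn p0.
Qed.

End ComplexPowers.

(** * The fundamental solution off the origin *)
Section FundamentalSolution.
Context {R : realType}.
Implicit Types (q h t e rho b r al : R) (k n m M J : nat).

Lemma Gamma_nat k : Gamma k.+1%:R = k`!%:R :> R.
Proof.
rewrite /Gamma.
under eq_Rintegral => t.
  rewrite inE/= in_itv/= andbT => t0.
  rewrite -[k.+1]addn1 natrD addrK powR_mulrn ?(ltW t0)//.
  have -> : t ^+ k * expR (- t) = k`!%:R * gdens 1 k t.
    have k0 : k`!%:R != 0 :> R by rewrite pnatr_eq0 -lt0n fact_gt0.
    by rewrite /gdens expr1n mul1r divr1; field.
  over.
by rewrite RintegralZl ?Rintegral_gdens ?mulr1//; exact: integrable_gdens.
Qed.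

Lemma enorm_ge0 N (x : 'rV[R]_N) : 0 <= enorm x.
Proof. exact: sqrtr_ge0. Qed.

Lemma enorm_sqr N (x : 'rV[R]_N) : enorm x ^+ 2 = \sum_(i < N) x 0 i ^+ 2.
Proof. by rewrite sqr_sqrtr// sumr_ge0// => i _; rewrite sqr_ge0. Qed.

Lemma dgauss_dheat N h k (x : 'rV[R]_N) : 0 < h -> 0 < enorm x ->
  dgauss k.+1 h x = dheat (N%:R / 2) h k (enorm x ^+ 2).
Proof.
move=> h0 x0; rewrite /dgauss Gamma_nat /dheat.
have fh : 0 < h ^+ k.+1 * k`!%:R by rewrite mulr_gt0 ?exprn_gt0// ltr0n fact_gt0.
under eq_Rintegral => t _.
  have -> : expR (- (t / h)) * t ^+ k.+1.-1 * gauss t x =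
    (h ^+ k.+1 * k`!%:R) * (gdens h k t * heat (N%:R / 2) (enorm x ^+ 2) t).
    by rewrite /gdens [RHS]mulrA [X in X * heat _ _ _]mulrC divfK// gt_eqF.
  over.
rewrite RintegralZl//; first by rewrite mulrA mulVf ?mul1r// gt_eqF.
apply: integrable_gdens_heat => //.
exact: exprn_gt0.
Qed.

(** The finite mixture of discrete heat kernels of scale [h `^ al] to which the
series of the fundamental solution sums when it converges. *)
Definition solprof q h al m rho : R :=
  \sum_(k < m.+1) sibuya al m k * dheat q (h `^ al) k rho.

Lemma limn_dvg (u : R ^nat) : ~ cvgn u -> limn u = point.
Proof.
move=> ncv; apply: getPN => l ul; apply: ncv.
by apply/cvg_ex; exists l.
Qed.

(** The hypotheses of [mix_dheat_cvg] and [mix_dheat_dvg] are complementary for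
[q = N / 2], because [2 m < N] means [2 m + 1 <= N]. *)
Lemma mix_dichotomy b N m : b < 1 ->
  (`|b| < 1 \/ b = -1 /\ m%:R + 2^-1 <= N%:R / 2 :> R) \/
  (b <= -1 /\ (b < -1 \/ N%:R / 2 <= m%:R :> R)).
Proof.
move=> b1; have [?|b2] := ltP `|b| 1; first by left; left.
have {}b2 : b <= -1.
  have [?|?] := lerP 0 b; first by rewrite ger0_norm// in b2; lra.
  by rewrite ltr0_norm// in b2; lra.
have [bE|bE] : b = -1 \/ b < -1.
- by move: b2; rewrite le_eqVlt => /predU1P[]; [left|right].
- have [Nm|mN] := leqP N (m * 2).
    by right; split=> //; right; rewrite ler_pdivrMr// -natrM ler_nat.
  left; right; split=> //.
  rewrite ler_pdivlMr// mulrDl mulVf ?pnatr_eq0//.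
  by rewrite -natrM natr1 ler_nat.
- by right; split=> //; left.
Qed.

(** Which case holds depends on [h], [al], [m] and [N] but not on [x], and this
matters: the gradient at [x] involves the values at all nearby points. *)
Lemma fundsol_cases N al h r m : 0 < al -> 0 < h -> 0 < r -> r < 1 ->
  (forall x : 'rV[R]_N, 0 < enorm x ->
    fundsol al h r m.+1 x = solprof (N%:R / 2) h al m (enorm x ^+ 2)) \/
  (forall x : 'rV[R]_N, 0 < enorm x -> fundsol al h r m.+1 x = point).
Proof.
move=> al0 h0 r0 r1.
pose a := h `^ (1 - al).
have a0 : 0 < a by rewrite powR_gt0.
have q0 : 0 <= N%:R / 2 :> R by rewrite divr_ge0.
pose u (x : 'rV[R]_N) M := \sum_(J < M) mixcoef (sibuya al m) a m J *
  dheat (N%:R / 2) h J (enorm x ^+ 2).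
have uE (x : 'rV[R]_N) : 0 < enorm x ->
   (fun M => \sum_(1 <= j < M.+1)
    complex.Re (wright h al (1 - al) r m.+1.-1 j.-1) * dgauss j h x) =
   (fun M => a * u x M).
  move=> x0; apply/funext => M; rewrite big_add1 succnK /u mulr_sumr big_mkord.
  apply: eq_bigr => J _.
  by rewrite wright_mixcoef// dgauss_dheat// mulrA.
have cm : sibuya al m m != 0 by rewrite gt_eqF// sibuya_diag_gt0.
have b1 : 1 - a < 1 by rewrite ltrBlDr ltrDl.
case: (mix_dichotomy N m b1) => [cv|dv].
- left => x x0.
  have H := @mix_dheat_cvg _ (sibuya al m) a _ h _ m q0 (exprn_gt0 2 x0) h0 a0 cv.
  rewrite /fundsol; apply/cvg_lim => //.
  rewrite -cvg_shiftS/= uE//.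
  have -> : solprof (N%:R / 2) h al m (enorm x ^+ 2) = a * (a^-1 *
    \sum_(k < m.+1) sibuya al m k * dheat (N%:R / 2) (h / a) k (enorm x ^+ 2)).
    rewrite mulrA mulfV ?gt_eqF// mul1r /solprof.
    have -> // : h / a = h `^ al.
    rewrite -{1}[h]powRr1 ?(ltW h0)// /a -powRB; last by rewrite (gt_eqF h0) implybT.
    by congr (_ `^ _); ring.
  exact: cvgMr.
- right => x x0.
  have [{}b1 H] := dv.
  have nc := mix_dheat_dvg q0 (exprn_gt0 2 x0) h0 a0 cm b1 H.
  apply: limn_dvg => cv; apply: nc.
  move: cv => /cvg_ex[l]; rewrite -cvg_shiftS/= uE// => cl.
  apply/cvg_ex; exists (a^-1 * l).
  have H2 : a^-1 * (a * u x M) @[M --> \oo] --> a^-1 * l by exact: cvgMr.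
  have E : (fun M => a^-1 * (a * u x M)) = u x.
    by apply/funext => M; rewrite mulrA mulVf ?gt_eqF// mul1r.
  by rewrite E in H2.
Qed.

End FundamentalSolution.

(** * The gradient of the fundamental solution *)
Section Gradient.
Context {R : realType}.
Local Notation mu := (@lebesgue_measure R).
Local Notation D := `]0%R, +oo[%classic.
Implicit Types (q h t e rho b r al : R) (k n m M J : nat).

Lemma heatS q rho t : 0 < t -> heat q rho t / (4 * t) = pi * heat (q + 1) rho t.
Proof.
move=> t0; have p0 := pi_gt0 R.
have t4 : 0 < 4 * pi * t by rewrite !mulr_gt0.
rewrite /heat opprD powRD ?(gt_eqF t4) ?implybT// powR_inv1 ?(ltW t4)//.
by move: (_ `^ _) (expR _) => A B; move: (@pi R) p0 => P p0; field; rewrite !gt_eqF.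
Qed.

Lemma is_derive_heat q rho t : 0 < t ->
  is_derive rho 1 (fun rho => heat q rho t) (- pi * heat (q + 1) rho t).
Proof.
move=> t0; rewrite mulNr -heatS// /heat.
have d : is_derive rho 1 (fun y : R => - (y / (4 * t))) (- (4 * t)^-1).
  by apply: is_derive_eq; rewrite /GRing.scale/=; ring.
have := @is_derive1_comp _ expR (fun y => - (y / (4 * t))) rho _ _ (is_derive_expR _) d.
move=> dc.
rewrite (_ : (fun y => _) = (4 * pi * t) `^ (- q) \*: (expR \o (fun y => - (y / (4 * t)))))//.
by apply: is_derive_eq; rewrite /GRing.scale/=; ring.
Qed.

Lemma heat_nonincr q rho1 rho2 t : 0 < t -> rho1 <= rho2 ->
  heat q rho2 t <= heat q rho1 t.
Proof.
move=> t0 r12; rewrite /heat ler_wpM2l ?powR_ge0// ler_expR lerN2 ler_wpM2r//.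
by rewrite invr_ge0 mulr_ge0// ltW.
Qed.

(** Differentiation under the integral sign on [rho / 2 < x < 2 rho]; the
derivative of the integrand is largest at the left end. *)
Lemma is_derive_dheat q h k rho : 0 <= q -> 0 < h -> 0 < rho ->
  is_derive rho 1 (dheat q h k) (- pi * dheat (q + 1) h k rho).
Proof.
move=> q0 h0 rho0.
pose f x t := gdens h k t * heat q x t.
pose u := rho / 2; pose v := rho * 2.
have u0 : 0 < u by rewrite divr_gt0.
have Is : `]u, v[%classic rho.
  by rewrite /= in_itv/= /u /v; apply/andP; split; lra.
have Ix x : `]u, v[%classic x -> u < x by rewrite /= in_itv/= => /andP[].
have q10 : 0 <= q + 1 by rewrite addr_ge0.
have [C C0 hC] := @heat_bound R (q + 1) 0 u (ler_wpDr (lexx 0) q10) u0.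
have intf x : `]u, v[%classic x -> mu.-integrable D (EFin \o f x).
  by move=> /Ix ux; apply: integrable_gdens_heat => //; exact: lt_trans ux.
have df (x t : R) : 0 < t -> is_derive x 1 (f ^~ t : R -> R)
    (gdens h k t * (- pi * heat (q + 1) x t)).
  move=> t0; have := is_derive_heat q x t0 => dh.
  exact: (is_deriveZ (gdens h k t) dh).
have Dt t : D t -> 0 < t by rewrite /= in_itv/= andbT.
have derf (x t : R) : `]u, v[%classic x -> D t -> derivable (f ^~ t) x 1.
  by move=> _ /Dt t0; case: (df x t t0).
pose G t := `|gdens h k t| * (pi * C).
have G0 t : 0 <= G t by rewrite !mulr_ge0// pi_ge0.
have intG : mu.-integrable D (EFin \o G).
  rewrite (_ : EFin \o G = fun t => ((pi * C)%:E * `|(EFin \o gdens h k) t|)%E).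
    apply: integrableZl => //; apply: (@integrable_abse _ _ _ mu D (EFin \o gdens h k)).
    exact: integrable_gdens.
  by apply/funext => t; rewrite /G /= -EFinM mulrC.
have dfE x t : D t -> partial1of2 f x t = gdens h k t * (- pi * heat (q + 1) x t).
  by move=> /Dt t0; rewrite partial1of2E; have := df x t t0 => ?; rewrite derive_val.
have Gub x t : `]u, v[%classic x -> D t -> `|partial1of2 f x t| <= G t.
  move=> /Ix ux Dtt; rewrite dfE// normrM ler_wpM2l// mulNr normrN normrM.
  rewrite (ger0_norm (pi_ge0 R)) ler_wpM2l ?pi_ge0// (ger0_norm (heat_ge0 _ _ _)).
  apply: le_trans (heat_nonincr _ (Dt _ Dtt) (ltW ux)) _.
  by have := hC t (Dt _ Dtt); rewrite oppr0 powRr0 mul1r.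
have d1 : derivable (fun x => \int[mu]_(t in D) f x t) rho 1.
  exact (@derivable_under_integral R _ _ mu f D (measurable_itv _)
    rho u v Is intf derf _ G0 intG Gub).
have d2 := @differentiation_under_integral R _ _ mu f D (measurable_itv _)
  rho u v Is intf derf _ G0 intG Gub.
apply: DeriveDef; first exact d1.
rewrite -derive1E; transitivity (\int[mu]_(t in D) partial1of2 f rho t); first exact: d2.
under eq_Rintegral => t Dtt.
  rewrite dfE; last by move: Dtt; rewrite inE.
  rewrite mulrCA.
  over.
by rewrite RintegralZl//; exact: integrable_gdens_heat.
Qed.

Lemma is_derive_solprof q h al m rho : 0 <= q -> 0 < h -> 0 < rho ->
  is_derive rho 1 (solprof q h al m) (- pi * solprof (q + 1) h al m rho).
Proof.
move=> q0 h0 rho0.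
have d k := @is_derive_dheat q (h `^ al) k rho q0 (powR_gt0 _ h0) rho0.
rewrite (_ : solprof q h al m = \sum_(k < m.+1) (sibuya al m k \*: dheat q (h `^ al) k)).
  apply: (is_derive_eq (is_derive_sum (fun k : 'I_m.+1 => is_deriveZ _ (d k)))).
  by rewrite /solprof mulr_sumr; apply: eq_bigr => k _; rewrite /GRing.scale/=; ring.
by apply/funext => x; rewrite fct_sumE.
Qed.

Lemma solprof_ge0 q h al m rho : 0 <= al <= 1 -> 0 < h -> 0 <= solprof q h al m rho.
Proof.
move=> al01 h0; apply: sumr_ge0 => k _; rewrite mulr_ge0 ?sibuya_ge0//.
apply: Rintegral_ge0 => t /=; rewrite in_itv/= andbT => t0.
by rewrite mulr_ge0 ?heat_ge0// gdens_ge0 ?(ltW t0)// powR_gt0.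
Qed.

Lemma enorm_line N (x : 'rV[R]_N) (i : 'I_N) s :
  enorm (s *: unitv i + x) ^+ 2 = enorm x ^+ 2 + 2 * s * x 0 i + s ^+ 2.
Proof.
rewrite !enorm_sqr (bigD1 i)//= [in RHS](bigD1 i)//= !mxE !eqxx/= mulr1.
rewrite (eq_bigr (fun j => x 0 j ^+ 2)); first by ring.
by move=> j ji; rewrite !mxE (negbTE ji)/= mulr0 add0r.
Qed.

(** The chain rule along the coordinate line through [x]. The radial formula holds
off the origin only, hence near [x] on that line. *)
Lemma radial_partial N (f : 'rV[R]_N -> R) (H : R -> R) (x : 'rV[R]_N) (i : 'I_N) dH :
  (forall y, 0 < enorm y -> f y = H (enorm y ^+ 2)) -> 0 < enorm x ->
  is_derive (enorm x ^+ 2) 1 H dH ->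
  is_derive x (unitv i) f (2 * x 0 i * dH).
Proof.
move=> fH x0 dHx.
pose g (s : R) := f (s *: unitv i + x).
suff dg : is_derive (0 : R) (1 : R) g (2 * x 0 i * dH).
  have [dg1 dg2] := dg.
  apply: DeriveDef; first by apply/derivable1P.
  rewrite -dg2 /derive; set g1 := fun h => h^-1 *: _; set g2 := fun h => h^-1 *: _.
  suff -> : g1 = g2 by [].
  by apply/funext => s; rewrite /g1 /g2 /g /= addr0 scale0r add0r [_%:A]mulr1.
pose p (s : R) := enorm x ^+ 2 + 2 * s * x 0 i + s ^+ 2.
have p0 : p 0 = enorm x ^+ 2 by rewrite /p; ring.
have dp : is_derive (0 : R) (1 : R) p (2 * x 0 i).
  by rewrite /p; apply: is_derive_eq; rewrite /GRing.scale/=; ring.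
have dHp : is_derive (p 0) 1 H dH by rewrite p0.
have dc := @is_derive1_comp _ H p 0 _ _ dHp dp.
rewrite mulrC; apply: near_eq_is_derive dc.
have cp : {for 0, continuous p}.
  by apply: differentiable_continuous; apply/derivable1_diffP; case: dp.
have p00 : 0 < p 0 by rewrite p0 exprn_gt0.
near=> s.
have e0 : 0 < p s by near: s; exact: (cvgr_gt (p 0) cp).
rewrite /p -enorm_line in e0; rewrite /= /g fH /p ?enorm_line//.
rewrite lt_neqAle enorm_ge0 andbT eq_sym.
by move: e0; apply: contraTneq => ->; rewrite expr0n ltxx.
Unshelve. all: end_near. Qed.

Lemma enormZ N c (x : 'rV[R]_N) : enorm (c *: x) = `|c| * enorm x.
Proof.
rewrite /enorm -sqrtr_sqr -sqrtrM ?sqr_ge0// mulr_sumr; congr Num.sqrt.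
by apply: eq_bigr => i _; rewrite mxE exprMn.
Qed.

Lemma grad_fundsol_bound N al h r m (x : 'rV[R]_N) :
  0 < al -> al < 1 -> 0 < h -> 0 < r -> r < 1 -> 0 < enorm x ->
  (forall i, derivable (fundsol al h r m.+1) x (unitv i)) /\
  enorm (grad (fundsol al h r m.+1) x) <=
    2 * enorm x * (pi * solprof (N%:R / 2 + 1) h al m (enorm x ^+ 2)).
Proof.
move=> al0 al1 h0 r0 r1 x0.
have q0 : 0 <= N%:R / 2 :> R by rewrite divr_ge0.
have x20 : 0 < enorm x ^+ 2 by rewrite exprn_gt0.
have al01 : 0 <= al <= 1 by rewrite !ltW.
have S0 : 0 <= pi * solprof (N%:R / 2 + 1) h al m (enorm x ^+ 2).
  by rewrite mulr_ge0 ?pi_ge0// solprof_ge0.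
have main dH : (forall i, is_derive x (unitv i) (fundsol al h r m.+1) (2 * x 0 i * dH)) ->
    `|dH| <= pi * solprof (N%:R / 2 + 1) h al m (enorm x ^+ 2) ->
  (forall i, derivable (fundsol al h r m.+1) x (unitv i)) /\
  enorm (grad (fundsol al h r m.+1) x) <=
    2 * enorm x * (pi * solprof (N%:R / 2 + 1) h al m (enorm x ^+ 2)).
  move=> d dHle; split; first by move=> i; case: (d i).
  have -> : grad (fundsol al h r m.+1) x = (2 * dH) *: x.
    by apply/rowP => i; rewrite !mxE; have := d i => ?; rewrite derive_val; ring.
  rewrite enormZ normrM ger0_norm// -!mulrA ler_wpM2l// mulrC ler_wpM2l//.
  exact: enorm_ge0.
have [H|H] := fundsol_cases N m al0 h0 r0 r1.
  apply: main => [i|].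
    by apply: (radial_partial _ H) => //; exact: is_derive_solprof.
  by rewrite mulNr normrN ger0_norm.
apply: (main 0); last by rewrite normr0.
move=> i; apply: (radial_partial (H := fun=> point)) => //.
Qed.

End Gradient.

(** * Negative moments of Gamma densities *)
Section FractionalMoments.
Context {R : realType}.
Local Notation mu := (@lebesgue_measure R).
Local Notation D := `]0%R, +oo[%classic.
Implicit Types (h t ga : R) (k n : nat).

Lemma integral_powRN_pos (a h ga : R) : 0 < a -> a < h -> 0 <= ga -> ga < 1 ->
  (\int[mu]_(t in `[a, h]) (t `^ (- ga))%:E <= (h `^ (1 - ga) / (1 - ga))%:E)%E.
Proof.
move=> a0 ah ga0 ga1; have g1 : 0 < 1 - ga by lra.
pose F t : R := t `^ (1 - ga) / (1 - ga).
have dF t : 0 < t -> is_derive t 1 F (t `^ (- ga)).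
  move=> t0; have := is_derive1_powR (1 - ga) t0 => d.
  rewrite (_ : F = (1 - ga)^-1 \*: (fun t => t `^ (1 - ga))); last first.
    by apply/funext => y; rewrite /F mulrC.
  apply: is_derive_eq; rewrite /GRing.scale/= mulrA mulVf ?gt_eqF// mul1r.
  by congr (_ `^ _); ring.
have cF t : 0 < t -> {for t, continuous F}.
  by move=> t0; apply: differentiable_continuous; apply/derivable1_diffP; case: (dF t t0).
have cf t : 0 < t -> {for t, continuous (fun t : R => t `^ (- ga))}.
  move=> t0; apply: differentiable_continuous; apply/derivable1_diffP.
  by case: (is_derive1_powR (- ga) t0).
have h0 : 0 < h by exact: lt_trans ah.
rewrite (@continuous_FTC2 R _ F a h ah).
- by rewrite -EFinB lee_fin /F gerBl divr_ge0 ?powR_ge0// ltW.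
- apply/continuous_within_itvP => //; split.
  + by move=> x; rewrite in_itv/= => /andP[ax _]; apply: cf; exact: lt_trans ax.
  + by apply: cvg_at_right_filter; exact: cf.
  + by apply: cvg_at_left_filter; exact: cf.
- split.
  + by move=> x; rewrite in_itv/= => /andP[ax _]; case: (dF x (lt_trans a0 ax)).
  + by apply: cvg_at_right_filter; exact: cF.
  + by apply: cvg_at_left_filter; exact: cF.
- move=> x; rewrite in_itv/= => /andP[ax _].
  by rewrite derive1E; have := dF x (lt_trans a0 ax) => ?; rewrite derive_val.
Qed.

(** Monotone limit of the integrals over [[h / (n + 2), h]]. *)
Lemma integral_powRN (h ga : R) : 0 < h -> 0 <= ga -> ga < 1 ->
  (\int[mu]_(t in `]0%R, h]) (t `^ (- ga))%:E <= (h `^ (1 - ga) / (1 - ga))%:E)%E.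
Proof.
move=> h0 ga0 ga1.
pose F n : set R := `[h / n.+2%:R, h]%classic.
have n20 n : 0 < n.+2%:R :> R by rewrite ltr0n.
have -> : `]0%R, h]%classic = \bigcup_n F n.
  apply/seteqP; split=> [t|t [n _]]; rewrite /F/= !in_itv/=.
    move=> /andP[t0 th]; exists (Num.trunc (h / t)) => //=; rewrite /F/= in_itv/= th andbT.
    rewrite ler_pdivrMr// -ler_pdivrMl// mulrC ltW// (lt_trans (truncnS_gt _))//.
    by rewrite ltr_nat.
  by move=> /andP[ht ->]; rewrite andbT (lt_le_trans _ ht)// divr_gt0.
have mf A : measurable_fun A (fun t : R => (t `^ (- ga))%:E).
  by apply/measurable_EFinP; apply: measurable_fun_powR; exact: measurable_id.
have ndF : {homo F : n m / (n <= m)%N >-> (n <= m)%O}.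
  move=> n m nm; apply/subsetPset => t; rewrite /F/= !in_itv/= => /andP[ht ->].
  rewrite andbT (le_trans _ ht)// ler_wpM2l ?(ltW h0)// lef_pV2 ?posrE//.
  by rewrite ler_nat !ltnS.
have cv : (\int[mu]_(t in F n) (t `^ (- ga))%:E @[n --> \oo] -->
    \int[mu]_(t in \bigcup_n F n) (t `^ (- ga))%:E)%E.
  apply: ge0_nondecreasing_set_cvg_integral => //.
  - by move=> i; exact: measurable_itv.
  - by move=> i; exact: mf.
  - by move=> i t Ft; rewrite lee_fin powR_ge0.
apply: (cvge_to_le cv).
apply: nearW => n; apply: integral_powRN_pos => //; first by rewrite divr_gt0.
by rewrite ltr_pdivrMr// ltr_pMr// (ltr_nat _ 1).
Qed.

(** The exact moment is [Gamma (1 - ga) h^(- ga) negbin (1 - ga) k]. For [k >= 1]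
the bound follows from Bernoulli's inequality
[(k h / t)^ga <= 1 + ga (k h / t - 1)], since [k h / t] has mean one under
[gdens h k], and from [negbin_ge]. For [k = 0], where [1 / t] has infinite mean,
split the integral at [t = h]. *)
Lemma frac_moment ga : 0 <= ga -> ga < 1 ->
  exists2 C, 0 <= C & forall h k, 0 < h ->
  (\int[mu]_(t in D) (gdens h k t * t `^ (- ga))%:E <=
     (C * (h `^ (- ga) * negbin (1 - ga) k))%:E)%E.
Proof.
move=> ga0 ga1; have g1 : 0 < 1 - ga by lra.
exists (1 + (1 - ga)^-1); first by rewrite addr_ge0// invr_ge0 ltW.
move=> h k h0.
have mt A : measurable_fun A (fun t : R => t `^ (- ga)).
  by apply: measurable_fun_powR; exact: measurable_id.
have mg A : measurable_fun A (fun t => (gdens h k t * t `^ (- ga))%:E).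
  by apply/measurable_EFinP; apply: measurable_funM => //; exact: measurable_gdens.
have hp x : 0 <= h `^ x by exact: powR_ge0.
case: k mg => [|k] mg.
- rewrite negbin0 mulr1.
  rewrite (@itv_bndbnd_setU _ _ _ (BRight h)) ?bnd_simp ?(ltW h0)//.
  have d0 t : gdens h 0 t = expR (- (t / h)) / h.
    by rewrite /gdens expr0 mulr1 expr1 fact0 mulr1.
  have g00 t : 0 <= gdens h 0 t * t `^ (- ga).
    by rewrite d0 mulr_ge0 ?powR_ge0// divr_ge0 ?expR_ge0 ?(ltW h0).
  have low : (\int[mu]_(t in `]0%R, h]) (gdens h 0 t * t `^ (- ga))%:E <=
      (h `^ (- ga) / (1 - ga))%:E)%E.
    apply: (@le_trans _ _ (\int[mu]_(t in `]0%R, h]) (h^-1 * t `^ (- ga))%:E)%E).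
      apply: ge0_le_integral => //.
      - by move=> t _; rewrite lee_fin.
      - exact: mg.
      - by apply/measurable_EFinP; apply: measurable_funM => //; exact: mt.
      move=> t /=; rewrite in_itv/= => /andP[t0 th].
      rewrite lee_fin ler_wpM2r ?powR_ge0// d0 ler_piMl ?invr_ge0 ?(ltW h0)//.
      by rewrite -expR0 ler_expR oppr_le0 divr_ge0// ltW.
    under eq_integral do rewrite EFinM.
    rewrite ge0_integralZl_EFin//; last 3 first.
    - by move=> t _; rewrite lee_fin powR_ge0.
    - by apply/measurable_EFinP; exact: mt.
    - by rewrite invr_ge0 ltW.
    apply: (@le_trans _ _ ((h^-1)%:E * (h `^ (1 - ga) / (1 - ga))%:E)%E).
      by rewrite lee_wpmul2l ?lee_fin ?invr_ge0 ?(ltW h0)// integral_powRN.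
    rewrite -EFinM lee_fin mulrA ler_wpM2r ?invr_ge0 ?(ltW g1)//.
    by rewrite powRD ?(gt_eqF h0) ?implybT// powRr1 ?(ltW h0)// mulrA mulVf ?mul1r// gt_eqF.
  have high : (\int[mu]_(t in `]h, +oo[) (gdens h 0 t * t `^ (- ga))%:E <=
      (h `^ (- ga))%:E)%E.
    apply: (@le_trans _ _ (\int[mu]_(t in `]h, +oo[) (h `^ (- ga) * gdens h 0 t)%:E)%E).
      apply: ge0_le_integral => //.
      - by move=> t _; rewrite lee_fin.
      - exact: mg.
      - by apply/measurable_EFinP; apply: measurable_funM => //; exact: measurable_gdens.
      move=> t /=; rewrite in_itv/= andbT => th.
      have t0 : 0 < t by exact: lt_trans th.
      rewrite lee_fin mulrC ler_wpM2r ?gdens_ge0 ?(ltW t0)//.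
      by rewrite !powRN lef_pV2 ?posrE ?powR_gt0// ge0_ler_powR ?nnegrE ?(ltW t0) ?(ltW h0)// ltW.
    under eq_integral do rewrite EFinM.
    rewrite ge0_integralZl_EFin//; last 2 first.
    - move=> t /=; rewrite in_itv/= andbT => th.
      by rewrite lee_fin gdens_ge0// ltW// (lt_trans h0).
    - by apply/measurable_EFinP; exact: measurable_gdens.
    rewrite -[leRHS]mule1; apply: lee_wpmul2l; first by rewrite lee_fin.
    rewrite -(integral_gdens 0 h0).
    apply: ge0_subset_integral => //.
    - by apply/measurable_EFinP; exact: measurable_gdens.
    - by move=> t /=; rewrite in_itv/= andbT => t0; rewrite lee_fin gdens_ge0// ltW.
    - by move=> t /=; rewrite !in_itv/= !andbT; exact: lt_trans.
  rewrite ge0_integral_setU//=; last first.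
  - apply/disj_setPS => t [] /=; rewrite !in_itv/= andbT => /andP[_ th] ht.
    by move: (lt_le_trans ht th); rewrite ltxx.
  - by move=> t _; rewrite lee_fin.
  - exact: mg.
  apply: (le_trans (leeD low high)).
  by rewrite -EFinD lee_fin mulrDl mul1r addrC mulrC.
- have k0 : 0 < k.+1%:R :> R by rewrite ltr0n.
  have kh0 : 0 < k.+1%:R * h by rewrite mulr_gt0.
  apply: (@le_trans _ _ ((k.+1%:R * h) `^ (- ga))%:E).
    apply: (@le_trans _ _ (\int[mu]_(t in D) ((k.+1%:R * h) `^ (- ga) *
        (ga * gdens h k t + (1 - ga) * gdens h k.+1 t))%:E)%E).
      apply: ge0_le_integral => //.
      - move=> t /=; rewrite in_itv/= andbT => t0.
        by rewrite lee_fin mulr_ge0 ?powR_ge0// gdens_ge0// ltW.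
      - exact: mg.
      - by apply/measurable_EFinP; rewrite /gdens; mfun.
      move=> t /=; rewrite in_itv/= andbT => t0; rewrite lee_fin.
      have b := @bernoulli_powR R (k.+1%:R * h / t) ga (ltW (divr_gt0 kh0 t0)).
      rewrite ga0 (ltW ga1) in b; have {}b := b isT.
      rewrite powRM ?invr_ge0 ?(ltW t0) ?(ltW kh0)// powRV ?(ltW t0)// -powRN in b.
      have g0 := gdens_ge0 k.+1 h0 (ltW t0).
      have -> : gdens h k t = k.+1%:R * h / t * gdens h k.+1 t.
        by rewrite mulrAC -gdensS// mulrAC mulfV ?mul1r// gt_eqF.
      rewrite [(k.+1%:R * h) `^ _]powRN ler_pdivlMl ?powR_gt0//.
      rewrite mulrCA; apply: le_trans (ler_wpM2l g0 b) _.
      by rewrite le_eqVlt; apply/orP; left; apply/eqP; ring.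
    have -> : (\int[mu]_(t in D) ((k.+1%:R * h) `^ (- ga) *
        (ga * gdens h k t + (1 - ga) * gdens h k.+1 t))%:E =
      ((k.+1%:R * h) `^ (- ga))%:E * (ga%:E * \int[mu]_(t in D) (gdens h k t)%:E +
        (1 - ga)%:E * \int[mu]_(t in D) (gdens h k.+1 t)%:E))%E.
      under eq_integral do rewrite EFinM.
      rewrite ge0_integralZl_EFin ?powR_ge0//; last 2 first.
      - move=> t /=; rewrite in_itv/= andbT => t0.
        by rewrite lee_fin addr_ge0// mulr_ge0 ?gdens_ge0 ?(ltW t0) ?(ltW g1).
      - by apply/measurable_EFinP; rewrite /gdens; mfun.
      congr (_ * _)%E; under eq_integral do rewrite EFinD.
      rewrite ge0_integralD//; last 4 first.
      - move=> t /=; rewrite in_itv/= andbT => t0.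
        by rewrite lee_fin mulr_ge0 ?gdens_ge0 ?(ltW t0).
      - by apply/measurable_EFinP; rewrite /gdens; mfun.
      - move=> t /=; rewrite in_itv/= andbT => t0.
        by rewrite lee_fin mulr_ge0 ?gdens_ge0 ?(ltW t0) ?(ltW g1).
      - by apply/measurable_EFinP; rewrite /gdens; mfun.
      have Z (x : R) j : 0 <= x -> (\int[mu]_(t in D) (x * gdens h j t)%:E =
          x%:E * \int[mu]_(t in D) (gdens h j t)%:E)%E.
        move=> x0; under eq_integral do rewrite EFinM.
        rewrite ge0_integralZl_EFin//.
        + move=> t /=; rewrite in_itv/= andbT => t0.
          by rewrite lee_fin gdens_ge0 ?(ltW t0).
        + by apply/measurable_EFinP; exact: measurable_gdens.
      by rewrite !Z// ltW.
    by rewrite !integral_gdens// !mule1 -EFinD -EFinM lee_fin addrC subrK mulr1.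
  rewrite lee_fin powRM ?(ltW k0) ?(ltW h0)// mulrC mulrCA ler_wpM2l//.
  have nb := negbin_ge ga0 (ltW ga1) (ltn0Sn k).
  have P : k.+1%:R `^ (- ga) <= (1 - ga)^-1 * negbin (1 - ga) k.+1 by rewrite ler_pdivlMl.
  rewrite mulrDl mul1r (le_trans P)// lerDr (le_trans _ nb)//.
  by rewrite mulr_ge0 ?(ltW g1).
Qed.

End FractionalMoments.

(** * Integration over R^N *)
Section LebesgueTuples.
Context {R : realType}.
Local Notation mu := (@lebesgue_measure R).
Local Notation RT := (measurableTypeR R).
Implicit Types (c : R) (n N : nat).

Lemma integral_expR_sqr c : 0 < c ->
  (\int[mu]_x (expR (- (c * x ^+ 2)))%:E = (Num.sqrt (pi / c))%:E)%E.
Proof.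
move=> c0.
pose s := Num.sqrt ((2 * c)^-1).
have s0 : s != 0 by rewrite gt_eqF// sqrtr_gt0 invr_gt0 mulr_gt0.
have s2 : s ^+ 2 = (2 * c)^-1 by rewrite sqr_sqrtr// invr_ge0 mulr_ge0// ltW.
have E x : normal_pdf 0 s x = (Num.sqrt (pi / c))^-1 * expR (- (c * x ^+ 2)).
  rewrite normal_pdfE// /normal_peak /normal_fun s2 subr0.
  have -> : (2 * c)^-1 * pi *+ 2 = pi / c.
    by rewrite -mulr_natr; move: (@pi R) => P; field; rewrite gt_eqF.
  by congr (_ * expR _); rewrite -mulr_natr; field; rewrite gt_eqF.
have S0 : 0 < Num.sqrt (pi / c) by rewrite sqrtr_gt0 divr_gt0// pi_gt0.
have I1 : ((Num.sqrt (pi / c))^-1%:E * \int[mu]_x (expR (- (c * x ^+ 2)))%:E = 1)%E.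
  rewrite -[RHS](@integral_normal_pdf R 0 s) -ge0_integralZl_EFin//.
  - by apply: eq_integral => x _; rewrite E EFinM.
  - by apply/measurable_EFinP; mfun.
by rewrite -[LHS]mul1e -(@mulfV _ (Num.sqrt (pi / c))) ?gt_eqF// EFinM -muleA I1 mule1.
Qed.

Lemma enorm_vec_sqr N (t : N.-tuple RT) :
  enorm (vec t) ^+ 2 = \sum_(i < N) tnth t i ^+ 2.
Proof. by rewrite enorm_sqr; apply: eq_bigr => i _; rewrite mxE. Qed.

Lemma measurable_enorm_vec_sqr N :
  measurable_fun [set: N.-tuple RT] (fun t => enorm (vec t) ^+ 2).
Proof.
rewrite (_ : (fun t => _) = fun t => \sum_(i < N) tnth t i ^+ 2).
  apply: measurable_sum => i; apply: measurable_funX; exact: measurable_tnth.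
by apply/funext => t; rewrite enorm_vec_sqr.
Qed.

Lemma integral_gauss_tuple N c : 0 < c ->
  (\int[lebesgueN N]_t (expR (- (c * enorm (vec t) ^+ 2)))%:E =
    (Num.sqrt (pi / c) ^+ N)%:E)%E.
Proof.
move=> c0.
have mf n : measurable_fun [set: n.-tuple RT]
    (fun t => (expR (- (c * enorm (vec t) ^+ 2)))%:E).
  apply/measurable_EFinP; apply: measurable_fun_expR; apply: measurable_funN.
  by apply: measurable_funM => //; exact: measurable_enorm_vec_sqr.
elim: N => [|n IH].
   rewrite /= integral_dirac//; last exact: (mf 0).
  rewrite diracE mem_set// mul1e.
  by rewrite enorm_vec_sqr big_ord0 mulr0 oppr0 expR0 expr0.
rewrite /= /lebesgue_tcons ge0_integral_pushforward//;
  [|exact: measurable_tcons|exact: (mf n.+1)].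
rewrite preimage_setT.
have step (u : RT * n.-tuple RT) : expR (- (c * enorm (vec (tcons u)) ^+ 2)) =
    expR (- (c * u.1 ^+ 2)) * expR (- (c * enorm (vec u.2) ^+ 2)).
  rewrite -expRD !enorm_vec_sqr big_ord_recl tnth0/=.
  congr expR; rewrite mulrDr opprD; congr (_ + - (_ * _)).
  by apply: eq_bigr => i _; rewrite tnthS.
have mg : measurable_fun [set: RT * n.-tuple RT]
    (fun u => (expR (- (c * u.1 ^+ 2)) * expR (- (c * enorm (vec u.2) ^+ 2)))%:E).
  apply/measurable_EFinP; apply: measurable_funM; first by mfun.
  apply: measurable_fun_expR; apply: measurable_funN; apply: measurable_funM => //.
  by apply: (measurableT_comp (@measurable_enorm_vec_sqr n)); exact: measurable_snd.
under eq_integral do rewrite /= step.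
rewrite (fubini_tonelli1 _ mg)/=; last by move=> u; rewrite lee_fin mulr_ge0 ?expR_ge0.
transitivity (\int[mu]_x ((Num.sqrt (pi / c) ^+ n)%:E * (expR (- (c * x ^+ 2)))%:E))%E.
  apply: eq_integral => x _; rewrite /fubini_F/=; under eq_integral do rewrite EFinM.
  rewrite ge0_integralZl_EFin ?expR_ge0//; last exact: (mf n).
  by rewrite IH muleC.
rewrite ge0_integralZl_EFin ?exprn_ge0 ?sqrtr_ge0//; last by apply/measurable_EFinP; mfun.
by rewrite integral_expR_sqr// -EFinM -exprSr.
Qed.

Lemma lebesgueN_vec0 N : (0 < N)%N ->
  (lebesgueN N).-negligible [set t : N.-tuple RT | enorm (vec t) = 0].
Proof.
move=> N0.
pose A : N.-tuple (set RT) := [tuple [set 0] | i < N].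
have AE : [set t : N.-tuple RT | enorm (vec t) = 0] =
    [set t | forall i, tnth A i (tnth t i)].
  apply/seteqP; split=> t /= h.
    move=> i; rewrite tnth_mktuple /=.
    have : \sum_(i < N) tnth t i ^+ 2 = 0 by rewrite -enorm_vec_sqr h expr0n.
    move/eqP; rewrite psumr_eq0; last by move=> j _; rewrite sqr_ge0.
    by move=> /allP/(_ i); rewrite mem_index_enum => /(_ isT); rewrite sqrf_eq0 => /eqP.
  apply/eqP; rewrite -sqrf_eq0 enorm_vec_sqr big1// => i _.
  by have := h i; rewrite tnth_mktuple /= => ->; rewrite expr0n.
have mA i : measurable (tnth A i) by rewrite tnth_mktuple.
exists [set t | forall i, tnth A i (tnth t i)]; split.
- rewrite (_ : [set _ | _] = \bigcap_(i in [set: 'I_N])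
      ((fun t : N.-tuple RT => tnth t i) @^-1` tnth A i)); last first.
    by apply/seteqP; split=> t /= h i; [move=> _|]; exact: h.
  apply: fin_bigcap_measurable => // i _.
  by rewrite -[X in measurable X]setTI; exact: measurable_tnth.
- rewrite lebesgueN_box// (bigD1 (Ordinal N0))//= tnth_mktuple lebesgue_measure_set1.
  by rewrite mul0e.
- by rewrite AE.
Qed.

End LebesgueTuples.

Section IntegralMonotone.
Context {R : realType} d (T : measurableType d) (mu : {measure set T -> \bar R}).

(** The integral of a nonnegative function is the supremum of the integrals of
the simple functions below it, so monotonicity holds for arbitrary functions;
the gradient of the fundamental solution is compared in this way with a
measurable majorant. *)
Lemma ge0_le_integral_any (f g : T -> \bar R) :
  (forall x, 0 <= f x)%E -> (forall x, f x <= g x)%E ->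
  (\int[mu]_x f x <= \int[mu]_x g x)%E.
Proof.
move=> f0 fg; rewrite !ge0_integralTE//; last by move=> x; exact: le_trans (fg x).
apply: le_ereal_sup => _ /= [h hf <-]; exists h => //= x.
exact: le_trans (fg x).
Qed.

End IntegralMonotone.

(** * A weighted Jensen inequality *)
Section WeightedJensen.
Context {R : realType} d (T : measurableType d) (mu : {measure set T -> \bar R}).

(** The tangent line of [y^p] at [y = c] lies below its graph; take [y = f / ka]
and multiply by [ka]. *)
Lemma jensen_pointwise (ka f c p : R) : 0 < ka -> 0 <= f -> 0 < c -> 1 <= p ->
  p * c `^ (p - 1) * f <= ka `^ (1 - p) * f `^ p + (p - 1) * c `^ p * ka.
Proof.
move=> ka0 f0 c0 p1.
have u0 : 0 <= f / (ka * c) by rewrite divr_ge0// mulr_ge0// ltW.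
have b := bernoulli_powR_ge1 u0 p1.
have X0 : 0 < ka * c `^ p by rewrite mulr_gt0 ?powR_gt0.
have := ler_wpM2l (ltW X0) b.
have E1 : ka * c `^ p * (f / (ka * c)) `^ p = ka `^ (1 - p) * f `^ p.
  rewrite powRM ?invr_ge0 ?mulr_ge0 ?(ltW ka0) ?(ltW c0)//.
  rewrite powRV ?mulr_ge0 ?(ltW ka0) ?(ltW c0)// powRM ?(ltW ka0) ?(ltW c0)//.
  rewrite powRD ?(gt_eqF ka0) ?implybT// powRr1 ?(ltW ka0)// powRN.
  by field; rewrite !gt_eqF ?powR_gt0.
rewrite {}E1.
have -> : c `^ p = c * c `^ (p - 1).
  rewrite -{2}[c]powRr1 ?(ltW c0)// -powRD ?(gt_eqF c0) ?implybT//.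
  by congr (_ `^ _); ring.
have -> : ka * (c * c `^ (p - 1)) * (1 + p * (f / (ka * c) - 1)) =
   p * c `^ (p - 1) * f - (p - 1) * (c * c `^ (p - 1)) * ka.
  by field; rewrite !gt_eqF.
lra.
Qed.

(** Jensen's inequality for the mean of [f / ka] under the measure of density
[w ka], whose mass is at most [A]. When [f] depends on a further variable and
[ka] is proportional to its L^p norm in that variable, integrating this
inequality is Minkowski's inequality for integrals. *)
Lemma weighted_jensen (D : set T) (w ka f : T -> R) (p A : R) :
  measurable D -> 1 <= p -> 0 < A ->
  (forall x, D x -> 0 <= w x) -> (forall x, D x -> 0 < ka x) ->
  (forall x, D x -> 0 <= f x) ->
  mu.-integrable D (EFin \o (fun x => w x * f x)) ->
  mu.-integrable D (EFin \o (fun x => w x * ka x)) ->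
  mu.-integrable D (EFin \o (fun x => w x * (ka x `^ (1 - p) * f x `^ p))) ->
  \int[mu]_(x in D) (w x * ka x) <= A ->
  (\int[mu]_(x in D) (w x * f x)) `^ p <=
    A `^ (p - 1) * \int[mu]_(x in D) (w x * (ka x `^ (1 - p) * f x `^ p)).
Proof.
move=> mD p1 A0 w0 ka0 f0 I1 I2 I3 leA.
set F := \int[mu]_(x in D) (w x * f x).
set B := \int[mu]_(x in D) (w x * (_ * _)).
have B0 : 0 <= B.
  by apply: Rintegral_ge0 => x Dx; rewrite !mulr_ge0 ?powR_ge0 ?w0.
have : 0 <= F by apply: Rintegral_ge0 => x Dx; rewrite mulr_ge0 ?w0 ?f0.
rewrite le_eqVlt => /predU1P[<-|F0].
  by rewrite powR0 ?mulr_ge0 ?powR_ge0//; lra.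
(* the tangent point is the mean of [f / ka] if [w ka] has mass [A] *)
pose c := F / A; have c0 : 0 < c by rewrite divr_gt0.
have IZ (g : T -> R) (x : R) : mu.-integrable D (EFin \o g) ->
    mu.-integrable D (EFin \o (fun t => x * g t)).
  move=> Ig; rewrite (_ : _ \o _ = fun t => (x%:E * (g t)%:E)%E); first exact: integrableZl.
  by apply/funext => t; rewrite -EFinM.
have H : p * c `^ (p - 1) * F <= B + (p - 1) * c `^ p * A.
  apply: (@le_trans _ _ (B + (p - 1) * c `^ p * \int[mu]_(x in D) (w x * ka x))); last first.
    by rewrite lerD2l ler_wpM2l// mulr_ge0 ?powR_ge0//; lra.
  rewrite -!RintegralZl// -RintegralD//; last exact: IZ.
  have I4 : mu.-integrable D (EFin \o (fun x =>
      w x * (ka x `^ (1 - p) * f x `^ p) + (p - 1) * c `^ p * (w x * ka x))).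
    have := integrableD mD I3 (IZ _ ((p - 1) * c `^ p) I2).
    by apply: eq_integrable => // x _; rewrite /= EFinD.
  apply: le_Rintegral => //; first exact: IZ.
  move=> x Dx.
  have j := jensen_pointwise (ka0 x Dx) (f0 x Dx) c0 p1.
  have {}j := ler_wpM2l (w0 x Dx) j.
  rewrite mulrCA (le_trans j)// mulrDr lerD2l le_eqVlt.
  by apply/orP; left; apply/eqP; ring.
have cp : c `^ p = c * c `^ (p - 1).
  rewrite -{2}[c]powRr1 ?(ltW c0)// -powRD ?(gt_eqF c0) ?implybT//.
  by congr (_ `^ _); ring.
have FE : F = c * A by rewrite /c divfK// gt_eqF.
have cB : c `^ p * A <= B.
  by move: H; rewrite FE cp; move: (c `^ (p - 1)) => X; lra.
rewrite FE powRM ?(ltW c0) ?(ltW A0)//.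
have -> : A `^ p = A `^ (p - 1) * A.
  rewrite -{3}[A]powRr1 ?(ltW A0)// -powRD ?(gt_eqF A0) ?implybT//.
  by congr (_ `^ _); ring.
by rewrite mulrCA ler_wpM2l ?powR_ge0.
Qed.

End WeightedJensen.

(** * The subordination density *)
Section SubordinationDensity.
Context {R : realType}.
Local Notation mu := (@lebesgue_measure R).
Local Notation D := (`]0%R, +oo[%classic : set (measurableTypeR R)).
Implicit Types (al q h t ga rho : R) (k n m : nat).

(** The density against which the Gaussian kernel is averaged, for the scale
[h `^ al] of the fundamental solution; see [solprof_subdens]. *)
Definition subdens al h m t : R := \sum_(k < m.+1) sibuya al m k * gdens h k t.

Lemma measurable_subdens A al h m : measurable_fun A (subdens al h m).
Proof.
apply: measurable_sum => k; apply: measurable_funM => //.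
exact: measurable_gdens.
Qed.

Lemma subdens_ge0 al h m t : 0 <= al <= 1 -> 0 < h -> 0 < t -> 0 <= subdens al h m t.
Proof.
move=> al01 h0 t0; apply: sumr_ge0 => k _.
by rewrite mulr_ge0 ?sibuya_ge0 ?gdens_ge0 ?(ltW t0).
Qed.

Lemma integrable_subdens al h m : 0 < h -> mu.-integrable D (EFin \o subdens al h m).
Proof.
move=> h0; rewrite (_ : _ \o _ = (fun t => \sum_(k < m.+1)
   (sibuya al m k)%:E * (gdens h k t)%:E)%E).
  apply: integrable_sum => // k _; apply: integrableZl => //.
  exact: integrable_gdens.
by apply/funext => t; rewrite /= -sumEFin; apply: eq_bigr => k _; rewrite EFinM.
Qed.

Lemma solprof_subdens q h al m rho : 0 <= q -> 0 < h -> 0 < rho ->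
  solprof q h al m rho =
  \int[mu]_(t in D) (subdens al (h `^ al) m t * heat q rho t).
Proof.
move=> q0 h0 rho0; have H0 : 0 < h `^ al by exact: powR_gt0.
under eq_Rintegral do rewrite mulr_suml.
rewrite Rintegral_sum//.
  apply: eq_bigr => k _; under eq_Rintegral do rewrite -mulrA.
  by rewrite RintegralZl//; exact: integrable_gdens_heat.
move=> k; rewrite (_ : _ \o _ = fun t =>
   ((sibuya al m k)%:E * (gdens (h `^ al) k t * heat q rho t)%:E)%E).
  by apply: integrableZl => //; exact: integrable_gdens_heat.
by apply/funext => t; rewrite -EFinM [in RHS]mulrA.
Qed.

(** By [frac_moment] the sum over [k] reduces to [sibuya_negbin] at
[th = 1 - ga], whose value is [negbin (1 - al ga) m], of size
[(m + 1)^(- al ga)] by [negbin_le]. *)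
Lemma subdens_moment al ga : 0 < al -> al <= 1 -> 0 <= ga -> ga < 1 ->
  exists2 C, 0 < C & forall h m, 0 < h ->
  (\int[mu]_(t in D) (subdens al (h `^ al) m t * t `^ (- ga))%:E <=
     (C * (m.+1%:R * h) `^ (- (al * ga)))%:E)%E.
Proof.
move=> al0 al1 ga0 ga1.
have [C C0 hC] := frac_moment ga0 ga1.
exists (C + 1) => [|h m h0]; first by rewrite ltr_wpDl.
have H0 : 0 < h `^ al by exact: powR_gt0.
have s0 k : 0 <= sibuya al m k by rewrite sibuya_ge0// (ltW al0).
have mk k : measurable_fun D (fun t => (gdens (h `^ al) k t * t `^ (- ga))%:E).
  by apply/measurable_EFinP; apply: measurable_funM; [exact: measurable_gdens|mfun].
have g0 k t : D t -> (0 <= (gdens (h `^ al) k t * t `^ (- ga))%:E)%E.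
  rewrite /= in_itv/= andbT => t0.
  by rewrite lee_fin mulr_ge0 ?powR_ge0 ?gdens_ge0 ?(ltW t0).
have -> : (\int[mu]_(t in D) (subdens al (h `^ al) m t * t `^ (- ga))%:E =
   \sum_(k < m.+1) (sibuya al m k)%:E *
     \int[mu]_(t in D) (gdens (h `^ al) k t * t `^ (- ga))%:E)%E.
  under eq_bigr => k _.
    rewrite -ge0_integralZl_EFin//; last exact: g0.
    over.
  rewrite -ge0_integral_sum//; last 2 first.
  - by move=> k; apply: emeasurable_funM; [exact: measurable_cst|exact: mk].
  - by move=> k t Dt; rewrite mule_ge0 ?g0// lee_fin.
  apply: eq_integral => t _; rewrite /subdens mulr_suml -sumEFin.
  by apply: eq_bigr => k _; rewrite -EFinM -[in LHS]mulrA.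
apply: (@le_trans _ _ (\sum_(k < m.+1) (sibuya al m k)%:E *
    (C * ((h `^ al) `^ (- ga) * negbin (1 - ga) k))%:E)%E).
  by apply: lee_sum => k _; apply: lee_wpmul2l; [rewrite lee_fin|exact: hC].
under eq_bigr do rewrite -EFinM.
rewrite sumEFin lee_fin.
have -> : \sum_(k < m.+1) sibuya al m k * (C * ((h `^ al) `^ (- ga) * negbin (1 - ga) k)) =
    C * (h `^ al) `^ (- ga) * \sum_(k < m.+1) sibuya al m k * negbin (1 - ga) k.
  by rewrite mulr_sumr; apply: eq_bigr => k _; ring.
rewrite sibuya_negbin.
have -> : 1 - al + al * (1 - ga) = 1 - al * ga by ring.
have ag0 : 0 <= al * ga by rewrite mulr_ge0// ltW.
have ag1 : al * ga <= 1 by rewrite (le_trans _ al1)// ler_piMr// ltW.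
rewrite powRM ?(ltW h0)// -powRrM mulrN -!mulrA.
apply: ler_pM => //; last first.
- by rewrite mulrC ler_wpM2r ?powR_ge0// negbin_le.
- by rewrite lerDl.
- rewrite mulr_ge0 ?powR_ge0//; apply: prodr_ge0 => i _.
  by rewrite divr_ge0// addr_ge0// subr_ge0.
Qed.

End SubordinationDensity.

(** * The L^p norm of the gradient *)
Section GradientKernel.
Context {R : realType}.
Implicit Types (q s t : R).

Definition gradC q : R := 4 * pi * (4 * pi) `^ (- (q + 1)).

Lemma gradC_gt0 q : 0 < gradC q.
Proof. by rewrite !mulr_gt0 ?powR_gt0 ?pi_gt0// mulr_gt0 ?pi_gt0. Qed.

(** Half of the Gaussian exponent absorbs the factor [s]: with [y = s / t^(1/2)]
one has [y expR (- y^2 / 8) <= 2]. *)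
Lemma heat_grad_bound q s t : 0 <= s -> 0 < t ->
  2 * s * (pi * heat (q + 1) (s ^+ 2) t) <=
    gradC q * (t `^ (- (q + 2^-1)) * expR (- (s ^+ 2 / (8 * t)))).
Proof.
move=> s0 t0; have p0 := pi_gt0 R.
set E := expR (- (s ^+ 2 / (8 * t))).
set y := s * t `^ (- 2^-1).
have y0 : 0 <= y by rewrite mulr_ge0 ?powR_ge0.
have y2 : y ^+ 2 = s ^+ 2 / t.
  rewrite /y exprMn; congr (_ * _); rewrite expr2 -powRD ?(gt_eqF t0) ?implybT//.
  by rewrite -opprD (_ : 2^-1 + 2^-1 = 1) ?powR_inv1 ?(ltW t0)//; lra.
have yE : y * E <= 2.
  rewrite /E expRN ler_pdivrMr ?expR_gt0//.
  have := expR_ge1Dx (s ^+ 2 / (8 * t)).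
  have -> : s ^+ 2 / (8 * t) = y ^+ 2 / 8 by rewrite y2; field; rewrite gt_eqF.
  have : 0 <= (y - 2) ^+ 2 by exact: sqr_ge0.
  move: (expR _) => e; nra.
rewrite /heat /gradC.
have -> : expR (- (s ^+ 2 / (4 * t))) = E * E.
  by rewrite /E -expRD; congr expR; field; rewrite gt_eqF.
rewrite powRM ?(ltW t0)//; last by rewrite mulr_ge0// ltW.
have -> : t `^ (- (q + 1)) = t `^ (- (q + 2^-1)) * t `^ (- 2^-1).
  rewrite -powRD ?(gt_eqF t0) ?implybT//; congr (_ `^ _); lra.
have -> : 2 * s * (pi * ((4 * pi) `^ (- (q + 1)) * (t `^ (- (q + 2^-1)) *
    t `^ (- 2^-1)) * (E * E))) =
   (2 * pi * (4 * pi) `^ (- (q + 1)) * t `^ (- (q + 2^-1)) * E) * (y * E).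
  by rewrite /y; ring.
have -> : 4 * pi * (4 * pi) `^ (- (q + 1)) * (t `^ (- (q + 2^-1)) * E) =
  (2 * pi * (4 * pi) `^ (- (q + 1)) * t `^ (- (q + 2^-1)) * E) * 2 by ring.
by rewrite ler_wpM2l// !mulr_ge0 ?powR_ge0 ?expR_ge0// ltW.
Qed.

End GradientKernel.

Section GradientNorm.
Context {R : realType}.
Local Notation mu := (@lebesgue_measure R).
Local Notation RT := (measurableTypeR R).
Local Notation D := (`]0%R, +oo[%classic : set RT).
Implicit Types (al q h t ga rho p A c d : R) (k n m N : nat).

Definition expker c d t : R := t `^ (- c) * expR (- (d / t)).

Lemma expker_ge0 c d t : 0 <= expker c d t.
Proof. by rewrite mulr_ge0 ?powR_ge0 ?expR_ge0. Qed.

Lemma integrable_subdens_expker al h m c d : 0 < h -> 0 <= c -> 0 < d ->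
  mu.-integrable D (EFin \o (fun t => subdens al h m t * expker c d t)).
Proof.
move=> h0 c0 d0; have [C C0 hC] := powRN_expR_bounded c0 d0.
apply: (@integrableM_real _ _ _ _ _ _ _ C) => //.
- exact: integrable_subdens.
- by rewrite /expker; mfun.
- move=> t /=; rewrite in_itv/= andbT => t0.
  by rewrite ger0_norm ?expker_ge0// hC.
Qed.

Lemma expker_powR c d t p : 0 <= t -> expker c d t `^ p = expker (c * p) (d * p) t.
Proof.
move=> t0; rewrite /expker powRM ?powR_ge0 ?expR_ge0// -powRrM -expRM.
by rewrite mulNr; congr (_ * expR _); ring.
Qed.

Lemma integral_indic_in (g : RT -> R) :
  (\int[mu]_(t in D) (g t)%:E = \int[mu]_t (\1_D t * g t)%:E)%E.
Proof.
rewrite integral_mkcond; apply: eq_integral => t _; rewrite patchE indicE.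
by case: (t \in D); rewrite ?mul1r ?mul0r.
Qed.

(** [weighted_jensen] with [w] the subordination density and [ka = t^(- ga)]. The
value of [ga] enters through
[t^(- ga (1 - p)) (t^(- (N + 1) / 2))^p = t^(- (N / 2 + ga))]. *)
Lemma enorm_grad_powR_bound N al h r m p ga A (x : 'rV[R]_N) :
  0 < al -> al < 1 -> 0 < h -> 0 < r -> r < 1 -> 1 <= p ->
  ga = N%:R / 2 * (1 - 1 / p) + 2^-1 -> 0 <= ga -> 0 < A ->
  (\int[mu]_(t in D) (subdens al (h `^ al) m t * t `^ (- ga))%:E <= A%:E)%E ->
  0 < enorm x ->
  ((enorm (grad (fundsol al h r m.+1) x) `^ p)%:E <=
   (A `^ (p - 1))%:E * \int[mu]_t (\1_D t * (subdens al (h `^ al) m t *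
     (gradC (N%:R / 2) `^ p *
       expker (N%:R / 2 + ga) (p / 8 * enorm x ^+ 2) t)))%:E)%E.
Proof.
move=> al0 al1 h0 r0 r1 p1 gaE ga0 A0 mom x0.
set q := N%:R / 2; have q0 : 0 <= q by rewrite divr_ge0.
have H0 : 0 < h `^ al by exact: powR_gt0.
have al01 : 0 <= al <= 1 by rewrite !ltW.
have p0 : 0 < p by lra.
have rho0 : 0 < enorm x ^+ 2 by rewrite exprn_gt0.
set rho := enorm x ^+ 2 in rho0 *.
pose w := subdens al (h `^ al) m.
pose f t := gradC q * expker (q + 2^-1) (rho / 8) t.
have D0 t : D t -> 0 < t by rewrite /= in_itv/= andbT.
have G0 := gradC_gt0 q.
have fG t : 0 < t -> (t `^ (- ga)) `^ (1 - p) * f t `^ p =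
    gradC q `^ p * expker (q + ga) (p / 8 * rho) t.
  move=> t0; rewrite /f powRM ?expker_ge0 ?(ltW G0)// expker_powR ?(ltW t0)//.
  rewrite mulrCA; congr (_ * _); rewrite -powRrM /expker mulrA.
  rewrite -powRD ?(gt_eqF t0) ?implybT//; congr (_ `^ _ * expR (- (_ / t))); last by ring.
  by rewrite gaE /q; field; rewrite gt_eqF.
have IZ (g : R -> R) (y : R) : mu.-integrable D (EFin \o g) ->
    mu.-integrable D (EFin \o (fun t => y * g t)).
  move=> Ig; rewrite (_ : _ \o _ = fun t => (y%:E * (g t)%:E)%E); first exact: integrableZl.
  by apply/funext => t; rewrite -EFinM.
have If : mu.-integrable D (EFin \o (fun t => w t * f t)).
  rewrite (_ : (fun t => w t * f t) = fun t => gradC q * (w t * expker (q + 2^-1) (rho / 8) t)).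
    apply: IZ; apply: integrable_subdens_expker => //; first by rewrite addr_ge0.
    by rewrite divr_gt0.
  by apply/funext => t; rewrite /f mulrCA.
have mka : measurable_fun D (fun t => w t * t `^ (- ga)).
  by apply: measurable_funM; [exact: measurable_subdens|mfun].
have Ika : mu.-integrable D (EFin \o (fun t => w t * t `^ (- ga))).
  apply/integrableP; split; first exact/measurable_EFinP.
  under eq_integral => t Dt.
    rewrite /= ger0_norm; last first.
      by rewrite mulr_ge0 ?powR_ge0// subdens_ge0// D0//; move: Dt; rewrite inE.
    over.
  by apply: le_lt_trans mom _; rewrite ltry.
have IG : mu.-integrable D (EFin \o (fun t => w t * ((t `^ (- ga)) `^ (1 - p) * f t `^ p))).
  apply: (@eq_integrable _ _ _ mu D _ (EFin \o (fun t => gradC q `^ p *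
     (w t * expker (q + ga) (p / 8 * rho) t)))) => //.
    by move=> t; rewrite inE => /D0 t0; rewrite /= fG// mulrCA.
  apply: IZ; apply: integrable_subdens_expker => //; first by rewrite addr_ge0.
  by rewrite !mulr_gt0.
have leA : \int[mu]_(t in D) (w t * t `^ (- ga)) <= A.
  by rewrite -lee_fin /Rintegral fineK//; apply: integrable_fin_num.
have J := @weighted_jensen R _ _ mu D w (fun t => t `^ (- ga)) f p A
  (measurable_itv _) p1 A0 (fun t Dt => subdens_ge0 m al01 H0 (D0 t Dt))
  (fun t Dt => powR_gt0 _ (D0 t Dt))
  (fun t Dt => mulr_ge0 (ltW G0) (expker_ge0 _ _ t)) If Ika IG leA.
have [_ B] := grad_fundsol_bound m al0 al1 h0 r0 r1 x0.
have B2 : enorm (grad (fundsol al h r m.+1) x) <= \int[mu]_(t in D) (w t * f t).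
  apply: (le_trans B); rewrite -/q -/rho solprof_subdens//; last by rewrite addr_ge0.
  have Ih : mu.-integrable D (EFin \o (fun t => w t * heat (q + 1) rho t)).
    have q10 : 0 <= q + 1 + 0 by rewrite addr0 addr_ge0.
    have [C C0 hC] := heat_bound q10 rho0.
    apply: (@integrableM_real _ _ _ _ _ _ _ C) => //.
    - exact: integrable_subdens.
    - exact: measurable_heat.
    - move=> t /D0 t0; have := hC t t0.
      by rewrite oppr0 powRr0 mul1r ger0_norm ?heat_ge0.
  rewrite mulrA -RintegralZl//.
  apply: le_Rintegral => //; first exact: IZ.
  move=> t Dt; have t0 := D0 t Dt.
  rewrite mulrCA ler_wpM2l ?subdens_ge0//.
  have -> : 2 * enorm x * pi * heat (q + 1) rho t =
    2 * enorm x * (pi * heat (q + 1) rho t) by ring.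
  apply: (le_trans (heat_grad_bound q (ltW x0) t0)).
  by rewrite /f /expker -/rho (_ : rho / (8 * t) = rho / 8 / t)// invfM mulrA.
have F0 : 0 <= \int[mu]_(t in D) (w t * f t).
  by rewrite (le_trans _ B2)// enorm_ge0.
have B3 := ge0_ler_powR (ltW p0) (enorm_ge0 _) F0 B2.
have {}J := le_trans B3 J.
rewrite -integral_indic_in.
apply: (@le_trans _ _ (A `^ (p - 1) * \int[mu]_(t in D)
   (w t * ((t `^ (- ga)) `^ (1 - p) * f t `^ p)))%:E); first by rewrite lee_fin.
rewrite EFinM; apply: lee_wpmul2l; first by rewrite lee_fin powR_ge0.
rewrite /Rintegral fineK; last exact: integrable_fin_num.
rewrite le_eqVlt; apply/orP; left; apply/eqP; apply: eq_integral => t.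
by rewrite inE => /D0 t0; rewrite fG.
Qed.

Lemma measurable_grad_majorant N al h m c d K :
  measurable_fun [set: N.-tuple RT * RT] (fun u =>
    (\1_D u.2 * (subdens al h m u.2 * (K * expker c (d * enorm (vec u.1) ^+ 2) u.2)))%:E).
Proof.
apply/measurable_EFinP; apply: measurable_funM.
  by apply: (measurableT_comp (measurable_indic (measurable_itv _))); exact: measurable_snd.
apply: measurable_funM.
  by apply: (measurableT_comp (@measurable_subdens R setT al h m)); exact: measurable_snd.
have me : measurable_fun [set: N.-tuple RT * RT] (fun u => enorm (vec u.1) ^+ 2).
  by apply: (measurableT_comp (@measurable_enorm_vec_sqr R N)); exact: measurable_fst.
by rewrite /expker; mfun.
Qed.

(** By Tonelli's theorem the integral in [x] comes first; this Gaussian integral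
is a multiple of [t^(N / 2)] and leaves [t^(- ga)]. *)
Lemma integral_grad_majorant N al h m p ga A K : 0 < p -> 0 <= al <= 1 -> 0 < h -> 0 <= K ->
  (\int[mu]_(t in D) (subdens al h m t * t `^ (- ga))%:E <= A%:E)%E ->
  (\int[lebesgueN N]_x \int[mu]_t (\1_D t * (subdens al h m t * (K *
     expker (N%:R / 2 + ga) (p / 8 * enorm (vec x) ^+ 2) t)))%:E <=
   (K * (8 * pi / p) `^ (N%:R / 2) * A)%:E)%E.
Proof.
move=> p0 al01 h0 K0 mom; set q := N%:R / 2.
have D0 t : D t -> 0 < t by rewrite /= in_itv/= andbT.
pose C := K * (8 * pi / p) `^ q.
have C0 : 0 <= C by rewrite mulr_ge0 ?powR_ge0.
have mf := @measurable_grad_majorant N al h m (q + ga) (p / 8) K.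
rewrite (fubini_tonelli _ mf); last first.
  move=> [x t] /=; rewrite lee_fin indicE.
  have [tD|_] := boolP (t \in D); last by rewrite mul0r.
  rewrite mul1r; apply: mulr_ge0; last by rewrite mulr_ge0 ?expker_ge0.
  by apply: subdens_ge0 => //; apply: D0; rewrite inE in tD.
rewrite /=.
apply: (@le_trans _ _ (\int[mu]_t (\1_D t * (C * (subdens al h m t * t `^ (- ga))))%:E)%E).
  rewrite le_eqVlt; apply/orP; left; apply/eqP; apply: eq_integral => t _.
  rewrite indicE; have [tD|_] := boolP (t \in D); last first.
    by rewrite mul0r; under eq_integral do rewrite mul0r; rewrite integral0.
  have t0 : 0 < t by apply: D0; rewrite inE in tD.
  have c0 : 0 < p / 8 / t by rewrite !divr_gt0.
  transitivity (\int[lebesgueN N]_x ((subdens al h m t * K * t `^ (- (q + ga)))%:E *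
      (expR (- (p / 8 / t * enorm (vec x) ^+ 2)))%:E))%E.
    apply: eq_integral => x _; rewrite mul1r -EFinM /expker; congr EFin.
    have -> : p / 8 * enorm (vec x) ^+ 2 / t = p / 8 / t * enorm (vec x) ^+ 2 by ring.
    by move: (expR _) => X; ring.
  rewrite ge0_integralZl_EFin//; last 2 first.
  - apply/measurable_EFinP; apply: measurable_fun_expR; apply: measurable_funN.
    by apply: measurable_funM => //; exact: measurable_enorm_vec_sqr.
  - by rewrite mulr_ge0 ?powR_ge0// mulr_ge0// subdens_ge0.
  rewrite integral_gauss_tuple// -EFinM; congr EFin; rewrite mul1r.
  have -> : pi / (p / 8 / t) = 8 * pi / p * t.
    by move: (@pi R) => P; field; rewrite !gt_eqF.
  have X0 : 0 <= 8 * pi / p by rewrite divr_ge0 ?(ltW p0)// mulr_ge0// pi_ge0.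
  rewrite -powR12_sqrt; last by rewrite mulr_ge0// ltW.
  rewrite -powR_mulrn ?powR_ge0// -powRrM mulrC [2^-1 * _]mulrC -/q.
  rewrite powRM ?(ltW t0)// /C.
  have -> : t `^ (- ga) = t `^ q * t `^ (- (q + ga)).
    by rewrite -powRD ?(gt_eqF t0) ?implybT//; congr (_ `^ _); ring.
  ring.
rewrite -integral_indic_in; under eq_integral do rewrite EFinM.
rewrite ge0_integralZl_EFin//; last 2 first.
- by move=> t /D0 t0; rewrite lee_fin mulr_ge0 ?powR_ge0// subdens_ge0.
- by apply/measurable_EFinP; apply: measurable_funM; [exact: measurable_subdens|mfun].
by rewrite [leRHS]EFinM; apply: lee_wpmul2l; first by rewrite lee_fin.
Qed.

Lemma Lnorm_grad_fundsol_le N al h r p ga A m :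
  (0 < N)%N -> 0 < al -> al < 1 -> 0 < h -> 0 < r -> r < 1 -> 1 <= p ->
  ga = N%:R / 2 * (1 - 1 / p) + 2^-1 -> 0 <= ga -> 0 < A ->
  (\int[mu]_(t in D)
     (subdens al (h `^ al) m t * t `^ (- ga))%:E <= A%:E)%E ->
  (LpnormV p (grad (fundsol (N := N) al h r m.+1)) <=
    ((gradC (N%:R / 2) `^ p * (8 * pi / p) `^ (N%:R / 2)) `^ (p^-1) * A)%:E)%E.
Proof.
move=> N0 al0 al1 h0 r0 r1 p1 gaE ga0 A0 mom.
have p0 : 0 < p by lra.
have al01 : 0 <= al <= 1 by rewrite !ltW.
have H0 : 0 < h `^ al by exact: powR_gt0.
set K := gradC (N%:R / 2) `^ p; set S := (8 * pi / p) `^ (N%:R / 2).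
have K0 : 0 <= K by exact: powR_ge0.
have S0 : 0 <= S by exact: powR_ge0.
pose g (x : N.-tuple RT) : \bar R := (\int[mu]_t (\1_D t *
   (subdens al (h `^ al) m t * (K *
     expker (N%:R / 2 + ga) (p / 8 * enorm (vec x) ^+ 2) t)))%:E)%E.
have mG := @measurable_grad_majorant N al (h `^ al) m (N%:R / 2 + ga) (p / 8) K.
have G0 (u : N.-tuple RT * RT) :
    (0 <= (\1_D u.2 *
    (subdens al (h `^ al) m u.2 * (K *
     expker (N%:R / 2 + ga) (p / 8 * enorm (vec u.1) ^+ 2) u.2)))%:E :> \bar R)%E.
  case: u => [x t] /=; rewrite lee_fin indicE.
  have [tD|_] := boolP (t \in _); last by rewrite mul0r.
  rewrite mul1r; apply: mulr_ge0; last by rewrite mulr_ge0 ?expker_ge0.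
  by apply: subdens_ge0 => //; move: tD; rewrite inE/= in_itv/= andbT.
have mg : measurable_fun [set: N.-tuple RT] g.
  exact (measurable_fun_fubini_tonelli_F (m2 := mu) _ mG G0).
have g0 x : (0 <= g x)%E by apply: integral_ge0 => t _; exact: (G0 (x, t)).
pose g1 (x : N.-tuple RT) : \bar R := ((A `^ (p - 1))%:E * g x)%E.
(* the gradient is bounded off the origin only; the majorant is made infinite on
   this null set *)
pose g2 (x : N.-tuple RT) : \bar R :=
  if enorm (vec x) ^+ 2 == 0 then +oo%E else g1 x.
have mg1 : measurable_fun [set: N.-tuple RT] g1.
  by apply: emeasurable_funM => //; exact: measurable_cst.
have g10 x : (0 <= g1 x)%E by rewrite mule_ge0// lee_fin powR_ge0.
have mg2 : measurable_fun [set: N.-tuple RT] g2.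
  apply: measurable_fun_ifT => //.
  by apply: measurable_fun_eqr => //; exact: measurable_enorm_vec_sqr.
have g20 x : (0 <= g2 x)%E by rewrite /g2; case: ifP => // _; rewrite leey.
have e12 : (\int[lebesgueN N]_x g2 x = \int[lebesgueN N]_x g1 x)%E.
  apply: ge0_ae_eq_integral => //.
  apply: (negligibleS _ (lebesgueN_vec0 (R := R) N0)) => x /= /not_implyP[_].
  by rewrite /g2; case: ifPn => [|//]; rewrite sqrf_eq0 => /eqP.
have int1 : (\int[lebesgueN N]_x g1 x <= (K * S * A `^ p)%:E)%E.
  rewrite ge0_integralZl_EFin ?powR_ge0//.
  apply: (@le_trans _ _ ((A `^ (p - 1))%:E * (K * S * A)%:E)%E).
    apply: lee_wpmul2l; first by rewrite lee_fin powR_ge0.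
    exact: integral_grad_majorant.
  rewrite -EFinM lee_fin.
  have -> : A `^ p = A `^ (p - 1) * A.
    rewrite -{3}[A]powRr1 ?(ltW A0)// -powRD ?(gt_eqF A0) ?implybT//.
    by congr (_ `^ _); ring.
  by rewrite le_eqVlt; apply/orP; left; apply/eqP; ring.
rewrite /LpnormV unlock.
pose f (x : N.-tuple RT) : \bar R :=
  (`|(enorm (grad (fundsol (N := N) al h r m.+1) (vec x)))%:E| `^ p)%E.
have f0 x : (0 <= f x)%E by exact: poweR_ge0.
have fg x : (f x <= g2 x)%E.
  rewrite /g2; case: ifPn => [_|x0]; first exact: leey.
  have ex0 : 0 < enorm (vec x).
    by rewrite lt_neqAle enorm_ge0 andbT eq_sym -sqrf_eq0.
  rewrite /f abse_EFin poweR_EFin ger0_norm ?enorm_ge0//.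
  exact: enorm_grad_powR_bound.
have fle : (\int[lebesgueN N]_x f x <= (K * S * A `^ p)%:E)%E.
  by apply: le_trans int1; rewrite -e12; exact: ge0_le_integral_any.
have fi0 : (0 <= \int[lebesgueN N]_x f x)%E by exact: integral_ge0.
apply: (@le_trans _ _ ((K * S * A `^ p)%:E `^ p^-1)%E).
  apply: gt0_ler_poweR => //; rewrite ?invr_ge0 ?(ltW p0)//.
  - by rewrite in_itv/= fi0 leey.
  - by rewrite in_itv/= lee_fin leey !mulr_ge0 ?powR_ge0.
rewrite poweR_EFin lee_fin powRM ?mulr_ge0 ?powR_ge0//.
by rewrite -[(A `^ p) `^ _]powRrM mulfV ?gt_eqF// powRr1 // ltW.
Qed.

End GradientNorm.

Theorem lemma6p3 (R : realType) (N : nat) (alpha p : R)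
  (hN : (0 < N)%N) (halpha0 : 0 < alpha) (halpha1 : alpha < 1)
  (hp1 : 1 <= p) (hpN : (1 < N)%N -> p < N%:R / (N%:R - 1)) :
  exists C : R, forall (h : R) (n : nat) (r : R),
    0 < h -> (0 < n)%N -> 0 < r -> r < 1 ->
    {ae lebesgueN N, forall t, forall i : 'I_N,
       derivable (fundsol alpha h r n) (vec t) (unitv i)} /\
    (LpnormV p (grad (fundsol (N := N) alpha h r n)) <=
      (C / (n%:R * h) `^ (alpha * N%:R / 2 * (1 - 1 / p) + alpha / 2))%:E)%E.
Proof.
have p0 : 0 < p by lra.
pose ga := N%:R / 2 * (1 - 1 / p) + 2^-1 : R.
have ip1 : 1 / p <= 1 by rewrite ler_pdivrMr// mul1r.
have ip0 : 0 < 1 / p by rewrite divr_gt0.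
have ga0 : 0 <= ga by rewrite addr_ge0// mulr_ge0 ?divr_ge0 ?subr_ge0.
have Np : N%:R * (1 - 1 / p) < 1.
  have [N1|N1] := leqP N 1.
    have -> : N = 1%N by apply/eqP; rewrite eqn_leq N1.
    lra.
  have N10 : 0 < N%:R - 1 :> R by rewrite subr_gt0 (ltr_nat _ 1).
  have := hpN N1; rewrite ltr_pdivlMr// => h.
  have -> : N%:R * (1 - 1 / p) = (N%:R * p - N%:R) / p by field; rewrite gt_eqF.
  rewrite ltr_pdivrMr// mul1r; move: h; rewrite mulrBr mulr1 [p * _]mulrC; lra.
have ga1 : ga < 1.
  have -> : ga = N%:R * (1 - 1 / p) / 2 + 2^-1 by rewrite /ga; ring.
  lra.
have [C C0 hC] := subdens_moment halpha0 (ltW halpha1) ga0 ga1.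
exists ((gradC (N%:R / 2) `^ p * (8 * pi / p) `^ (N%:R / 2)) `^ (p^-1) * C).
move=> h [//|m] r h0 _ r0 r1; split.
  apply: (negligibleS _ (lebesgueN_vec0 (R := R) hN)) => t /= nd.
  apply: contrapT => t0; apply: nd => i.
  have et0 : 0 < enorm (vec t).
    by rewrite lt_neqAle enorm_ge0 andbT eq_sym; apply/eqP.
  by have [] := grad_fundsol_bound m halpha0 halpha1 h0 r0 r1 et0.
have mh0 : 0 < m.+1%:R * h by rewrite mulr_gt0.
have A0 : 0 < C * (m.+1%:R * h) `^ (- (alpha * ga)).
  by rewrite mulr_gt0 ?powR_gt0.
have := Lnorm_grad_fundsol_le hN halpha0 halpha1 h0 r0 r1 hp1 (erefl ga) ga0 A0 (hC h m h0).
have -> : alpha * N%:R / 2 * (1 - 1 / p) + alpha / 2 = alpha * ga.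
  by rewrite /ga; ring.
by rewrite powRN mulrA.
Qed.
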